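(* The following identity, with parameter $a$ and variable $x$, holds; it generalizes the summation formula at $x=\frac12$ recalled in the context: $$\sum_{n=1}^\infty\frac{(a)_n(1-a)_n}{(n!)^2}H_nx^n=\frac{\pi}{2\sin\pi a}\,{}_2F_1\left({a,1-a\atop 1};1-x\right)+\frac12\left(\psi\left(1-\tfrac a2\right)+\psi\left(\tfrac{a+1}2\right)-\psi(1)-\psi\left(\tfrac12\right)-\frac{\pi}{\sin\pi a}-\log\frac{1-x}{x}\right){}_2F_1\left({a,1-a\atop 1};x\right).$$
   Context: $(y)_n=y(y+1)\cdots(y+n-1)$ is the Pochhammer symbol, $H_n=\sum_{k=1}^n\frac1k$ is the $n$-th harmonic number, $\Gamma$ is the gamma function, and $\psi(y)=\Gamma'(y)/\Gamma(y)$ is the digamma function. ${}_2F_1\left({\alpha,\beta\atop\gamma};z\right)=\sum_{n=0}^\infty\frac{(\alpha)_n(\beta)_n}{n!(\gamma)_n}z^n$ is the Gauss hypergeometric function. The formula being generalized is $$\sum_{n=1}^\infty\frac{(a)_n(1-a)_n}{(n!)^2}\frac{H_n}{2^n}=\frac{\sqrt\pi}{2\,\Gamma\left(1-\frac a2\right)\Gamma\left(\frac{a+1}2\right)}\left(\psi\left(1-\tfrac a2\right)+\psi\left(\tfrac{a+1}2\right)-\psi(1)-\psi\left(\tfrac12\right)\right).$$ *)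

(* Defs.v *)
(* Stdlib reals with Coquelicot's complex numbers. *)
From Stdlib Require Import Reals Factorial.
From Coquelicot Require Import Coquelicot.

Open Scope C_scope.

(* Meaningful only when [u] converges; see [is_Clim_seq_unique]. *)
Definition Clim_seq (u : nat -> C) : C :=
  @lim C_CompleteNormedModule (filtermap u eventually).

Lemma is_Clim_seq_unique (u : nat -> C) (l : C) :
  filterlim u eventually (@locally C_UniformSpace l) -> Clim_seq u = l.
Proof.
intros H.
apply (@filterlim_locally_unique nat C_AbsRing C_NormedModule eventually _ u).
- intros P [eps HP].
  unfold filtermap.
  apply (filter_imp (fun n => @ball C_UniformSpace (Clim_seq u) eps (u n))).
  + intros n Hn; apply HP; exact Hn.
  + apply (@complete_cauchy C_CompleteNormedModule (filtermap u eventually) _).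
    intros e; exists l; apply H; exists e; auto.
- exact H.
Qed.

Definition is_Cseries (a : nat -> C) (s : C) : Prop :=
  @is_series C_AbsRing C_NormedModule a s.

Definition Cseries (a : nat -> C) : C :=
  Clim_seq (@sum_n C_AbelianMonoid a).

Definition Cexp (z : C) : C := exp (Re z) * (cos (Im z), sin (Im z)).

Definition Csin (z : C) : C := (Cexp (Ci * z) - Cexp (- (Ci * z))) / (2 * Ci).

(* Principal branch, with values in (-PI, PI] for z <> 0. *)
Definition Carg (z : C) : R :=
  if Rle_dec 0 (Im z) then acos (Re z / Cmod z) else (- acos (Re z / Cmod z))%R.

Definition Clog (z : C) : C := (ln (Cmod z), Carg z).

Fixpoint pochhammer (y : C) (n : nat) : C :=
  match n with
  | O => 1
  | S k => pochhammer y k * (y + INR k)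
  end.

Definition harmonic (n : nat) : R := sum_n_m (fun k => / INR k)%R 1 n.

(* Euler's limit  n! n^(z-1) / (z)_n,  which converges to the gamma function on
   all of C except the poles 0, -1, -2, ... and needs no analytic continuation. *)
Definition Gamma (z : C) : C :=
  Clim_seq (fun n => INR (fact n) * Cexp ((z - 1) * ln (INR n)) / pochhammer z n).

Definition digamma (z : C) : C := C_derive Gamma z / Gamma z.

Definition hyp2F1 (alpha beta gamma z : C) : C :=
  Cseries (fun n =>
    pochhammer alpha n * pochhammer beta n /
    (INR (fact n) * pochhammer gamma n) * z ^ n).

(* Main.v *)
Require Import Defs.
From Stdlib Require Import Reals Ranalysis5 Factorial Lra Lia FunctionalExtensionality.
From Coquelicot Require Import Coquelicot.
Open Scope C_scope.

(** Write F(x) for 2F1(a, 1-a; 1; x) and G(x) for the series with harmonic numbers.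

    F satisfies x(1-x) y'' + (1-2x) y' = a(1-a) y, an equation invariant under
    x -> 1-x, while G satisfies the same equation with the extra right-hand side
    F' [harmonic_ode]. The function log(x/(1-x)) F(x) / 2 has the same right-hand
    side, so

      D(x) = G(x) - A F(x) - B F(1-x) - log(x/(1-x)) F(x) / 2

    is a solution for all constants A, B [hyp_solution_combination], and the theorem
    says that D = 0 for B = PI / (2 sin(PI a)) and A + B = Psi / 2, where Psi is the
    combination of four digamma values. Two conditions determine a solution.

    - Behaviour at 0. F(1-x) ~ - (sin(PI a) / PI) log x, so that the choice of B removes the
      logarithm from D. Then the Wronskian of F and D, multiplied by x(1-x), is a
      constant that tends to 0 at 0 [wronskian_F_D].
    - Value at the midpoint. D(1/2) = 0 amounts to G(1/2) = (Psi/2) F(1/2), which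
      is the summation formula at 1/2 [harmonic_at_half]. As F(1-x) and F(x) agree at
      1/2, the Wronskian of F(1-x) and D vanishes too [wronskian_F2_D].

    The Wronskian of F(x) and F(1-x) is not zero, hence D = 0 [D_zero].

    The two inputs both come from Bailey's theorem for F(a, 1-a; g; 1/2). A telescoping
    certificate shows that g -> g+2 multiplies this value by a rational function of
    g, and the value tends to 1 for large g; this gives an infinite product
    [bailey_product]. Differentiating the certificate in g gives the same for the
    series with harmonic numbers: G(1/2)/F(1/2) is the sum of the logarithmic
    derivatives of the factors [bailey_log_derivative], which is Psi/2 by Euler's limit
    for the digamma function [digamma_tends]. For g = 1/2 Bailey's value is also an
    elementary cosine [hyp_one_half_cos], and comparing the two evaluations
    yields the limit sin(PI a) / PI of n (a)_n (1-a)_n / (n!)^2 [log_coef_tends], whence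
    the behaviour of F(1-x) at 0 by Abel's theorem [Abel_near0].

    Infinite sums and products are handled through explicit estimates that are
    uniform in the number of terms; in particular Gamma is differentiated directly
    from its defining limit. *)

(** * Limits and derivatives of complex functions *)

(** Stated with [Cmod], so that complex limits reduce to real squeeze arguments;
    [Ctends_filterlim] identifies it with the filter notion. *)
Definition Ctends (u : nat -> C) (l : C) : Prop :=
  is_lim_seq (fun n => Cmod (u n - l)) 0%R.

Lemma Ctends_of_le (u : nat -> C) (l : C) (v : nat -> R) :
  (forall n, (Cmod (u n - l) <= v n)%R) -> is_lim_seq v 0%R -> Ctends u l.
Proof.
intros H Hv.
apply is_lim_seq_le_le with (u := fun _ => 0%R) (w := v).
- intros n; split; [apply Cmod_ge_0 | apply H].
- apply is_lim_seq_const.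
- exact Hv.
Qed.

Lemma Ctends_ext (u v : nat -> C) (l : C) :
  (forall n, u n = v n) -> Ctends u l -> Ctends v l.
Proof.
intros H; apply is_lim_seq_ext; intros n; rewrite H; reflexivity.
Qed.

Lemma Ctends_eq (u : nat -> C) (l m : C) : Ctends u l -> l = m -> Ctends u m.
Proof. intros H <-; exact H. Qed.

Lemma Ctends_const (l : C) : Ctends (fun _ => l) l.
Proof.
apply Ctends_of_le with (v := fun _ => 0%R); [|apply is_lim_seq_const].
intros n; replace (l - l) with (RtoC 0) by ring; rewrite Cmod_0; lra.
Qed.

Lemma is_lim_seq_0_plus (u v : nat -> R) :
  is_lim_seq u 0%R -> is_lim_seq v 0%R -> is_lim_seq (fun n => (u n + v n)%R) 0%R.
Proof.
intros Hu Hv; replace (Finite 0) with (Finite (0 + 0)) by (f_equal; ring).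
apply is_lim_seq_plus'; assumption.
Qed.

Lemma is_lim_seq_0_scal (k : R) (u : nat -> R) :
  is_lim_seq u 0%R -> is_lim_seq (fun n => (k * u n)%R) 0%R.
Proof.
intros Hu; replace (Finite 0) with (Finite (k * 0)) by (f_equal; ring).
apply is_lim_seq_mult'; [apply is_lim_seq_const | exact Hu].
Qed.

Lemma Ctends_plus (u v : nat -> C) (l m : C) :
  Ctends u l -> Ctends v m -> Ctends (fun n => u n + v n) (l + m).
Proof.
intros Hu Hv.
apply Ctends_of_le with (v := fun n => (Cmod (u n - l) + Cmod (v n - m))%R).
- intros n; replace (u n + v n - (l + m)) with ((u n - l) + (v n - m)) by ring.
  apply Cmod_triangle.
- apply is_lim_seq_0_plus; assumption.
Qed.

Lemma Ctends_mult (u v : nat -> C) (l m : C) :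
  Ctends u l -> Ctends v m -> Ctends (fun n => u n * v n) (l * m).
Proof.
intros Hu Hv.
apply Ctends_of_le with (v := fun n => (Cmod (u n - l) * Cmod (v n - m)
   + (Cmod l * Cmod (v n - m) + Cmod m * Cmod (u n - l)))%R).
- intros n.
  replace (u n * v n - l * m)
    with ((u n - l) * (v n - m) + (l * (v n - m) + m * (u n - l))) by ring.
  eapply Rle_trans; [apply Cmod_triangle|]; rewrite Cmod_mult.
  apply Rplus_le_compat_l.
  eapply Rle_trans; [apply Cmod_triangle|]; rewrite !Cmod_mult; lra.
- apply is_lim_seq_0_plus; [|apply is_lim_seq_0_plus].
  + replace (Finite 0) with (Finite (0 * 0)) by (f_equal; ring).
    apply is_lim_seq_mult'; assumption.
  + apply is_lim_seq_0_scal; exact Hv.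
  + apply is_lim_seq_0_scal; exact Hu.
Qed.

Lemma Ctends_scal (k : C) (u : nat -> C) (l : C) :
  Ctends u l -> Ctends (fun n => k * u n) (k * l).
Proof.
apply Ctends_mult, Ctends_const.
Qed.

Lemma Ctends_minus (u v : nat -> C) (l m : C) :
  Ctends u l -> Ctends v m -> Ctends (fun n => u n - v n) (l - m).
Proof.
intros Hu Hv; replace (l - m) with (l + - (1) * m) by ring.
apply Ctends_ext with (fun n => u n + - (1) * v n); [intros; ring|].
apply Ctends_plus; [|apply Ctends_scal]; assumption.
Qed.

Lemma Ctends_unique (u : nat -> C) (l m : C) :
  Ctends u l -> Ctends u m -> l = m.
Proof.
intros Hl Hm.
assert (H : Ctends (fun n => u n - u n) (l - m)) by (apply Ctends_minus; assumption).
assert (E : Cmod (l - m) = 0%R).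
{ apply (Ctends_ext _ (fun _ => RtoC 0)) in H; [|intros; ring].
  unfold Ctends in H; apply is_lim_seq_unique in H.
  rewrite Lim_seq_const in H; injection H as H.
  rewrite <- H; rewrite <- Cmod_opp; f_equal; ring. }
apply Cmod_eq_0 in E; replace l with (l - m + m) by ring; rewrite E; ring.
Qed.

Lemma Ctends_Cmod (u : nat -> C) (l : C) :
  Ctends u l -> is_lim_seq (fun n => Cmod (u n)) (Cmod l).
Proof.
intros H; apply is_lim_seq_le_le with
  (u := fun n => (Cmod l - Cmod (u n - l))%R) (w := fun n => (Cmod l + Cmod (u n - l))%R).
- intros n; split.
  + pose proof (Cmod_triangle (u n) (- (u n - l))) as T.
    replace (u n + - (u n - l)) with l in T by ring; rewrite Cmod_opp in T; lra.
  + pose proof (Cmod_triangle l (u n - l)) as T.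
    replace (l + (u n - l)) with (u n) in T by ring; lra.
- replace (Finite (Cmod l)) with (Finite (Cmod l - 0)) by (f_equal; ring).
  apply is_lim_seq_minus'; [apply is_lim_seq_const | exact H].
- replace (Finite (Cmod l)) with (Finite (Cmod l + 0)) by (f_equal; ring).
  apply is_lim_seq_plus'; [apply is_lim_seq_const | exact H].
Qed.

Lemma Ctends_incr_1 (u : nat -> C) (l : C) :
  Ctends (fun n => u (S n)) l <-> Ctends u l.
Proof.
symmetry; apply (is_lim_seq_incr_1 (fun n => Cmod (u n - l))).
Qed.

Lemma Ctends_RtoC (u : nat -> R) (l : R) :
  is_lim_seq u l -> Ctends (fun n => RtoC (u n)) l.
Proof.
intros H; unfold Ctends.
apply is_lim_seq_ext with (fun n => Rabs (u n - l)).
{ intros n; rewrite <- RtoC_minus, Cmod_R; reflexivity. }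
rewrite <- (Rabs_R0); apply (is_lim_seq_abs _ 0%R).
replace (Finite 0) with (Finite (l - l)) by (f_equal; ring).
apply is_lim_seq_minus'; [exact H | apply is_lim_seq_const].
Qed.

Lemma Ctends_spec (u : nat -> C) (l : C) :
  Ctends u l <->
  forall eps : R, (0 < eps)%R -> exists N, forall n, (N <= n)%nat -> (Cmod (u n - l) < eps)%R.
Proof.
split.
- intros H eps He; apply is_lim_seq_spec in H.
  destruct (H (mkposreal eps He)) as [N HN]; exists N; intros n Hn.
  specialize (HN n Hn); simpl in HN.
  rewrite Rminus_0_r, Rabs_pos_eq in HN by apply Cmod_ge_0; exact HN.
- intros H; apply is_lim_seq_spec; intros [eps He].
  destruct (H eps He) as [N HN]; exists N; intros n Hn; simpl.
  rewrite Rminus_0_r, Rabs_pos_eq by apply Cmod_ge_0; apply HN, Hn.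
Qed.

Lemma Ctends_filterlim (u : nat -> C) (l : C) :
  Ctends u l <-> filterlim u eventually (@locally C_UniformSpace l).
Proof.
rewrite Ctends_spec; split.
- intros H P HP; apply locally_C in HP; destruct HP as [[eps He] HP].
  destruct (H eps He) as [N HN]; exists N; intros n Hn; apply HP, HN, Hn.
- intros H eps He.
  apply (H (fun y => (Cmod (y - l) < eps)%R)).
  apply locally_C; exists (mkposreal eps He); intros y Hy; exact Hy.
Qed.

Lemma Clim_seq_eq (u : nat -> C) (l : C) : Ctends u l -> Clim_seq u = l.
Proof.
intros H; apply is_Clim_seq_unique, Ctends_filterlim, H.
Qed.

Lemma is_Cseries_tends (a : nat -> C) (s : C) :
  is_Cseries a s <-> Ctends (@sum_n C_AbelianMonoid a) s.
Proof.
rewrite Ctends_filterlim; reflexivity.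
Qed.

Lemma Cseries_eq (a : nat -> C) (s : C) : is_Cseries a s -> Cseries a = s.
Proof.
intros H; apply Clim_seq_eq, is_Cseries_tends, H.
Qed.

Lemma Ctends_complete (u : nat -> C) (b : nat -> R) :
  (forall n m, (n <= m)%nat -> (Cmod (u m - u n) <= b n)%R) ->
  is_lim_seq b 0%R -> exists l : C, Ctends u l.
Proof.
intros H Hb.
assert (Hc : cauchy (T := C_UniformSpace) (filtermap u eventually)).
{ intros [eps He]; apply is_lim_seq_spec in Hb.
  destruct (Hb (mkposreal eps He)) as [N HN]; exists (u N).
  exists N; intros n Hn.
  apply C_NormedModule_mixin_compat1.
  eapply Rle_lt_trans; [apply (H N n Hn)|].
  specialize (HN N (Nat.le_refl _)); simpl in HN; rewrite Rminus_0_r in HN.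
  eapply Rle_lt_trans; [apply Rle_abs | exact HN]. }
exists (@lim C_CompleteNormedModule (filtermap u eventually)).
apply Ctends_filterlim; intros P [eps HP].
pose proof (@complete_cauchy C_CompleteNormedModule (filtermap u eventually) _ Hc eps) as K.
apply (filter_imp (F := filtermap u eventually) _ P HP K).
Qed.

Lemma Ctends_inv (u : nat -> C) (l : C) :
  l <> 0 -> Ctends u l -> (forall n, u n <> 0) -> Ctends (fun n => / u n) (/ l).
Proof.
intros Hl H Hu; unfold Ctends.
apply is_lim_seq_ext with (fun n => (Cmod (u n - l) / (Cmod (u n) * Cmod l))%R).
{ intros n; rewrite <- Cmod_mult, <- Cmod_div by (apply Cmult_neq_0; auto).
  replace (/ u n - / l) with (- ((u n - l) / (u n * l))) by (field; auto).
  rewrite Cmod_opp; reflexivity. }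
pose proof (proj1 (Cmod_gt_0 l) Hl) as P.
replace (Finite 0) with (Finite (0 / (Cmod l * Cmod l))) by (f_equal; field; lra).
apply is_lim_seq_div'; [exact H | |apply Rgt_not_eq; nra].
apply is_lim_seq_mult'; [apply Ctends_Cmod, H | apply is_lim_seq_const].
Qed.

(** [C] as a normed module over itself is the setting in which the product and
    the chain rule are available. *)
Definition is_Cderive (f : C -> C) (x l : C) : Prop :=
  @is_derive C_AbsRing (AbsRing_NormedModule C_AbsRing) f x l.

Lemma is_Cderive_spec (f : C -> C) (x l : C) :
  is_Cderive f x l <->
  forall eps : R, (0 < eps)%R -> exists d : R, (0 < d)%R /\
    forall h, (Cmod h < d)%R -> (Cmod (f (x + h)%C - f x - h * l) <= eps * Cmod h)%R.
Proof.
split.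
- intros [_ H] eps He.
  destruct (H x (fun P HP => HP) (mkposreal eps He)) as [[d Hd] K].
  exists d; split; [exact Hd|]; intros h Hh.
  specialize (K (x + h)).
  replace h with (x + h - x) at 2 3 by ring.
  apply K; change (Cmod (x + h - x) < d)%R; replace (x + h - x) with h by ring; exact Hh.
- intros H; split; [apply is_linear_scal_l|].
  intros y Hy.
  apply (@is_filter_lim_locally_unique C_AbsRing (AbsRing_NormedModule C_AbsRing)) in Hy.
  subst y.
  intros [eps He]; destruct (H eps He) as [d [Hd K]].
  exists (mkposreal d Hd); intros y Hy.
  specialize (K (y - x) Hy).
  assert (E : @eq C (x + (y - x)) y) by ring.
  rewrite E in K; exact K.
Qed.

(** The derivatives not given by the calculus rules (exponential, power series, gamma
    function, inverse) all come from an explicit quadratic remainder. *)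
Lemma is_Cderive_of_quadratic (f : C -> C) (x l : C) (d M : R) :
  (0 < d)%R ->
  (forall h, (Cmod h < d)%R -> (Cmod (f (x + h)%C - f x - h * l) <= M * Cmod h ^ 2)%R) ->
  is_Cderive f x l.
Proof.
intros Hd H; apply is_Cderive_spec; intros eps He.
assert (Hm : (0 < eps / (Rabs M + 1))%R).
{ apply Rdiv_lt_0_compat; [exact He | pose proof (Rabs_pos M); lra]. }
exists (Rmin d (eps / (Rabs M + 1))); split; [apply Rmin_pos; assumption|].
intros h Hh; eapply Rle_trans.
{ apply H; eapply Rlt_le_trans; [exact Hh | apply Rmin_l]. }
assert (K : (Cmod h * (Rabs M + 1) <= eps)%R).
{ apply Rle_div_r; [pose proof (Rabs_pos M); lra|].
  apply Rlt_le; eapply Rlt_le_trans; [exact Hh | apply Rmin_r]. }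
pose proof (Cmod_ge_0 h); pose proof (Rle_abs M); nra.
Qed.

Lemma is_Cderive_const (k x : C) : is_Cderive (fun _ => k) x 0.
Proof. exact (@is_derive_const C_AbsRing (AbsRing_NormedModule C_AbsRing) k x). Qed.

Lemma is_Cderive_id (x : C) : is_Cderive (fun y => y) x 1.
Proof. exact (@is_derive_id C_AbsRing x). Qed.

Lemma is_Cderive_eq (f : C -> C) (x l m : C) :
  is_Cderive f x l -> l = m -> is_Cderive f x m.
Proof. intros H <-; exact H. Qed.

Lemma is_Cderive_plus (f g : C -> C) (x l m : C) :
  is_Cderive f x l -> is_Cderive g x m -> is_Cderive (fun y => f y + g y) x (l + m).
Proof. exact (@is_derive_plus C_AbsRing (AbsRing_NormedModule C_AbsRing) f g x l m). Qed.

Lemma is_Cderive_minus (f g : C -> C) (x l m : C) :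
  is_Cderive f x l -> is_Cderive g x m -> is_Cderive (fun y => f y - g y) x (l - m).
Proof. exact (@is_derive_minus C_AbsRing (AbsRing_NormedModule C_AbsRing) f g x l m). Qed.

Lemma is_Cderive_opp (f : C -> C) (x l : C) :
  is_Cderive f x l -> is_Cderive (fun y => - f y) x (- l).
Proof. exact (@is_derive_opp C_AbsRing (AbsRing_NormedModule C_AbsRing) f x l). Qed.

Lemma is_Cderive_mult (f g : C -> C) (x l m : C) :
  is_Cderive f x l -> is_Cderive g x m ->
  is_Cderive (fun y => f y * g y) x (l * g x + f x * m).
Proof.
intros Hf Hg; exact (@is_derive_mult C_AbsRing f g x l m Hf Hg Cmult_comm).
Qed.

Lemma is_Cderive_comp (f g : C -> C) (x l m : C) :
  is_Cderive f (g x) l -> is_Cderive g x m -> is_Cderive (fun y => f (g y)) x (m * l).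
Proof. exact (@is_derive_comp C_AbsRing (AbsRing_NormedModule C_AbsRing) f g x l m). Qed.

Lemma Ctends_of_Cderive (f : C -> C) (x l : C) (u : nat -> C) :
  is_Cderive f x l -> Ctends u x -> Ctends (fun n => f (u n)) (f x).
Proof.
intros Hf Hu.
assert (Hc : filterlim f (locally (T := AbsRing_UniformSpace C_AbsRing) x)
   (locally (T := AbsRing_UniformSpace C_AbsRing) (f x))).
{ apply (@ex_derive_continuous C_AbsRing (AbsRing_NormedModule C_AbsRing)); exists l; exact Hf. }
apply Ctends_spec; intros eps He.
destruct (Hc (fun y => (Cmod (y - f x) < eps)%R)) as [[d Hd] K].
{ exists (mkposreal eps He); intros y Hy; exact Hy. }
destruct (proj1 (Ctends_spec u x) Hu d Hd) as [N HN].
exists N; intros n Hn; apply K, HN, Hn.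
Qed.

Lemma Re_Cderive_line (f : C -> C) (p q l : C) (s : R) :
  is_Cderive f (p + s * q) l ->
  is_derive (fun t : R => Re (f (p + t * q))) s (Re (q * l)) /\
  is_derive (fun t : R => Im (f (p + t * q))) s (Im (q * l)).
Proof.
intros H.
assert (K : forall g : C -> R,
  (forall x y, g (x - y)%C = g x - g y)%R -> (forall (r : R) y, g (r * y)%C = r * g y)%R ->
  (forall x, (Rabs (g x) <= Cmod x)%R) ->
  is_derive (fun t : R => g (f (p + t * q))) s (g (q * l))).
{ intros g G1 G2 G3; apply is_derive_Reals.
  intros eps He.
  destruct (proj1 (is_Cderive_spec _ _ _) H (eps / (2 * (Cmod q + 1))))%R as [d [Hd D]].
  { apply Rdiv_lt_0_compat; [exact He | pose proof (Cmod_ge_0 q); lra]. }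
  assert (Hd' : (0 < d / (Cmod q + 1))%R).
  { apply Rdiv_lt_0_compat; [exact Hd | pose proof (Cmod_ge_0 q); lra]. }
  exists (mkposreal _ Hd'); simpl; intros h Hh0 Hh.
  apply Rlt_div_r in Hh; [|pose proof (Cmod_ge_0 q); lra].
  assert (Hq : (Cmod (h * q) < d)%R).
  { rewrite Cmod_mult, Cmod_R; pose proof (Rabs_pos h); lra. }
  specialize (D _ Hq).
  replace ((g (f (p + RtoC (s + h) * q)%C) - g (f (p + s * q)%C)) / h - g (q * l)%C)%R
    with (g (f (p + s * q + h * q) - f (p + s * q) - h * q * l)%C / h)%R.
  2:{ rewrite !G1, <- Cmult_assoc, G2.
      replace (p + RtoC (s + h) * q) with (p + s * q + h * q) by (rewrite RtoC_plus; ring).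
      field; exact Hh0. }
  pose proof (Rabs_pos_lt h Hh0) as Ph.
  rewrite Rabs_div by exact Hh0.
  apply Rlt_div_l; [exact Ph|].
  eapply Rle_lt_trans; [apply G3|]; eapply Rle_lt_trans; [exact D|].
  rewrite Cmod_mult, Cmod_R.
  replace (eps / (2 * (Cmod q + 1)) * (Rabs h * Cmod q))%R
    with ((eps * Rabs h) * (Cmod q / (2 * (Cmod q + 1))))%R
    by (field; pose proof (Cmod_ge_0 q); lra).
  rewrite <- (Rmult_1_r (eps * Rabs h)) at 2.
  apply Rmult_lt_compat_l; [nra|].
  apply Rlt_div_l; pose proof (Cmod_ge_0 q); lra. }
split; apply K.
- intros x y; unfold Re, Im, Cminus, Cplus, Copp; simpl; ring.
- intros r y; unfold Re, Im, Cmult; simpl; ring.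
- apply re_le_Cmod.
- intros x y; unfold Re, Im, Cminus, Cplus, Copp; simpl; ring.
- intros r y; unfold Re, Im, Cmult; simpl; ring.
- intros x; eapply Rle_trans; [|apply Rmax_Cmod]; apply Rmax_r.
Qed.

Lemma Cmod_le_Re_Im (z : C) : (Cmod z <= Rabs (Re z) + Rabs (Im z))%R.
Proof.
replace z with ((Re z, 0%R) + (0%R, Im z)) at 1
  by (destruct z; apply injective_projections; simpl; ring).
eapply Rle_trans; [apply Cmod_triangle|].
apply Rplus_le_compat.
- change (Re z, 0%R) with (RtoC (Re z)); rewrite Cmod_R; lra.
- replace (0%R, Im z) with (Ci * RtoC (Im z))
    by (apply injective_projections; simpl; ring).
  rewrite Cmod_mult, Cmod_Ci, Cmod_R; lra.
Qed.

(** The mean value theorem is applied to the real and to the imaginary part,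
    whence the factor 2. *)
Lemma Cmean_value (f f' : C -> C) (p q : C) (M : R) :
  (forall s : R, (0 <= s <= 1)%R ->
     is_Cderive f (p + s * q) (f' (p + s * q)) /\ (Cmod (f' (p + s * q)%C) <= M)%R) ->
  (Cmod (f (p + q)%C - f p) <= 2 * (Cmod q * M))%R.
Proof.
intros H.
assert (B : forall s : R, (0 <= s <= 1)%R ->
  (Rabs (Re (q * f' (p + s * q)%C)) <= Cmod q * M /\
   Rabs (Im (q * f' (p + s * q)%C)) <= Cmod q * M)%R).
{ intros s Hs; destruct (H s Hs) as [_ K].
  assert (K' : (Cmod (q * f' (p + s * q)%C) <= Cmod q * M)%R).
  { rewrite Cmod_mult; apply Rmult_le_compat_l; [apply Cmod_ge_0 | exact K]. }
  split; (eapply Rle_trans; [|exact K']); [apply re_le_Cmod|].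
  eapply Rle_trans; [|apply Rmax_Cmod]; apply Rmax_r. }
assert (E : forall s : R, (0 <= s <= 1)%R ->
  is_derive (fun t : R => Re (f (p + t * q))) s (Re (q * f' (p + s * q))) /\
  is_derive (fun t : R => Im (f (p + t * q))) s (Im (q * f' (p + s * q)))).
{ intros s Hs; apply Re_Cderive_line, H, Hs. }
replace (f (p + q)) with (f (p + RtoC 1 * q)) by (f_equal; ring).
replace (f p) with (f (p + RtoC 0 * q)) by (f_equal; ring).
assert (K : forall g dg : R -> R, (forall s, (0 <= s <= 1)%R -> is_derive g s (dg s)) ->
  (forall s, (0 <= s <= 1)%R -> (Rabs (dg s) <= Cmod q * M)%R) ->
  (Rabs (g 1 - g 0) <= Cmod q * M)%R).
{ intros g dg Hg Hb.
  assert (Hmin : Rmin 0 1 = 0%R) by (apply Rmin_left; lra).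
  assert (Hmax : Rmax 0 1 = 1%R) by (apply Rmax_right; lra).
  destruct (MVT_gen g 0 1 dg) as [c [Hc Ec]].
  - rewrite Hmin, Hmax; intros s Hs; apply Hg; lra.
  - rewrite Hmin, Hmax; intros s Hs.
    apply continuity_pt_filterlim, (ex_derive_continuous (V := R_NormedModule) g s).
    exists (dg s); apply Hg; lra.
  - rewrite Hmin, Hmax in Hc; rewrite Ec.
    replace (dg c * (1 - 0))%R with (dg c) by ring; apply Hb, Hc. }
pose proof (K _ _ (fun s Hs => proj1 (E s Hs)) (fun s Hs => proj1 (B s Hs))) as K1.
pose proof (K _ _ (fun s Hs => proj2 (E s Hs)) (fun s Hs => proj2 (B s Hs))) as K2.
eapply Rle_trans; [apply Cmod_le_Re_Im|].
cbv beta in K1, K2.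
set (u := f (p + RtoC 1 * q)) in *; set (v := f (p + RtoC 0 * q)) in *.
change (Re (u - v)) with (Re u - Re v)%R; change (Im (u - v)) with (Im u - Im v)%R.
lra.
Qed.

Lemma Cderive_zero_const (f : C -> C) (p q : C) :
  (forall s : R, (0 <= s <= 1)%R -> is_Cderive f (p + s * (q - p)) 0) -> f q = f p.
Proof.
intros H.
pose proof (Cmean_value f (fun _ => 0) p (q - p) 0) as K.
replace (p + (q - p)) with q in K by ring.
assert (E : (Cmod (f q - f p) <= 0)%R).
{ eapply Rle_trans; [apply K|lra].
  intros s Hs; split; [apply H, Hs | rewrite Cmod_0; lra]. }
assert (E' : Cmod (f q - f p) = 0%R) by (pose proof (Cmod_ge_0 (f q - f p)); lra).
apply Cmod_eq_0 in E'; replace (f q) with (f q - f p + f p) by ring; rewrite E'; ring.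
Qed.

(** * The complex exponential *)

Lemma Cexp_plus (x y : C) : Cexp (x + y) = Cexp x * Cexp y.
Proof.
unfold Cexp; destruct x as [a b], y as [c d]; simpl.
rewrite exp_plus, cos_plus, sin_plus.
apply injective_projections; simpl; ring.
Qed.

Lemma Cexp_RtoC (r : R) : Cexp r = exp r.
Proof.
unfold Cexp; simpl; rewrite cos_0, sin_0; apply injective_projections; simpl; ring.
Qed.

Lemma Cexp_0 : Cexp 0 = 1.
Proof. rewrite Cexp_RtoC, exp_0; reflexivity. Qed.

Lemma Cmod_Cexp (z : C) : Cmod (Cexp z) = exp (Re z).
Proof.
unfold Cexp; rewrite Cmod_mult, Cmod_R, Rabs_pos_eq by (left; apply exp_pos).
replace (Cmod (cos (Im z), sin (Im z))) with 1%R; [ring|].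
unfold Cmod; simpl fst; simpl snd.
replace (cos (Im z) ^ 2 + sin (Im z) ^ 2)%R with 1%R
  by (pose proof (sin2_cos2 (Im z)) as H; unfold Rsqr in H; simpl; lra).
symmetry; apply sqrt_1.
Qed.

Lemma Cexp_neq_0 (z : C) : Cexp z <> 0.
Proof.
apply Cmod_gt_0; rewrite Cmod_Cexp; apply exp_pos.
Qed.

Lemma Cexp_opp (z : C) : Cexp (- z) = / Cexp z.
Proof.
assert (H : Cexp z * Cexp (- z) = 1).
{ rewrite <- Cexp_plus, Cplus_opp_r; apply Cexp_0. }
replace (Cexp (- z)) with (/ Cexp z * (Cexp z * Cexp (- z)))
  by (field; apply Cexp_neq_0).
rewrite H; ring.
Qed.

Lemma sin_abs_le (y : R) : (Rabs (sin y) <= Rabs y)%R.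
Proof.
assert (P : forall t, (0 <= t -> Rabs (sin t) <= t)%R).
{ intros t Ht; apply Rabs_le; split.
  - destruct (Rle_lt_dec t PI) as [H|H].
    + pose proof (sin_ge_0 t Ht H); lra.
    + pose proof (SIN_bound t); pose proof PI2_1; lra.
  - destruct Ht as [Ht|<-]; [left; apply sin_lt_x, Ht | rewrite sin_0; lra]. }
destruct (Rle_lt_dec 0 y) as [H|H].
- rewrite (Rabs_pos_eq y H); apply P, H.
- rewrite (Rabs_left y H), <- Rabs_Ropp, <- sin_neg; apply P; lra.
Qed.

Lemma cos_quadratic (y : R) : (1 - y ^ 2 / 2 <= cos y <= 1)%R.
Proof.
split; [|apply COS_bound].
replace y with (2 * (y / 2))%R at 2 by field.
rewrite cos_2a_sin; pose proof (sin_abs_le (y / 2)) as H.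
apply Rsqr_le_abs_1 in H; unfold Rsqr in H; nra.
Qed.

Lemma sin_quadratic (y : R) : (Rabs y <= 1)%R -> (Rabs (sin y - y) <= y ^ 2)%R.
Proof.
intros Hy.
destruct (MVT_gen (fun t => sin t - t)%R 0 y (fun t => cos t - 1)%R) as [c [Hc E]].
- intros t _; auto_derive; [exact I | ring].
- intros t _; apply continuity_pt_minus; [apply continuity_sin | apply derivable_continuous_pt, derivable_pt_id].
- rewrite sin_0, !Rminus_0_r in E; rewrite E, Rabs_mult.
  pose proof (cos_quadratic c) as K.
  assert (Rabs c <= Rabs y)%R.
  { unfold Rmin, Rmax in Hc; destruct (Rle_dec 0 y) as [H|H].
    - rewrite !Rabs_pos_eq; lra.
    - rewrite !Rabs_left1; lra. }
  assert (Hcc : (c ^ 2 <= Rabs y)%R).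
  { rewrite <- (pow2_abs c); pose proof (Rabs_pos c); nra. }
  rewrite <- (pow2_abs y); rewrite (Rabs_left1 (cos c - 1)) by lra.
  pose proof (Rabs_pos y); nra.
Qed.

Lemma exp_quadratic (x : R) : (Rabs x <= 1 / 2)%R -> (1 + x <= exp x <= 1 + x + 2 * x ^ 2)%R.
Proof.
intros H; apply Rabs_le_between in H; split; [apply exp_ineq1_le|].
pose proof (exp_ineq1_le (- x)) as K; rewrite exp_Ropp in K.
pose proof (exp_pos x) as P.
assert (exp x * (1 - x) <= 1)%R.
{ replace 1%R with (exp x * / exp x)%R at 2 by (field; lra).
  apply Rmult_le_compat_l; lra. }
assert (E : (exp x <= / (1 - x))%R).
{ apply (Rmult_le_reg_r (1 - x)); [lra|]; rewrite Rinv_l; lra. }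
eapply Rle_trans; [exact E|].
apply (Rmult_le_reg_r (1 - x)); [lra|]; rewrite Rinv_l by lra; nra.
Qed.

Lemma Cexp_quadratic_small (z : C) :
  (Cmod z <= 1 / 2)%R -> (Cmod (Cexp z - 1 - z) <= 6 * Cmod z ^ 2)%R.
Proof.
intros Hz; destruct z as [x y].
pose proof (Rmax_Cmod (x, y)) as Hm; simpl in Hm.
assert (Hx : (Rabs x <= Cmod (x, y))%R) by (eapply Rle_trans; [apply Rmax_l | exact Hm]).
assert (Hy : (Rabs y <= Cmod (x, y))%R) by (eapply Rle_trans; [apply Rmax_r | exact Hm]).
set (r := Cmod (x, y)) in *.
assert (E : Cexp (x, y) - 1 - (x, y)
  = ((exp x - 1 - x) + exp x * (cos y - 1), (exp x - 1) * sin y + (sin y - y))%R).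
{ unfold Cexp; apply injective_projections; simpl; ring. }
rewrite E; eapply Rle_trans; [apply Cmod_le_Re_Im|]; simpl Re; simpl Im.
pose proof (exp_quadratic x ltac:(lra)) as E1.
pose proof (cos_quadratic y) as E2.
pose proof (sin_quadratic y ltac:(lra)) as E3.
pose proof (sin_abs_le y) as E4.
pose proof (Rabs_pos x) as Px; pose proof (Rabs_pos y) as Py.
pose proof (pow2_abs x) as Sx; pose proof (pow2_abs y) as Sy.
assert (X2 : (x ^ 2 <= r ^ 2)%R) by nra.
assert (Y2 : (y ^ 2 <= r ^ 2)%R) by nra.
pose proof (Rle_abs x) as Ax.
assert (Ex : (exp x <= 2)%R) by nra.
pose proof (exp_pos x) as Pe.
assert (B1 : (Rabs (exp x - 1 - x + exp x * (cos y - 1)) <= 3 * r ^ 2)%R).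
{ apply Rabs_le; split; nra. }
assert (B2 : (Rabs (exp x - 1) <= 2 * r)%R).
{ pose proof (Rle_abs (- x)) as Ax'; rewrite Rabs_Ropp in Ax'; apply Rabs_le; split; nra. }
assert (B3 : (Rabs ((exp x - 1) * sin y + (sin y - y)) <= 3 * r ^ 2)%R).
{ eapply Rle_trans; [apply Rabs_triang|]; rewrite Rabs_mult.
  pose proof (Rabs_pos (exp x - 1)); pose proof (Rabs_pos (sin y)); nra. }
unfold Re, Im; simpl fst; simpl snd; lra.
Qed.

(** The shape is immaterial: it majorizes |e^z - 1 - z| / |z|^2 on the disc of
    radius [r]. *)
Definition expK (r : R) : R := (10 + 4 * r + 4 * exp r)%R.

Lemma expK_pos (r : R) : (0 <= r)%R -> (0 < expK r)%R.
Proof. intros H; unfold expK; pose proof (exp_pos r); lra. Qed.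

Lemma Cexp_quadratic (z : C) (r : R) :
  (Cmod z <= r)%R -> (Cmod (Cexp z - 1 - z) <= expK r * Cmod z ^ 2)%R.
Proof.
intros Hr; pose proof (Cmod_ge_0 z) as Pz.
pose proof (exp_pos r) as Pe.
destruct (Rle_lt_dec (Cmod z) (1 / 2)) as [H|H].
- eapply Rle_trans; [apply Cexp_quadratic_small, H|].
  apply Rmult_le_compat_r; [apply pow2_ge_0 | unfold expK; lra].
- (* away from 0 the three terms are bounded separately *)
  assert (B : (Cmod (Cexp z - 1 - z) <= exp r + 1 + r)%R).
  { unfold Cminus; eapply Rle_trans; [apply Cmod_triangle|].
    rewrite Cmod_opp; apply Rplus_le_compat; [|exact Hr].
    eapply Rle_trans; [apply Cmod_triangle|].
    rewrite Cmod_opp, Cmod_1, Cmod_Cexp; apply Rplus_le_compat_r.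
    pose proof (re_le_Cmod z); pose proof (Rle_abs (Re z)).
    destruct (Rle_lt_or_eq_dec (Re z) r) as [L|L]; [lra| |].
    - left; apply exp_increasing, L.
    - rewrite L; lra. }
  eapply Rle_trans; [exact B|].
  assert (1 <= 4 * Cmod z ^ 2)%R by nra.
  unfold expK; nra.
Qed.

Lemma is_Cderive_Cexp (z : C) : is_Cderive Cexp z (Cexp z).
Proof.
apply is_Cderive_of_quadratic with (d := 1%R) (M := (Cmod (Cexp z) * expK 1)%R); [lra|].
intros h Hh.
replace (Cexp (z + h)%C - Cexp z - h * Cexp z) with (Cexp z * (Cexp h - 1 - h))
  by (rewrite Cexp_plus; ring).
rewrite Cmod_mult, Rmult_assoc; apply Rmult_le_compat_l; [apply Cmod_ge_0|].
apply Cexp_quadratic; lra.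
Qed.

Lemma is_Cderive_Cexp_lin (k z : C) : is_Cderive (fun y => Cexp (k * y)) z (k * Cexp (k * z)).
Proof.
apply is_Cderive_comp with (g := fun y => k * y); [apply is_Cderive_Cexp|].
eapply is_Cderive_eq.
- apply (is_Cderive_mult (fun _ => k) (fun y => y)); [apply is_Cderive_const | apply is_Cderive_id].
- ring.
Qed.

(** * Sums and products over initial segments *)

Fixpoint Csum (u : nat -> C) (n : nat) : C :=
  match n with O => 0 | S k => Csum u k + u k end.

Fixpoint Cprod (u : nat -> C) (n : nat) : C :=
  match n with O => 1 | S k => Cprod u k * u k end.

Lemma sum_n_Csum (u : nat -> C) (n : nat) : @sum_n C_AbelianMonoid u n = Csum u (S n).
Proof.
induction n as [|n IH].
- rewrite sum_O; simpl; ring.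
- rewrite sum_Sn, IH; reflexivity.
Qed.

Lemma is_Cseries_Csum (u : nat -> C) (s : C) : is_Cseries u s <-> Ctends (Csum u) s.
Proof.
rewrite is_Cseries_tends, <- (Ctends_incr_1 (Csum u)).
split; apply Ctends_ext; intros n; rewrite sum_n_Csum; reflexivity.
Qed.

Lemma Csum_scal (c : C) (u : nat -> C) (n : nat) :
  Csum (fun k => c * u k) n = c * Csum u n.
Proof. induction n as [|n IH]; simpl; [|rewrite IH]; ring. Qed.

Lemma Cprod_mult (u v : nat -> C) (n : nat) :
  Cprod (fun k => u k * v k) n = Cprod u n * Cprod v n.
Proof. induction n as [|n IH]; simpl; [|rewrite IH]; ring. Qed.

Lemma Cprod_neq_0 (u : nat -> C) (n : nat) : (forall k, u k <> 0) -> Cprod u n <> 0.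
Proof.
intros H; induction n as [|n IH]; simpl; [exact C1_nz | apply Cmult_neq_0; auto].
Qed.

(** The comparison scale 1/((k+1)(k+2)), whose partial sums telescope to
    1 - 1/(n+1); every infinite sum or product of factors 1 + O(1/k^2) below is
    controlled by it through a plain induction. *)
Definition tau (k : nat) : R := (/ ((INR k + 1) * (INR k + 2)))%R.

Definition tauS (n : nat) : R := (1 - / (INR n + 1))%R.

Lemma tauS_S (n : nat) : tauS (S n) = (tauS n + tau n)%R.
Proof.
unfold tauS, tau; rewrite S_INR; pose proof (pos_INR n); field; lra.
Qed.

Lemma tau_pos (k : nat) : (0 < tau k)%R.
Proof. apply Rinv_0_lt_compat; pose proof (pos_INR k); nra. Qed.

Lemma tauS_bounds (n : nat) : (0 <= tauS n <= 1)%R.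
Proof.
unfold tauS; pose proof (pos_INR n).
assert (/ (INR n + 1) <= 1)%R.
{ rewrite <- Rinv_1; apply Rinv_le_contravar; lra. }
pose proof (Rinv_0_lt_compat (INR n + 1) ltac:(lra)); lra.
Qed.

Lemma tauS_le_sub (n m : nat) : (tauS m - tauS n <= / (INR n + 1))%R.
Proof. pose proof (tauS_bounds m); unfold tauS in *; lra. Qed.

Lemma is_lim_seq_inv_INR_1 : is_lim_seq (fun n => / (INR n + 1))%R 0%R.
Proof.
apply is_lim_seq_ext with (fun n => / INR (S n))%R.
{ intros n; rewrite S_INR; reflexivity. }
apply -> (is_lim_seq_incr_1 (fun n => / INR n)%R).
apply (is_lim_seq_inv INR p_infty); [apply is_lim_seq_INR | discriminate].
Qed.

Lemma Csum_tau_le (u : nat -> C) (M : R) (n m : nat) :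
  (forall k, Cmod (u k) <= M * tau k)%R -> (n <= m)%nat ->
  (Cmod (Csum u m - Csum u n) <= M * (tauS m - tauS n))%R.
Proof.
intros H; induction 1 as [|m L IH].
- replace (Csum u n - Csum u n) with (RtoC 0) by ring; rewrite Cmod_0; lra.
- simpl; replace (Csum u m + u m - Csum u n) with ((Csum u m - Csum u n) + u m) by ring.
  eapply Rle_trans; [apply Cmod_triangle|].
  rewrite tauS_S; specialize (H m); lra.
Qed.

Lemma Ctends_complete_tau (u : nat -> C) (M : R) :
  (forall n m, (n <= m)%nat -> (Cmod (u m - u n) <= M * (tauS m - tauS n))%R) ->
  exists l : C, Ctends u l.
Proof.
intros H; apply Ctends_complete with (b := fun n => (Rabs M * / (INR n + 1))%R).
- intros n m L; eapply Rle_trans; [apply H, L|].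
  assert (D : (0 <= tauS m - tauS n)%R).
  { unfold tauS; pose proof (pos_INR n); apply le_INR in L.
    assert (/ (INR m + 1) <= / (INR n + 1))%R by (apply Rinv_le_contravar; lra); lra. }
  pose proof (tauS_le_sub n m); pose proof (Rle_abs M); pose proof (Rabs_pos M); nra.
- apply is_lim_seq_0_scal, is_lim_seq_inv_INR_1.
Qed.

Lemma Csum_tau_converges (u : nat -> C) (M : R) :
  (forall k, Cmod (u k) <= M * tau k)%R -> exists l : C, Ctends (Csum u) l.
Proof.
intros H; apply Ctends_complete_tau with M; intros n m L; apply Csum_tau_le; assumption.
Qed.

Lemma Cprod_tau_le (u : nat -> C) (M : R) (n : nat) :
  (0 <= M)%R -> (forall k, Cmod (u k - 1) <= M * tau k)%R ->
  (Cmod (Cprod u n) <= exp M)%R.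
Proof.
intros HM H.
assert (K : (Cmod (Cprod u n) <= exp (M * tauS n))%R).
{ induction n as [|n IH]; simpl.
  - rewrite Cmod_1; unfold tauS; simpl; replace (M * (1 - / (0 + 1)))%R with 0%R by field.
    rewrite exp_0; lra.
  - rewrite Cmod_mult, tauS_S, Rmult_plus_distr_l, exp_plus.
    apply Rmult_le_compat; try apply Cmod_ge_0; [exact IH|].
    replace (u n) with (1 + (u n - 1)) by ring.
    eapply Rle_trans; [apply Cmod_triangle|]; rewrite Cmod_1.
    eapply Rle_trans; [|apply exp_ineq1_le]; specialize (H n); lra. }
eapply Rle_trans; [exact K|].
pose proof (tauS_bounds n).
destruct (Rle_lt_or_eq_dec (M * tauS n) M) as [L|L]; [nra| |].
- left; apply exp_increasing, L.
- rewrite L; lra.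
Qed.

Lemma Cprod_tau_diff (u : nat -> C) (M : R) (n m : nat) :
  (0 <= M)%R -> (forall k, Cmod (u k - 1) <= M * tau k)%R -> (n <= m)%nat ->
  (Cmod (Cprod u m - Cprod u n) <= (exp M * M) * (tauS m - tauS n))%R.
Proof.
intros HM H; induction 1 as [|m L IH].
- replace (Cprod u n - Cprod u n) with (RtoC 0) by ring; rewrite Cmod_0; lra.
- simpl; replace (Cprod u m * u m - Cprod u n)
    with ((Cprod u m - Cprod u n) + Cprod u m * (u m - 1)) by ring.
  eapply Rle_trans; [apply Cmod_triangle|].
  rewrite tauS_S, Cmod_mult.
  assert (Cmod (Cprod u m) * Cmod (u m - 1) <= exp M * (M * tau m))%R.
  { apply Rmult_le_compat; try apply Cmod_ge_0; [apply Cprod_tau_le; assumption | apply H]. }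
  lra.
Qed.

Lemma Cprod_tau_sub1 (u : nat -> C) (M : R) (n : nat) :
  (0 <= M)%R -> (forall k, Cmod (u k - 1) <= M * tau k)%R ->
  (Cmod (Cprod u n - 1) <= exp M * M)%R.
Proof.
intros HM H; eapply Rle_trans.
- apply (Cprod_tau_diff u M 0 n); [assumption | assumption | lia].
- pose proof (tauS_bounds n); pose proof (tauS_bounds 0); pose proof (exp_pos M).
  assert (0 <= exp M * M)%R by nra; nra.
Qed.

Lemma Cmod_lower_bound (u : nat -> C) (l : C) :
  (forall n, u n <> 0) -> Ctends u l -> l <> 0 ->
  exists c : R, (0 < c)%R /\ forall n, (c <= Cmod (u n))%R.
Proof.
intros Hu H Hl.
pose proof (proj1 (Cmod_gt_0 l) Hl) as Pl.
destruct (proj1 (Ctends_spec u l) H (Cmod l / 2)%R ltac:(lra)) as [N HN].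
assert (K : exists c : R, (0 < c)%R /\ forall n, (n < N)%nat -> (c <= Cmod (u n))%R).
{ clear HN; induction N as [|N [c [Pc IH]]].
  - exists 1%R; split; [lra | intros n Hn; lia].
  - exists (Rmin c (Cmod (u N))); split.
    + apply Rmin_pos; [exact Pc | apply Cmod_gt_0, Hu].
    + intros n Hn; destruct (Nat.eq_dec n N) as [->|D]; [apply Rmin_r|].
      eapply Rle_trans; [apply Rmin_l | apply IH; lia]. }
destruct K as [c [Pc Hc]]; exists (Rmin c (Cmod l / 2)); split; [apply Rmin_pos; lra|].
intros n; destruct (Nat.le_gt_cases N n) as [L|L].
- eapply Rle_trans; [apply Rmin_r|]; specialize (HN n L).
  pose proof (Cmod_triangle (u n) (- (u n - l))) as T.
  replace (u n + - (u n - l)) with l in T by ring; rewrite Cmod_opp in T; lra.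
- eapply Rle_trans; [apply Rmin_l | apply Hc, L].
Qed.

(** The product of the inverses satisfies the same hypotheses, so the limit is
    invertible. *)
Lemma Cprod_tau_converges (u : nat -> C) (M : R) :
  (0 <= M)%R -> (forall k, u k <> 0) -> (forall k, Cmod (u k - 1) <= M * tau k)%R ->
  exists l : C, l <> 0 /\ Ctends (Cprod u) l.
Proof.
intros HM Hu H.
assert (K : forall (v : nat -> C) (M : R), (0 <= M)%R ->
  (forall k, Cmod (v k - 1) <= M * tau k)%R -> exists l : C, Ctends (Cprod v) l).
{ intros v N HN Hv; apply Ctends_complete_tau with (exp N * N)%R.
  intros n m L; apply Cprod_tau_diff; assumption. }
destruct (K u M HM H) as [l Hl].
assert (Lu : Ctends u 1).
{ apply Ctends_of_le with (v := fun k => (M * / (INR k + 1))%R).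
  - intros k; eapply Rle_trans; [apply H|]; apply Rmult_le_compat_l; [exact HM|].
    pose proof (pos_INR k); apply Rinv_le_contravar; nra.
  - apply is_lim_seq_0_scal, is_lim_seq_inv_INR_1. }
destruct (Cmod_lower_bound u 1 Hu Lu C1_nz) as [c [Pc Hc]].
destruct (K (fun k => / u k) (M / c)%R) as [m Hm].
- apply Rle_div_r; [exact Pc | lra].
- intros k; replace (/ u k - 1) with (- ((u k - 1) / u k)) by (field; apply Hu).
  rewrite Cmod_opp, Cmod_div by apply Hu.
  replace (M / c * tau k)%R with ((M * tau k) * / c)%R by (field; lra).
  apply Rmult_le_compat; [apply Cmod_ge_0 | | apply H |].
  + left; apply Rinv_0_lt_compat; specialize (Hc k); lra.
  + apply Rinv_le_contravar; [exact Pc | apply Hc].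
- exists l; split; [|exact Hl].
  assert (E : l * m = 1).
  { apply Ctends_unique with (fun n => Cprod u n * Cprod (fun k => / u k) n).
    - apply Ctends_mult; assumption.
    - apply Ctends_ext with (fun _ => 1); [|apply Ctends_const].
      intros n; rewrite <- Cprod_mult.
      symmetry; induction n as [|n IH]; simpl; [reflexivity|].
      rewrite IH; field; apply Hu. }
  intros ->; apply C1_nz; rewrite <- E; ring.
Qed.

(** First order expansion in [h] of a product with factors 1 + h e_k + O(h^2),
    uniformly in the number of factors: this is what lets one differentiate an
    infinite product without any uniform convergence theorem. *)
Lemma Cprod_first_order (w e : nat -> C) (h : C) (E Q : R) (n : nat) :
  (0 <= E)%R -> (0 <= Q)%R -> (Cmod h <= 1)%R ->
  (forall k, Cmod (e k) <= E * tau k)%R ->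
  (forall k, Cmod (w k - 1 - h * e k) <= Q * Cmod h ^ 2 * tau k)%R ->
  (Cmod (Cprod w n - 1 - h * Csum e n)
     <= exp (E + Q) * ((E + Q) * E + Q) * Cmod h ^ 2)%R.
Proof.
intros HE HQ Hh He Hw.
set (H := Cmod h) in *; pose proof (Cmod_ge_0 h) as PH; fold H in PH.
assert (Hw1 : forall k, (Cmod (w k - 1) <= H * (E + Q) * tau k)%R).
{ intros k; replace (w k - 1) with (h * e k + (w k - 1 - h * e k)) by ring.
  eapply Rle_trans; [apply Cmod_triangle|]; rewrite Cmod_mult; fold H.
  pose proof (tau_pos k); specialize (He k); specialize (Hw k).
  assert (H * Cmod (e k) <= H * (E * tau k))%R by (apply Rmult_le_compat_l; lra).
  assert (H ^ 2 <= H)%R by nra.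
  assert (Q * H ^ 2 * tau k <= Q * H * tau k)%R.
  { apply Rmult_le_compat_r; [lra|]; apply Rmult_le_compat_l; lra. }
  nra. }
assert (HM : (H * (E + Q) <= E + Q)%R) by nra.
assert (PM : (0 <= H * (E + Q))%R) by (apply Rmult_le_pos; lra).
assert (He' : (exp (H * (E + Q)) <= exp (E + Q))%R).
{ destruct (Rle_lt_or_eq_dec _ _ HM) as [L|L]; [left; apply exp_increasing, L | rewrite L; lra]. }
assert (B1 : forall n, (Cmod (Cprod w n) <= exp (E + Q))%R).
{ intros k; eapply Rle_trans; [apply Cprod_tau_le with (M := (H * (E + Q))%R)|]; assumption. }
assert (B2 : forall n, (Cmod (Cprod w n - 1) <= exp (E + Q) * (H * (E + Q)))%R).
{ intros k; eapply Rle_trans; [apply Cprod_tau_sub1 with (M := (H * (E + Q))%R); assumption|].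
  apply Rmult_le_compat_r; assumption. }
set (X := exp (E + Q)) in *.
assert (PX : (0 < X)%R) by apply exp_pos.
assert (K : (Cmod (Cprod w n - 1 - h * Csum e n)
   <= X * ((E + Q) * E + Q) * H ^ 2 * tauS n)%R).
{ induction n as [|n IH].
  - simpl Cprod; simpl Csum; replace (1 - 1 - h * 0) with (RtoC 0) by ring.
    rewrite Cmod_0; unfold tauS; simpl; replace (1 - / (0 + 1))%R with 0%R by field; lra.
  - simpl Cprod; simpl Csum.
    replace (Cprod w n * w n - 1 - h * (Csum e n + e n))
      with ((Cprod w n - 1 - h * Csum e n)
        + ((Cprod w n - 1) * (h * e n) + Cprod w n * (w n - 1 - h * e n))) by ring.
    eapply Rle_trans; [apply Cmod_triangle|].
    rewrite tauS_S, Rmult_plus_distr_l; apply Rplus_le_compat; [exact IH|].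
    eapply Rle_trans; [apply Cmod_triangle|]; rewrite !Cmod_mult; fold H.
    replace (X * ((E + Q) * E + Q) * H ^ 2 * tau n)%R
      with ((X * (H * (E + Q))) * (H * (E * tau n)) + X * (Q * H ^ 2 * tau n))%R by ring.
    apply Rplus_le_compat; apply Rmult_le_compat; try apply Cmod_ge_0; auto.
    + apply Rmult_le_pos; [exact PH | apply Cmod_ge_0].
    + apply Rmult_le_compat_l; auto. }
eapply Rle_trans; [exact K|].
rewrite <- Rmult_1_r; apply Rmult_le_compat_l; [|apply tauS_bounds].
apply Rmult_le_pos; [|apply pow2_ge_0]; apply Rmult_le_pos; [lra|nra].
Qed.

(** * The gamma function and its logarithmic derivative *)

Definition gamma_approx (z : C) (n : nat) : C :=
  INR (fact n) * Cexp ((z - 1) * ln (INR n)) / pochhammer z n.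

Definition not_pole (z : C) : Prop := forall k : nat, z + INR k <> 0.

(** Since [ln 0 = 0], this is 0 for [k = 0], and the sum over [k < n] is [ln n]
    for every [n]. *)
Definition dln (k : nat) : R := (ln (INR (S k)) - ln (INR k))%R.

Definition gamma_ratio (z h : C) (k : nat) : C :=
  Cexp (h * dln k) * (z + INR k) / (z + h + INR k).

Definition digamma_term (z : C) (k : nat) : C := dln k - / (z + INR k).

Lemma ln_0 : ln 0 = 0%R.
Proof.
unfold ln; destruct (Rlt_dec 0 0) as [H|H]; [destruct (Rlt_irrefl _ H) | reflexivity].
Qed.

Lemma pochhammer_neq_0 (z : C) (n : nat) : not_pole z -> pochhammer z n <> 0.
Proof.
intros H; induction n as [|n IH]; simpl; [exact C1_nz | apply Cmult_neq_0; auto].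
Qed.

(** Moving the argument by [h] multiplies the n-th approximant by n factors that
    are 1 + O(1/k^2), so limits and derivatives in [h] become statements on
    products. *)
Lemma gamma_approx_ratio (z h : C) (n : nat) :
  not_pole z -> not_pole (z + h) ->
  gamma_approx (z + h) n = gamma_approx z n * Cprod (gamma_ratio z h) n.
Proof.
intros Hz Hzh.
assert (K : Cprod (gamma_ratio z h) n * pochhammer (z + h) n
  = Cexp (h * ln (INR n)) * pochhammer z n).
{ induction n as [|n IH].
  - simpl; rewrite ln_0, Cmult_0_r, Cexp_0; ring.
  - cbn [Cprod pochhammer].
    replace (h * ln (INR (S n))) with (h * dln n + h * ln (INR n))
      by (unfold dln; rewrite RtoC_minus; ring).
    rewrite Cexp_plus.
    change (gamma_ratio z h n) with (Cexp (h * dln n) * (z + INR n) / (z + h + INR n)).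
    replace (Cexp (h * dln n) * Cexp (h * ln (INR n)) * (pochhammer z n * (z + INR n)))
      with ((Cexp (h * ln (INR n)) * pochhammer z n) * (Cexp (h * dln n) * (z + INR n)))
      by ring.
    rewrite <- IH; field; apply Hzh. }
unfold gamma_approx.
replace ((z + h - 1) * ln (INR n)) with ((z - 1) * ln (INR n) + h * ln (INR n)) by ring.
rewrite Cexp_plus.
pose proof (pochhammer_neq_0 z n Hz) as P; pose proof (pochhammer_neq_0 (z + h) n Hzh) as P'.
replace (Cexp (h * ln (INR n)))
  with (Cprod (gamma_ratio z h) n * pochhammer (z + h) n / pochhammer z n)
  by (rewrite K; field; exact P).
field; split; assumption.
Qed.

Lemma Csum_digamma_term (z : C) (n : nat) :
  Csum (digamma_term z) n = ln (INR n) - Csum (fun k => / (z + INR k)) n.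
Proof.
induction n as [|n IH].
- simpl; rewrite ln_0; ring.
- cbn [Csum]; rewrite IH; unfold digamma_term, dln; rewrite RtoC_minus; ring.
Qed.

(** The constants 6 and 3 are attained at [k = 1] by the bounds 1/k^2 and
    1/(k(k+1)); at [k = 0] everything rests on [dln 0 = 0]. *)
Lemma dln_bounds (k : nat) :
  (Rabs (dln k) <= 1 /\ dln k ^ 2 <= 6 * tau k /\ Rabs (dln k - / (INR k + 1)) <= 3 * tau k)%R.
Proof.
destruct k as [|k].
- unfold dln, tau; simpl; rewrite ln_0, ln_1.
  replace (0 - 0)%R with 0%R by ring; rewrite Rabs_R0.
  replace (0 - / (0 + 1))%R with (- (1))%R by field; rewrite Rabs_Ropp, Rabs_R1.
  replace (/ ((0 + 1) * (0 + 2)))%R with (/ 2)%R by field; lra.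
- set (K := INR (S k)); assert (HK : (1 <= K)%R) by (unfold K; rewrite S_INR; pose proof (pos_INR k); lra).
  assert (E : dln (S k) = ln ((K + 1) / K)).
  { unfold dln; rewrite ln_div by (try (rewrite S_INR); fold K; lra).
    rewrite (S_INR (S k)); reflexivity. }
  assert (U : (ln ((K + 1) / K) <= / K)%R).
  { pose proof (exp_ineq1_le (/ K)) as X.
    replace (1 + / K)%R with ((K + 1) / K)%R in X by (field; lra).
    rewrite <- (ln_exp (/ K)); apply ln_le; [|exact X].
    apply Rdiv_lt_0_compat; lra. }
  assert (L : (/ (K + 1) <= ln ((K + 1) / K))%R).
  { pose proof (exp_ineq1_le (- / (K + 1))) as X.
    replace (1 + - / (K + 1))%R with (/ ((K + 1) / K))%R in X by (field; lra).
    rewrite exp_Ropp in X.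
    apply Rinv_le_contravar in X; [|apply Rinv_0_lt_compat, Rdiv_lt_0_compat; lra].
    rewrite !Rinv_inv in X.
    rewrite <- (ln_exp (/ (K + 1))); apply ln_le; [apply exp_pos | exact X]. }
  rewrite E; unfold tau; fold K; set (l := ln ((K + 1) / K)) in *.
  assert (PK : (0 < / (K + 1))%R) by (apply Rinv_0_lt_compat; lra).
  assert (K1 : (/ K <= 1)%R) by (rewrite <- Rinv_1; apply Rinv_le_contravar; lra).
  split; [|split].
  + rewrite Rabs_pos_eq; lra.
  + apply Rle_trans with (/ K ^ 2)%R.
    * rewrite <- pow_inv; apply pow_incr; lra.
    * replace (6 * / ((K + 1) * (K + 2)))%R with (/ ((K + 1) * (K + 2) / 6))%R by (field; lra).
      apply Rinv_le_contravar; nra.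
  + rewrite Rabs_pos_eq by lra.
    apply Rle_trans with (/ K - / (K + 1))%R; [lra|].
    replace (/ K - / (K + 1))%R with (/ (K * (K + 1)))%R by (field; lra).
    replace (3 * / ((K + 1) * (K + 2)))%R with (/ ((K + 1) * (K + 2) / 3))%R by (field; lra).
    apply Rinv_le_contravar; nra.
Qed.

Lemma not_pole_lower_bound (z : C) :
  not_pole z -> exists c : R, (0 < c)%R /\ forall k, (c * (INR k + 2) <= Cmod (z + INR k))%R.
Proof.
intros Hz.
assert (P : forall k, (RtoC (INR k + 2)%R <> 0)).
{ intros k E; apply RtoC_inj in E; pose proof (pos_INR k); lra. }
destruct (Cmod_lower_bound (fun k => (z + INR k) / RtoC (INR k + 2)%R) 1) as [c [Pc Hc]].
- intros k; apply Cmult_neq_0; [apply Hz|].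
  intros E; apply (P k).
  replace (RtoC (INR k + 2)%R) with (RtoC (INR k + 2)%R * RtoC (INR k + 2)%R * / RtoC (INR k + 2)%R)
    by (field; apply P).
  rewrite E; ring.
- apply Ctends_of_le with (v := fun k => (Cmod (z - 2) * / (INR k + 1))%R).
  + intros k.
    replace ((z + INR k) / RtoC (INR k + 2)%R - 1) with ((z - 2) / RtoC (INR k + 2)%R)
      by (specialize (P k); rewrite RtoC_plus in *; field; exact P).
    rewrite Cmod_div, Cmod_R by apply P; pose proof (pos_INR k).
    rewrite Rabs_pos_eq by lra; apply Rmult_le_compat_l; [apply Cmod_ge_0|].
    apply Rinv_le_contravar; lra.
  + apply is_lim_seq_0_scal, is_lim_seq_inv_INR_1.
- exact C1_nz.
- exists c; split; [exact Pc|]; intros k; specialize (Hc k).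
  rewrite Cmod_div, Cmod_R in Hc by apply P; pose proof (pos_INR k).
  rewrite Rabs_pos_eq in Hc by lra; apply Rle_div_r in Hc; lra.
Qed.

Lemma digamma_term_bound (z : C) :
  not_pole z -> exists E : R, (0 <= E)%R /\ forall k, (Cmod (digamma_term z k) <= E * tau k)%R.
Proof.
intros Hz; destruct (not_pole_lower_bound z Hz) as [c [Pc Hc]].
exists (3 + Cmod (z - 1) / c)%R; split.
{ pose proof (Cmod_ge_0 (z - 1)); pose proof (Rinv_0_lt_compat c Pc); unfold Rdiv; nra. }
intros k; destruct (dln_bounds k) as [_ [_ B]]; pose proof (pos_INR k) as Pk.
assert (P : RtoC (INR k + 1)%R <> 0) by (intros E; apply RtoC_inj in E; lra).
replace (digamma_term z k) with (RtoC (dln k - / (INR k + 1))%R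
   + (z - 1) / (RtoC (INR k + 1)%R * (z + INR k))).
2:{ unfold digamma_term; rewrite RtoC_minus, RtoC_inv by lra.
    specialize (Hz k); rewrite RtoC_plus in *; field; split; assumption. }
eapply Rle_trans; [apply Cmod_triangle|]; rewrite Cmod_R, Rmult_plus_distr_r.
apply Rplus_le_compat; [exact B|].
rewrite Cmod_div, Cmod_mult, Cmod_R by (apply Cmult_neq_0; auto).
rewrite (Rabs_pos_eq (INR k + 1)) by lra; specialize (Hc k).
unfold tau.
replace (Cmod (z - 1) / c * / ((INR k + 1) * (INR k + 2)))%R
  with (Cmod (z - 1) * / ((INR k + 1) * (c * (INR k + 2))))%R by (field; lra).
apply Rmult_le_compat_l; [apply Cmod_ge_0|].
apply Rinv_le_contravar; [apply Rmult_lt_0_compat; nra | apply Rmult_le_compat_l; lra].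
Qed.

Lemma gamma_ratio_first_order (z h : C) (E B c r : R) (k : nat) :
  (0 <= E)%R -> (0 < c)%R -> (0 <= B)%R ->
  z + INR k <> 0 -> (Cmod h <= r)%R ->
  (Cmod (digamma_term z k) <= E * tau k)%R ->
  (Cmod (z + INR k) <= B * (INR k + 2))%R ->
  (c * (INR k + 2) <= Cmod (z + h + INR k))%R ->
  (Cmod (gamma_ratio z h k - 1 - h * digamma_term z k)
     <= (6 * expK r * B + E) / c * Cmod h ^ 2 * tau k)%R.
Proof.
intros HE Hc HB Hz Hh He Hb Hl.
pose proof (pos_INR k) as Pk; pose proof (tau_pos k) as Pt.
destruct (dln_bounds k) as [D1 [D2 _]].
pose proof (Cmod_ge_0 h) as Ph.
assert (Pl : (0 < Cmod (z + h + INR k))%R) by nra.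
assert (Hzh : z + h + INR k <> 0) by (apply Cmod_gt_0, Pl).
(* digamma_term z k * (z + k) = dln k * (z + k) - 1 cancels all first order terms *)
replace (gamma_ratio z h k - 1 - h * digamma_term z k)
  with (((Cexp (h * dln k) - 1 - h * dln k) * (z + INR k) - h * h * digamma_term z k)
         / (z + h + INR k)).
2:{ unfold gamma_ratio, digamma_term; field; split; assumption. }
rewrite Cmod_div by exact Hzh.
apply Rle_div_l; [exact Pl|].
assert (N : (Cmod ((Cexp (h * dln k) - 1 - h * dln k) * (z + INR k) - h * h * digamma_term z k)
   <= (6 * expK r * B + E) * Cmod h ^ 2 * tau k * (INR k + 2))%R).
{ unfold Cminus at 1; eapply Rle_trans; [apply Cmod_triangle|].
  rewrite Cmod_opp, !Cmod_mult.
  assert (Q : (Cmod (Cexp (h * dln k) - 1 - h * dln k) <= expK r * (Cmod h ^ 2 * (6 * tau k)))%R).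
  { eapply Rle_trans; [apply (Cexp_quadratic (h * dln k) r)|].
    - rewrite Cmod_mult, Cmod_R; pose proof (Rabs_pos (dln k)); nra.
    - rewrite Cmod_mult, Cmod_R, Rpow_mult_distr, pow2_abs.
      apply Rmult_le_compat_l; [left; apply expK_pos; lra|].
      apply Rmult_le_compat_l; [apply pow2_ge_0 | exact D2]. }
  assert (Q2 : (Cmod h * Cmod h * Cmod (digamma_term z k)
     <= E * Cmod h ^ 2 * tau k * (INR k + 2))%R).
  { replace (Cmod h * Cmod h)%R with (Cmod h ^ 2)%R by ring.
    apply Rle_trans with (Cmod h ^ 2 * (E * tau k))%R.
    - apply Rmult_le_compat_l; [apply pow2_ge_0 | exact He].
    - assert (0 <= Cmod h ^ 2 * (E * tau k))%R.
      { apply Rmult_le_pos; [apply pow2_ge_0 | nra]. }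
      nra. }
  assert (Q3 : (Cmod (Cexp (h * dln k) - 1 - h * dln k) * Cmod (z + INR k)
     <= expK r * (Cmod h ^ 2 * (6 * tau k)) * (B * (INR k + 2)))%R).
  { apply Rmult_le_compat; try apply Cmod_ge_0; assumption. }
  lra. }
eapply Rle_trans; [exact N|].
replace ((6 * expK r * B + E) / c * Cmod h ^ 2 * tau k * Cmod (z + h + INR k))%R
  with ((6 * expK r * B + E) * Cmod h ^ 2 * tau k * (Cmod (z + h + INR k) / c))%R by (field; lra).
apply Rmult_le_compat_l.
- pose proof (expK_pos r ltac:(lra)).
  apply Rmult_le_pos; [apply Rmult_le_pos; [nra | apply pow2_ge_0] | lra].
- apply Rle_div_r; lra.
Qed.

Lemma pochhammer_1 (n : nat) : pochhammer 1 n = INR (fact n).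
Proof.
induction n as [|n IH]; [reflexivity|].
cbn [pochhammer]; rewrite IH, fact_simpl, mult_INR, S_INR, RtoC_mult, RtoC_plus; ring.
Qed.

Lemma gamma_approx_1 (n : nat) : gamma_approx 1 n = 1.
Proof.
unfold gamma_approx; rewrite pochhammer_1.
replace ((1 - 1) * ln (INR n)) with (RtoC 0) by ring; rewrite Cexp_0; field.
intros E; apply RtoC_inj in E; apply (INR_fact_neq_0 n), E.
Qed.

Lemma Cmod_plus_INR_le (z : C) (k : nat) : (Cmod (z + INR k) <= (Cmod z + 1) * (INR k + 2))%R.
Proof.
eapply Rle_trans; [apply Cmod_triangle|]; rewrite Cmod_R.
pose proof (pos_INR k); pose proof (Cmod_ge_0 z); rewrite Rabs_pos_eq by lra; nra.
Qed.

Lemma not_pole_1 : not_pole 1.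
Proof.
intros k; rewrite <- RtoC_plus; intros E; apply RtoC_inj in E; pose proof (pos_INR k); lra.
Qed.

(** Euler's limit is compared with its value at 1, where every approximant is 1. *)
Lemma gamma_approx_tends (z : C) :
  not_pole z -> Gamma z <> 0 /\ Ctends (gamma_approx z) (Gamma z).
Proof.
intros Hz.
assert (Hz' : not_pole (1 + (z - 1))) by (replace (1 + (z - 1)) with z by ring; exact Hz).
destruct (digamma_term_bound 1 not_pole_1) as [E [PE HE]].
destruct (not_pole_lower_bound z Hz) as [c [Pc Hc]].
set (h := z - 1) in *; set (Q := ((6 * expK (Cmod h) * (Cmod 1 + 1) + E) / c * Cmod h ^ 2)%R).
assert (PQ : (0 <= Q)%R).
{ apply Rmult_le_pos; [|apply pow2_ge_0].
  apply Rle_div_r; [exact Pc|]; pose proof (expK_pos _ (Cmod_ge_0 h)); pose proof (Cmod_ge_0 1); nra. }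
destruct (Cprod_tau_converges (gamma_ratio 1 h) (Cmod h * E + Q)) as [l [Hl L]].
- pose proof (Cmod_ge_0 h); nra.
- intros k; unfold gamma_ratio; apply Cmult_neq_0.
  + apply Cmult_neq_0; [apply Cexp_neq_0 | apply not_pole_1].
  + intros K; apply C1_nz; rewrite <- (Cinv_r _ (Hz' k)); unfold h in *; rewrite K; ring.
- intros k; replace (gamma_ratio 1 h k - 1)
    with (h * digamma_term 1 k + (gamma_ratio 1 h k - 1 - h * digamma_term 1 k)) by ring.
  eapply Rle_trans; [apply Cmod_triangle|]; rewrite Cmod_mult, Rmult_plus_distr_r.
  apply Rplus_le_compat.
  + rewrite Rmult_assoc; apply Rmult_le_compat_l; [apply Cmod_ge_0 | apply HE].
  + apply gamma_ratio_first_order; auto.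
    * pose proof (Cmod_ge_0 1); lra.
    * apply not_pole_1.
    * lra.
    * apply Cmod_plus_INR_le.
    * replace (1 + h) with z by (unfold h; ring); apply Hc.
- assert (T : Ctends (gamma_approx z) l).
  { apply Ctends_ext with (Cprod (gamma_ratio 1 h)); [|exact L].
    intros n; replace z with (1 + h) at 1 by (unfold h; ring).
    rewrite gamma_approx_ratio by (try apply not_pole_1; exact Hz').
    rewrite gamma_approx_1; ring. }
  replace (Gamma z) with l by (symmetry; apply Clim_seq_eq, T); split; assumption.
Qed.

Lemma is_lim_seq_le_const (u : nat -> R) (l M : R) :
  (forall n, (u n <= M)%R) -> is_lim_seq u l -> (l <= M)%R.
Proof.
intros H L; apply (is_lim_seq_le u (fun _ => M) l M H L (is_lim_seq_const M)).
Qed.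

(** The first order expansion of the ratios of approximants has a remainder
    quadratic in [h] and uniform in [n]; it survives the limit, which shows at once
    that Gamma is differentiable at [z] and what its logarithmic derivative is. *)
Theorem digamma_tends (z : C) :
  not_pole z -> Ctends (fun n => ln (INR n) - Csum (fun k => / (z + INR k)) n) (digamma z).
Proof.
intros Hz.
destruct (digamma_term_bound z Hz) as [E [PE HE]].
destruct (Csum_tau_converges _ _ HE) as [l L].
destruct (gamma_approx_tends z Hz) as [G0 G].
destruct (not_pole_lower_bound z Hz) as [c [Pc Hc]].
set (B := (Cmod z + 1)%R).
set (Q := ((6 * expK 1 * B + E) / (c / 2))%R).
assert (PB : (0 <= B)%R) by (unfold B; pose proof (Cmod_ge_0 z); lra).
assert (PQ : (0 <= Q)%R).
{ apply Rle_div_r; [lra|]; pose proof (expK_pos 1 ltac:(lra)); nra. }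
set (W := (exp (E + Q) * ((E + Q) * E + Q))%R).
assert (D : is_Cderive Gamma z (l * Gamma z)).
{ apply is_Cderive_of_quadratic with (d := Rmin 1 c) (M := (W * Cmod (Gamma z))%R).
  { apply Rmin_pos; lra. }
  intros h Hh.
  assert (H1 : (Cmod h < 1)%R) by (eapply Rlt_le_trans; [exact Hh | apply Rmin_l]).
  assert (Hc1 : (Cmod h < c)%R) by (eapply Rlt_le_trans; [exact Hh | apply Rmin_r]).
  assert (Low : forall k, (c / 2 * (INR k + 2) <= Cmod (z + h + INR k))%R).
  { intros k; specialize (Hc k); pose proof (pos_INR k).
    pose proof (Cmod_triangle (z + h + INR k) (- h)) as T.
    replace (z + h + INR k + - h) with (z + INR k) in T by ring; rewrite Cmod_opp in T; nra. }
  assert (Hzh : not_pole (z + h)).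
  { intros k; apply Cmod_gt_0; specialize (Low k); pose proof (pos_INR k); nra. }
  destruct (gamma_approx_tends (z + h) Hzh) as [_ G'].
  assert (R : Ctends (fun n => gamma_approx (z + h) n - gamma_approx z n
      - h * (Csum (digamma_term z) n * gamma_approx z n))
      (Gamma (z + h) - Gamma z - h * (l * Gamma z))).
  { repeat apply Ctends_minus; [exact G' | exact G |].
    apply Ctends_scal, Ctends_mult; assumption. }
  assert (RB : is_lim_seq (fun n => W * Cmod h ^ 2 * Cmod (gamma_approx z n))%R
     (W * Cmod h ^ 2 * Cmod (Gamma z))%R).
  { apply is_lim_seq_mult'; [apply is_lim_seq_const | apply Ctends_Cmod, G]. }
  replace (W * Cmod (Gamma z) * Cmod h ^ 2)%R with (W * Cmod h ^ 2 * Cmod (Gamma z))%R by ring.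
  refine (is_lim_seq_le _ _ _ _ _ (Ctends_Cmod _ _ R) RB).
  intros n; rewrite gamma_approx_ratio by assumption.
  replace (gamma_approx z n * Cprod (gamma_ratio z h) n - gamma_approx z n
     - h * (Csum (digamma_term z) n * gamma_approx z n))
    with ((Cprod (gamma_ratio z h) n - 1 - h * Csum (digamma_term z) n) * gamma_approx z n)
    by ring.
  rewrite Cmod_mult; apply Rmult_le_compat_r; [apply Cmod_ge_0|].
  apply Cprod_first_order; auto; [lra|].
  intros k; apply gamma_ratio_first_order; auto; [lra | lra | apply Cmod_plus_INR_le]. }
replace (digamma z) with l.
- apply Ctends_ext with (Csum (digamma_term z)); [|exact L].
  intros n; apply Csum_digamma_term.
- unfold digamma; rewrite (is_C_derive_unique Gamma z (l * Gamma z)); [field; exact G0|].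
  destruct D as [_ D]; split; [apply is_linear_scal_l | exact D].
Qed.

(** * Power series with polynomially bounded coefficients *)

Definition poly_bounded (c : nat -> C) : Prop :=
  exists (M : R) (K : nat), forall n, (Cmod (c n) <= M * (INR n + 1) ^ K)%R.

Definition PS (c : nat -> C) (x : C) : C := Cseries (fun n => c n * x ^ n).

Definition coef_deriv (c : nat -> C) (n : nat) : C := INR (S n) * c (S n).

Definition coef_shift (c : nat -> C) (n : nat) : C :=
  match n with O => 0 | S m => c m end.

Lemma ex_series_poly_geom (K : nat) (r : R) :
  (0 < r < 1)%R -> ex_series (fun n => (INR n + 1) ^ K * r ^ n)%R.
Proof.
intros Hr.
apply ex_series_ext with (fun n => Rabs ((INR n + 1) ^ K * r ^ n)%R).
{ intros n; apply Rabs_pos_eq, Rmult_le_pos; apply pow_le; pose proof (pos_INR n); lra. }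
apply ex_series_DAlembert with r; [lra | |].
- intros n; apply Rmult_integral_contrapositive_currified; apply pow_nonzero;
    pose proof (pos_INR n); lra.
- apply is_lim_seq_ext with (fun n => (1 + / (INR n + 1)) ^ K * r)%R.
  { intros n; pose proof (pos_INR n).
    rewrite Rabs_pos_eq.
    - replace (1 + / (INR n + 1))%R with ((INR (S n) + 1) * / (INR n + 1))%R
        by (rewrite S_INR; field; lra).
      rewrite Rpow_mult_distr, pow_inv; simpl; field.
      split; apply pow_nonzero; lra.
    - apply Rlt_le, Rdiv_lt_0_compat; apply Rmult_lt_0_compat; apply pow_lt;
        try rewrite S_INR; lra. }
  assert (L : is_lim_seq (fun n => (1 + / (INR n + 1)) ^ K)%R 1%R).
  { induction K as [|K IH].
    - simpl; apply is_lim_seq_const.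
    - simpl; replace (Finite 1) with (Finite ((1 + 0) * 1)) by (f_equal; ring).
      apply is_lim_seq_mult'; [|exact IH].
      apply is_lim_seq_plus'; [apply is_lim_seq_const | apply is_lim_seq_inv_INR_1]. }
  replace (Finite r) with (Finite (1 * r)) by (f_equal; ring).
  apply is_lim_seq_mult'; [exact L | apply is_lim_seq_const].
Qed.

Lemma ex_Cseries_le (u : nat -> C) (b : nat -> R) :
  (forall n, (Cmod (u n) <= b n)%R) -> ex_series b -> exists s : C, is_Cseries u s.
Proof.
intros H Hb.
destruct (@ex_series_le C_AbsRing C_CompleteNormedModule u b) as [s Hs].
- exact H.
- exact Hb.
- exists s; exact Hs.
Qed.

Lemma Cseries_le (u : nat -> C) (s : C) (b : nat -> R) :
  (forall n, (Cmod (u n) <= b n)%R) -> is_Cseries u s -> ex_series b ->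
  (Cmod s <= Series b)%R.
Proof.
intros H Hs Hb.
apply is_Cseries_tends, Ctends_Cmod in Hs.
assert (HB : is_lim_seq (sum_n b) (Series b)) by exact (Series_correct b Hb).
refine (is_lim_seq_le _ _ _ _ _ Hs HB).
intros n; induction n as [|n IH].
- rewrite !sum_O; apply H.
- rewrite !sum_Sn; eapply Rle_trans; [apply Cmod_triangle|].
  apply Rplus_le_compat; [exact IH | apply H].
Qed.

Lemma is_Cseries_ext (u v : nat -> C) (s : C) :
  (forall n, u n = v n) -> is_Cseries u s -> is_Cseries v s.
Proof. apply is_series_ext. Qed.

Lemma is_Cseries_plus (u v : nat -> C) (s t : C) :
  is_Cseries u s -> is_Cseries v t -> is_Cseries (fun n => u n + v n) (s + t).
Proof. apply (@is_series_plus C_AbsRing C_NormedModule u v s t). Qed.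

Lemma is_Cseries_scal (k : C) (u : nat -> C) (s : C) :
  is_Cseries u s -> is_Cseries (fun n => k * u n) (k * s).
Proof.
rewrite !is_Cseries_Csum; intros H.
apply Ctends_ext with (fun n => k * Csum u n).
- intros n; rewrite Csum_scal; reflexivity.
- apply Ctends_scal, H.
Qed.

Lemma is_Cseries_minus (u v : nat -> C) (s t : C) :
  is_Cseries u s -> is_Cseries v t -> is_Cseries (fun n => u n - v n) (s - t).
Proof.
intros Hu Hv; replace (s - t) with (s + - (1) * t) by ring.
apply is_Cseries_ext with (fun n => u n + - (1) * v n); [intros; ring|].
apply is_Cseries_plus; [exact Hu | apply is_Cseries_scal, Hv].
Qed.

Lemma is_Cseries_unique (u : nat -> C) (s t : C) :
  is_Cseries u s -> is_Cseries u t -> s = t.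
Proof. intros Hs Ht; rewrite <- (Cseries_eq _ _ Hs); apply Cseries_eq, Ht. Qed.

Lemma Csum_S_l (u : nat -> C) (n : nat) :
  Csum u (S n) = u O + Csum (fun k => u (S k)) n.
Proof.
induction n as [|n IH]; [simpl; ring|].
change (Csum u (S (S n))) with (Csum u (S n) + u (S n)).
rewrite IH; simpl; ring.
Qed.

Lemma is_Cseries_incr_1 (u : nat -> C) (s : C) :
  is_Cseries (fun n => u (S n)) s <-> is_Cseries u (u O + s).
Proof.
rewrite !is_Cseries_Csum; rewrite <- (Ctends_incr_1 (Csum u)).
split; intros H.
- apply Ctends_ext with (fun n => u O + Csum (fun k => u (S k)) n).
  + intros n; rewrite Csum_S_l; reflexivity.
  + apply Ctends_plus; [apply Ctends_const | exact H].
- replace s with (u O + s - u O) by ring.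
  apply Ctends_ext with (fun n => Csum u (S n) - u O).
  + intros n; rewrite Csum_S_l; ring.
  + apply Ctends_minus; [exact H | apply Ctends_const].
Qed.

(** Replacing [Cmod x] by the midpoint with 1 keeps the ratio test clear of 0. *)
Lemma midpoint_radius (x : C) :
  (Cmod x < 1)%R -> (0 < (1 + Cmod x) / 2 < 1)%R /\ (Cmod x < (1 + Cmod x) / 2)%R.
Proof. intros H; pose proof (Cmod_ge_0 x); lra. Qed.

Lemma PS_correct (c : nat -> C) (x : C) :
  poly_bounded c -> (Cmod x < 1)%R -> is_Cseries (fun n => c n * x ^ n) (PS c x).
Proof.
intros [M [K H]] Hx; destruct (midpoint_radius x Hx) as [Hr Hxr].
set (r := ((1 + Cmod x) / 2)%R) in *.
destruct (ex_Cseries_le (fun n => c n * x ^ n) (fun n => M * ((INR n + 1) ^ K * r ^ n))%R)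
  as [s Hs].
- intros n; rewrite Cmod_mult, Cmod_pow, <- Rmult_assoc.
  apply Rmult_le_compat; [apply Cmod_ge_0 | apply pow_le, Cmod_ge_0 | apply H |].
  apply pow_incr; pose proof (Cmod_ge_0 x); lra.
- apply (@ex_series_scal R_AbsRing R_NormedModule M), ex_series_poly_geom, Hr.
- unfold PS; rewrite (Cseries_eq _ _ Hs); exact Hs.
Qed.

Lemma PS_eq (c : nat -> C) (x s : C) :
  is_Cseries (fun n => c n * x ^ n) s -> PS c x = s.
Proof. apply Cseries_eq. Qed.

Lemma PS_ext (c d : nat -> C) (x : C) : (forall n, c n = d n) -> PS c x = PS d x.
Proof.
intros H; replace d with c; [reflexivity | apply functional_extensionality, H].
Qed.

Lemma poly_bounded_le (c d : nat -> C) :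
  (forall n, (Cmod (c n) <= Cmod (d n))%R) -> poly_bounded d -> poly_bounded c.
Proof.
intros L [M [K H]]; exists M, K; intros n; eapply Rle_trans; [apply L | apply H].
Qed.

Lemma poly_bounded_const (k : C) : poly_bounded (fun _ => k).
Proof. exists (Cmod k), O; intros n; simpl; lra. Qed.

Lemma poly_bounded_INR : poly_bounded (fun n => INR n).
Proof.
exists 1%R, 1%nat; intros n; rewrite Cmod_R; pose proof (pos_INR n).
rewrite Rabs_pos_eq; simpl; lra.
Qed.

Lemma poly_bounded_pos (c : nat -> C) :
  poly_bounded c -> exists (M : R) (K : nat), (0 <= M)%R /\
    forall n, (Cmod (c n) <= M * (INR n + 1) ^ K)%R.
Proof.
intros [M [K H]]; exists M, K; split; [|exact H].
specialize (H O); simpl in H; rewrite Rplus_0_l, pow1 in H.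
pose proof (Cmod_ge_0 (c O)); lra.
Qed.

Lemma poly_bounded_plus (c d : nat -> C) :
  poly_bounded c -> poly_bounded d -> poly_bounded (fun n => c n + d n).
Proof.
intros Hc Hd; destruct (poly_bounded_pos c Hc) as [M [K [PM H]]].
destruct (poly_bounded_pos d Hd) as [M' [K' [PM' H']]].
exists (M + M')%R, (K + K')%nat; intros n.
eapply Rle_trans; [apply Cmod_triangle|]; rewrite Rmult_plus_distr_r.
pose proof (pos_INR n).
apply Rplus_le_compat.
- eapply Rle_trans; [apply H|]; apply Rmult_le_compat_l; [exact PM|].
  apply Rle_pow; [lra | lia].
- eapply Rle_trans; [apply H'|]; apply Rmult_le_compat_l; [exact PM'|].
  apply Rle_pow; [lra | lia].
Qed.

Lemma poly_bounded_mult (c d : nat -> C) :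
  poly_bounded c -> poly_bounded d -> poly_bounded (fun n => c n * d n).
Proof.
intros [M [K H]] [M' [K' H']]; exists (M * M')%R, (K + K')%nat; intros n.
rewrite Cmod_mult, pow_add.
replace (M * M' * ((INR n + 1) ^ K * (INR n + 1) ^ K'))%R
  with ((M * (INR n + 1) ^ K) * (M' * (INR n + 1) ^ K'))%R by ring.
apply Rmult_le_compat; try apply Cmod_ge_0; auto.
Qed.

Lemma poly_bounded_minus (c d : nat -> C) :
  poly_bounded c -> poly_bounded d -> poly_bounded (fun n => c n - d n).
Proof.
intros Hc Hd; apply poly_bounded_le with (fun n => c n + - (1) * d n).
- intros n; right; f_equal; ring.
- apply poly_bounded_plus; [exact Hc|].
  apply poly_bounded_mult; [apply poly_bounded_const | exact Hd].
Qed.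

Lemma poly_bounded_S (c : nat -> C) : poly_bounded c -> poly_bounded (fun n => c (S n)).
Proof.
intros Hc; destruct (poly_bounded_pos c Hc) as [M [K [PM H]]].
exists (M * 2 ^ K)%R, K; intros n.
eapply Rle_trans; [apply H|]; rewrite Rmult_assoc, <- Rpow_mult_distr.
apply Rmult_le_compat_l; [exact PM|]; apply pow_incr.
pose proof (pos_INR n); rewrite S_INR; lra.
Qed.

Lemma poly_bounded_deriv (c : nat -> C) : poly_bounded c -> poly_bounded (coef_deriv c).
Proof.
intros H; apply (poly_bounded_S (fun n => INR n * c n)).
apply poly_bounded_mult; [apply poly_bounded_INR | exact H].
Qed.

Lemma poly_bounded_shift (c : nat -> C) : poly_bounded c -> poly_bounded (coef_shift c).
Proof.
intros Hc; destruct (poly_bounded_pos c Hc) as [M [K [PM H]]]; exists M, K.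
intros [|n]; simpl coef_shift.
- rewrite Cmod_0; apply Rmult_le_pos; [exact PM | apply pow_le; simpl; lra].
- eapply Rle_trans; [apply H|]; apply Rmult_le_compat_l; [exact PM|].
  apply pow_incr; pose proof (pos_INR n); rewrite S_INR; lra.
Qed.

Lemma PS_plus (c d : nat -> C) (x : C) :
  poly_bounded c -> poly_bounded d -> (Cmod x < 1)%R ->
  PS c x + PS d x = PS (fun n => c n + d n) x.
Proof.
intros Hc Hd Hx; symmetry; apply PS_eq.
apply is_Cseries_ext with (fun n => c n * x ^ n + d n * x ^ n); [intros; ring|].
apply is_Cseries_plus; apply PS_correct; assumption.
Qed.

Lemma PS_minus (c d : nat -> C) (x : C) :
  poly_bounded c -> poly_bounded d -> (Cmod x < 1)%R ->
  PS c x - PS d x = PS (fun n => c n - d n) x.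
Proof.
intros Hc Hd Hx; symmetry; apply PS_eq.
apply is_Cseries_ext with (fun n => c n * x ^ n - d n * x ^ n); [intros; ring|].
apply is_Cseries_minus; apply PS_correct; assumption.
Qed.

Lemma PS_scal (k : C) (c : nat -> C) (x : C) :
  poly_bounded c -> (Cmod x < 1)%R -> k * PS c x = PS (fun n => k * c n) x.
Proof.
intros Hc Hx; symmetry; apply PS_eq.
apply is_Cseries_ext with (fun n => k * (c n * x ^ n)); [intros; ring|].
apply is_Cseries_scal, PS_correct; assumption.
Qed.

Lemma PS_shift (c : nat -> C) (x : C) :
  poly_bounded c -> (Cmod x < 1)%R -> x * PS c x = PS (coef_shift c) x.
Proof.
intros Hc Hx; symmetry; apply PS_eq.
replace (x * PS c x) with (coef_shift c O * x ^ 0 + x * PS c x) by (simpl; ring).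
apply (is_Cseries_incr_1 (fun n => coef_shift c n * x ^ n)).
apply is_Cseries_ext with (fun n => x * (c n * x ^ n)); [intros; simpl; ring|].
apply is_Cseries_scal, PS_correct; assumption.
Qed.

Lemma PS_0 (c : nat -> C) : PS c 0 = c O.
Proof.
apply PS_eq; replace (c O) with (c O * 0 ^ 0 + 0) by (simpl; ring).
apply (is_Cseries_incr_1 (fun n => c n * 0 ^ n)).
apply is_Cseries_Csum; apply Ctends_ext with (fun _ => 0); [|apply Ctends_const].
intros n; induction n as [|n IH]; [reflexivity|].
cbn [Csum]; rewrite <- IH, Cpow_S; ring.
Qed.

(** The derivative n x^(n-1), without a predecessor in the exponent. *)
Definition monomial_deriv (n : nat) (x : C) : C :=
  match n with O => 0 | S m => INR n * x ^ m end.

(** Induction on [n]; multiplying by [r ^ 2] avoids the exponent n - 2. *)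
Lemma monomial_remainder (x h : C) (r : R) (n : nat) :
  (Cmod x <= r)%R -> (Cmod (x + h) <= r)%R ->
  (r ^ 2 * Cmod ((x + h) ^ n - x ^ n - h * monomial_deriv n x)
     <= Cmod h ^ 2 * (INR n ^ 2 * r ^ n))%R.
Proof.
intros Hx Hxh; pose proof (Cmod_ge_0 x) as Px.
induction n as [|n IH].
- simpl; replace (1 - 1 - h * 0) with (RtoC 0) by ring; rewrite Cmod_0; lra.
- assert (D : (r * Cmod (monomial_deriv n x) <= INR n * r ^ n)%R).
  { destruct n as [|n]; [simpl; rewrite Cmod_0; lra|].
    unfold monomial_deriv; rewrite Cmod_mult, Cmod_R, Cmod_pow, Rabs_pos_eq by apply pos_INR.
    replace (INR (S n) * r ^ S n)%R with (r * (INR (S n) * r ^ n))%R by (simpl; ring).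
    apply Rmult_le_compat_l; [lra|]; apply Rmult_le_compat_l; [apply pos_INR|].
    apply pow_incr; lra. }
  assert (E : (x + h) ^ S n - x ^ S n - h * monomial_deriv (S n) x
    = (x + h) * ((x + h) ^ n - x ^ n - h * monomial_deriv n x) + h * h * monomial_deriv n x).
  { unfold monomial_deriv at 1; rewrite S_INR, RtoC_plus, !Cpow_S.
    assert (X : x * monomial_deriv n x = INR n * x ^ n).
    { destruct n as [|n]; [simpl; ring|]; unfold monomial_deriv; rewrite Cpow_S; ring. }
    replace ((x + h) * ((x + h) ^ n - x ^ n - h * monomial_deriv n x) + h * h * monomial_deriv n x)
      with ((x + h) * ((x + h) ^ n - x ^ n) - h * (x * monomial_deriv n x)) by ring.
    rewrite X; ring. }
  rewrite E.
  eapply Rle_trans.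
  { apply Rmult_le_compat_l; [apply pow2_ge_0|]; apply Cmod_triangle. }
  rewrite !Cmod_mult, Rmult_plus_distr_l.
  set (e := Cmod ((x + h) ^ n - x ^ n - h * monomial_deriv n x)) in *.
  set (dn := Cmod (monomial_deriv n x)) in *.
  set (H := Cmod h) in *.
  assert (Pe : (0 <= e)%R) by apply Cmod_ge_0.
  assert (PH : (0 <= H)%R) by apply Cmod_ge_0.
  assert (A1 : (r ^ 2 * (Cmod (x + h) * e) <= r * (H ^ 2 * (INR n ^ 2 * r ^ n)))%R).
  { apply Rle_trans with (r * (r ^ 2 * e))%R; [|apply Rmult_le_compat_l; lra].
    assert (0 <= r ^ 2 * e)%R by (apply Rmult_le_pos; [apply pow2_ge_0 | exact Pe]).
    pose proof (Cmod_ge_0 (x + h)); nra. }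
  assert (A2 : (r ^ 2 * (H * H * dn) <= r * (H ^ 2 * (INR n * r ^ n)))%R).
  { replace (r ^ 2 * (H * H * dn))%R with ((r * H ^ 2) * (r * dn))%R by ring.
    replace (r * (H ^ 2 * (INR n * r ^ n)))%R with ((r * H ^ 2) * (INR n * r ^ n))%R by ring.
    apply Rmult_le_compat_l; [|exact D]; apply Rmult_le_pos; [lra | apply pow2_ge_0]. }
  assert (A3 : (0 <= H ^ 2 * r ^ S n)%R).
  { apply Rmult_le_pos; [apply pow2_ge_0 | apply pow_le; lra]. }
  rewrite S_INR; simpl pow in *; pose proof (pos_INR n).
  nra.
Qed.

Lemma PS_monomial_deriv (c : nat -> C) (x : C) :
  poly_bounded c -> (Cmod x < 1)%R ->
  is_Cseries (fun n => c n * monomial_deriv n x) (PS (coef_deriv c) x).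
Proof.
intros Hc Hx.
replace (PS (coef_deriv c) x) with (c O * monomial_deriv O x + PS (coef_deriv c) x)
  by (simpl; ring).
apply (is_Cseries_incr_1 (fun n => c n * monomial_deriv n x)).
apply is_Cseries_ext with (fun n => coef_deriv c n * x ^ n).
- intros n; unfold coef_deriv, monomial_deriv; ring.
- apply PS_correct; [apply poly_bounded_deriv, Hc | exact Hx].
Qed.

Theorem is_Cderive_PS (c : nat -> C) (x : C) :
  poly_bounded c -> (Cmod x < 1)%R -> is_Cderive (PS c) x (PS (coef_deriv c) x).
Proof.
intros Hc Hx; destruct (midpoint_radius x Hx) as [Hr Hxr].
set (r := ((1 + Cmod x) / 2)%R) in *.
destruct (poly_bounded_pos c Hc) as [M [K [PM H]]].
set (b := fun n => ((INR n + 1) ^ (K + 2) * r ^ n)%R).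
assert (Hb : ex_series b) by (apply ex_series_poly_geom, Hr).
apply is_Cderive_of_quadratic with (d := (r - Cmod x)%R) (M := (M / r ^ 2 * Series b)%R); [lra|].
intros h Hh.
assert (Hxh : (Cmod (x + h) < r)%R).
{ eapply Rle_lt_trans; [apply Cmod_triangle | lra]. }
assert (S : is_Cseries (fun n => c n * ((x + h) ^ n - x ^ n - h * monomial_deriv n x))
   (PS c (x + h)%C - PS c x - h * PS (coef_deriv c) x)).
{ apply is_Cseries_ext with
    (fun n => c n * (x + h) ^ n - c n * x ^ n - h * (c n * monomial_deriv n x)).
  { intros n; ring. }
  apply is_Cseries_minus; [apply is_Cseries_minus|].
  - apply PS_correct; [exact Hc | lra].
  - apply PS_correct; [exact Hc | exact Hx].
  - apply is_Cseries_scal, PS_monomial_deriv; assumption. }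
replace (M / r ^ 2 * Series b * Cmod h ^ 2)%R with ((M / r ^ 2 * Cmod h ^ 2) * Series b)%R by ring.
rewrite <- Series_scal_l.
refine (Cseries_le _ _ _ _ S _); [|apply (@ex_series_scal R_AbsRing R_NormedModule (M / r ^ 2 * Cmod h ^ 2)%R), Hb].
intros n; rewrite Cmod_mult.
pose proof (monomial_remainder x h r n ltac:(lra) ltac:(lra)) as R1.
assert (Pr : (0 < r ^ 2)%R) by (apply pow_lt; lra).
assert (R2 : (Cmod ((x + h) ^ n - x ^ n - h * monomial_deriv n x)
   <= Cmod h ^ 2 * (INR n ^ 2 * r ^ n) / r ^ 2)%R).
{ apply Rle_div_r; [exact Pr | lra]. }
pose proof (pos_INR n) as Pn.
apply Rle_trans with ((M * (INR n + 1) ^ K) * (Cmod h ^ 2 * ((INR n + 1) ^ 2 * r ^ n) / r ^ 2))%R.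
- apply Rmult_le_compat; try apply Cmod_ge_0; [apply H|].
  eapply Rle_trans; [exact R2|].
  apply Rmult_le_compat_r; [left; apply Rinv_0_lt_compat, Pr|].
  apply Rmult_le_compat_l; [apply pow2_ge_0|].
  apply Rmult_le_compat_r; [apply pow_le; lra | apply pow_incr; lra].
- right; unfold b; rewrite pow_add; field; lra.
Qed.

(** ** The hypergeometric operator acting on power series *)

(** Coefficients of x(1-x) y'' + (g - 2x) y' - a(1-a) y when y has coefficients [c]. *)
Definition hyp_op_coef (a g : C) (c : nat -> C) (n : nat) : C :=
  INR (S n) * (INR n + g) * c (S n) - (INR n + a) * (INR n + 1 - a) * c n.

Lemma hyp_op_PS (a g : C) (c : nat -> C) (x : C) :
  poly_bounded c -> (Cmod x < 1)%R ->
  x * (1 - x) * PS (coef_deriv (coef_deriv c)) x + (g - 2 * x) * PS (coef_deriv c) x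
    - a * (1 - a) * PS c x = PS (hyp_op_coef a g c) x.
Proof.
intros Hc Hx.
pose proof (poly_bounded_deriv c Hc) as Hd.
pose proof (poly_bounded_deriv _ Hd) as Hdd.
pose proof (poly_bounded_shift _ Hdd) as Hs.
pose proof (poly_bounded_shift _ Hs) as Hss.
pose proof (poly_bounded_shift _ Hd) as Hsd.
set (d := coef_deriv c) in *; set (dd := coef_deriv d) in *.
replace (x * (1 - x) * PS dd x + (g - 2 * x) * PS d x - a * (1 - a) * PS c x)
  with (x * PS dd x - x * (x * PS dd x) + g * PS d x - 2 * (x * PS d x) - a * (1 - a) * PS c x)
  by ring.
rewrite (PS_shift dd), (PS_shift (coef_shift dd)), (PS_shift d) by assumption.
rewrite !PS_scal by assumption.
assert (B : forall (k : C) (u : nat -> C), poly_bounded u -> poly_bounded (fun n => k * u n)).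
{ intros k u Hu; apply poly_bounded_mult; [apply poly_bounded_const | exact Hu]. }
rewrite PS_minus, PS_plus, PS_minus, PS_minus
  by (repeat first [assumption | apply poly_bounded_minus | apply poly_bounded_plus | apply B]).
apply PS_ext; intros n; unfold dd, d, hyp_op_coef.
destruct n as [|[|n]]; unfold coef_shift, coef_deriv; rewrite ?S_INR, ?RtoC_plus;
  simpl INR; ring.
Qed.

(** ** Abel's theorem along 1/2, 1/3, 1/4, ... *)

Definition near0 (m : nat) : R := (/ (INR m + 2))%R.

Lemma near0_bounds (m : nat) : (0 < near0 m < 1)%R.
Proof.
unfold near0; pose proof (pos_INR m); split; [apply Rinv_0_lt_compat; lra|].
rewrite <- Rinv_1; apply Rinv_lt_contravar; lra.
Qed.

Lemma near0_tends : is_lim_seq near0 0%R.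
Proof.
apply is_lim_seq_ext with (fun n => / (INR (S n) + 1))%R.
{ intros n; unfold near0; rewrite S_INR; f_equal; ring. }
apply -> (is_lim_seq_incr_1 (fun n => / (INR n + 1))%R); apply is_lim_seq_inv_INR_1.
Qed.

Lemma tau_decr (n m : nat) : (n <= m)%nat -> (tau m <= tau n)%R.
Proof.
intros H; apply le_INR in H; pose proof (pos_INR n); unfold tau.
apply Rinv_le_contravar; nra.
Qed.

(** The terms with |b k - l| > e are finitely many in the application, so their
    excess is bounded by a multiple of the summable sequence [tau]; this makes the
    usual splitting of the sum unnecessary. *)
Lemma Abel_bound (b : nat -> C) (l : C) (e A y : R) :
  poly_bounded b -> (0 < y < 1)%R -> (0 <= A)%R ->
  (forall k, (Cmod (b k - l) <= e + A * tau k)%R) ->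
  (Cmod ((1 - y) * PS b y - l) <= e + A * (1 - y))%R.
Proof.
intros Hb Hy HA H.
assert (Hy1 : (Cmod y < 1)%R) by (rewrite Cmod_R, Rabs_pos_eq; lra).
assert (He : (0 <= e)%R).
{ apply Rnot_lt_le; intros He.
  assert (L : is_lim_seq (fun k => A * / (INR k + 1))%R 0%R)
    by (apply is_lim_seq_0_scal, is_lim_seq_inv_INR_1).
  apply is_lim_seq_spec in L.
  destruct (L (mkposreal (- e) ltac:(lra))) as [N HN]; specialize (HN N (Nat.le_refl _)).
  simpl in HN; rewrite Rminus_0_r in HN; pose proof (Rle_abs (A * / (INR N + 1))).
  pose proof (H N); pose proof (Cmod_ge_0 (b N - l)); pose proof (pos_INR N).
  assert (tau N <= / (INR N + 1))%R by (apply Rinv_le_contravar; nra).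
  nra. }
assert (T : Ctends (fun n => (1 - y) * Csum (fun k => b k * y ^ k) n - l * (1 - RtoC (y ^ n)%R))
   ((1 - y) * PS b y - l * (1 - 0))).
{ apply Ctends_minus; apply Ctends_scal.
  - apply is_Cseries_Csum, PS_correct; assumption.
  - apply Ctends_minus; [apply Ctends_const|].
    apply Ctends_RtoC, is_lim_seq_geom; rewrite Rabs_pos_eq; lra. }
replace (l * (1 - 0)) with l in T by ring.
refine (is_lim_seq_le_const _ _ _ _ (Ctends_Cmod _ _ T)).
intros n.
assert (B : (Cmod ((1 - y) * Csum (fun k => b k * y ^ k)%C n - l * (1 - RtoC (y ^ n)%R))
   <= e * (1 - y ^ n) + A * (1 - y) * tauS n)%R).
{ induction n as [|n IH].
  - simpl; replace ((1 - y) * 0 - l * (1 - 1)) with (RtoC 0) by ring; rewrite Cmod_0.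
    unfold tauS; simpl; replace (1 - / (0 + 1))%R with 0%R by field; lra.
  - cbn [Csum]; rewrite <- RtoC_pow.
    replace ((1 - y) * (Csum (fun k => b k * y ^ k) n + b n * RtoC (y ^ n)%R)
              - l * (1 - RtoC (y ^ S n)%R))
      with (((1 - y) * Csum (fun k => b k * y ^ k) n - l * (1 - RtoC (y ^ n)%R))
            + RtoC ((1 - y) * y ^ n)%R * (b n - l)).
    2:{ simpl pow; rewrite !RtoC_mult, RtoC_minus; ring. }
    eapply Rle_trans; [apply Cmod_triangle|].
    rewrite Cmod_mult, Cmod_R.
    assert (Py : (0 < y ^ n <= 1)%R).
    { split; [apply pow_lt; lra|].
      rewrite <- (pow1 n); apply pow_incr; lra. }
    rewrite Rabs_pos_eq by nra; rewrite tauS_S; simpl pow.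
    specialize (H n); pose proof (tau_pos n) as Pt.
    assert ((1 - y) * y ^ n * Cmod (b n - l) <= (1 - y) * y ^ n * (e + A * tau n))%R
      by (apply Rmult_le_compat_l; nra).
    assert ((1 - y) * y ^ n * (A * tau n) <= (1 - y) * (A * tau n))%R.
    { apply Rmult_le_compat_r; [nra|]; nra. }
    nra. }
eapply Rle_trans; [exact B|].
pose proof (tauS_bounds n); pose proof (pow_le y n ltac:(lra)).
assert (0 <= A * (1 - y))%R by nra; nra.
Qed.

Theorem Abel_near0 (b : nat -> C) (l : C) :
  poly_bounded b -> Ctends b l ->
  Ctends (fun m => near0 m * PS b (RtoC (1 - near0 m)%R)) l.
Proof.
intros Hb L; apply Ctends_spec; intros eps He.
destruct (proj1 (Ctends_spec b l) L (eps / 2)%R ltac:(lra)) as [N HN].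
assert (KB : exists B : R, (0 <= B)%R /\ forall k, (k < N)%nat -> (Cmod (b k - l) <= B)%R).
{ clear HN; induction N as [|N [B [PB IH]]].
  - exists 0%R; split; [lra | intros k Hk; lia].
  - exists (Rmax B (Cmod (b N - l))); split; [eapply Rle_trans; [exact PB | apply Rmax_l]|].
    intros k Hk; destruct (Nat.eq_dec k N) as [->|D]; [apply Rmax_r|].
    eapply Rle_trans; [apply IH; lia | apply Rmax_l]. }
destruct KB as [B [PB HB]].
set (A := (B / tau N)%R).
assert (PA : (0 <= A)%R) by (apply Rle_div_r; [apply tau_pos | lra]).
assert (H : forall k, (Cmod (b k - l) <= eps / 2 + A * tau k)%R).
{ intros k; pose proof (tau_pos k) as Pk; pose proof (tau_pos N) as PN.
  destruct (Nat.le_gt_cases N k) as [C|C].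
  - specialize (HN k C); nra.
  - specialize (HB k C).
    assert (B <= A * tau k)%R.
    { replace B with (A * tau N)%R by (unfold A; field; lra).
      apply Rmult_le_compat_l; [exact PA | apply tau_decr; lia]. }
    lra. }
pose proof (is_lim_seq_0_scal A _ near0_tends) as LA; apply is_lim_seq_spec in LA.
destruct (LA (mkposreal (eps / 2) ltac:(lra))) as [N' HN'].
exists N'; intros m Hm; specialize (HN' m Hm); simpl in HN'.
rewrite Rminus_0_r in HN'; pose proof (Rle_abs (A * near0 m)).
pose proof (near0_bounds m) as Bm.
pose proof (Abel_bound b l (eps / 2) A (1 - near0 m) Hb ltac:(lra) PA H) as K.
replace (1 - RtoC (1 - near0 m)%R) with (RtoC (near0 m)) in K
  by (rewrite RtoC_minus; ring).
replace (1 - (1 - near0 m))%R with (near0 m) in K by ring; lra.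
Qed.

(** * Bailey's summation at 1/2 and its derivative in the lower parameter *)

Definition hyp_coef (a g : C) (n : nat) : C :=
  pochhammer a n * pochhammer (1 - a) n / (INR (fact n) * pochhammer g n).

(** Minus the logarithmic derivative in [g] of the coefficient [hyp_coef a g n]. *)
Definition shifted_harmonic (g : C) (n : nat) : C := Csum (fun k => / (g + INR k)) n.

Definition hyp_harmonic_coef (a g : C) (n : nat) : C := hyp_coef a g n * shifted_harmonic g n.

Lemma RtoC_neq_0 (r : R) : r <> 0%R -> RtoC r <> 0.
Proof. intros H E; apply RtoC_inj in E; contradiction. Qed.

Lemma INR_S_neq_0 (n : nat) : RtoC (INR (S n)) <> 0.
Proof. apply RtoC_neq_0, not_0_INR; discriminate. Qed.

Lemma INR_plus_1_neq_0 (n : nat) : INR n + 1 <> 0.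
Proof. rewrite <- RtoC_plus, <- S_INR; apply INR_S_neq_0. Qed.

Lemma INR_fact_C_neq_0 (n : nat) : RtoC (INR (fact n)) <> 0.
Proof. apply RtoC_neq_0, INR_fact_neq_0. Qed.

Lemma not_pole_pos (g : R) : (0 < g)%R -> not_pole g.
Proof.
intros H k; rewrite <- RtoC_plus; apply RtoC_neq_0; pose proof (pos_INR k); lra.
Qed.

Lemma hyp_coef_S (a g : C) (n : nat) :
  not_pole g ->
  hyp_coef a g (S n) = hyp_coef a g n * ((INR n + a) * (INR n + 1 - a) / ((INR n + 1) * (INR n + g))).
Proof.
intros Hg; unfold hyp_coef; cbn [pochhammer].
rewrite fact_simpl, mult_INR, S_INR, RtoC_mult, RtoC_plus.
pose proof (pochhammer_neq_0 g n Hg) as P; pose proof (INR_plus_1_neq_0 n) as P1.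
pose proof (INR_fact_C_neq_0 n) as P2; specialize (Hg n).
assert (Hg' : INR n + g <> 0) by (rewrite Cplus_comm; exact Hg).
field; repeat split; assumption.
Qed.

Lemma hyp_op_hyp_coef (a g : C) (n : nat) :
  not_pole g -> hyp_op_coef a g (hyp_coef a g) n = 0.
Proof.
intros Hg; unfold hyp_op_coef; rewrite hyp_coef_S by exact Hg.
rewrite S_INR, RtoC_plus; pose proof (INR_plus_1_neq_0 n).
specialize (Hg n); rewrite Cplus_comm in Hg; field; split; assumption.
Qed.

Lemma hyp_coef_growth (a : C) (g : R) (n : nat) :
  (0 < g)%R ->
  (Cmod (hyp_coef a g (S n)) <= (1 + Cmod (a * (1 - a)) / g / (INR n + 1)) * Cmod (hyp_coef a g n))%R.
Proof.
intros Hg; rewrite hyp_coef_S by (apply not_pole_pos, Hg).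
rewrite Cmod_mult, Rmult_comm; apply Rmult_le_compat_r; [apply Cmod_ge_0|].
pose proof (pos_INR n) as Pn; pose proof (Cmod_ge_0 (a * (1 - a))) as Pa.
rewrite <- !RtoC_plus, <- RtoC_mult.
rewrite Cmod_div by (apply RtoC_neq_0; nra).
rewrite Cmod_R, Rabs_pos_eq by nra.
apply Rle_div_l; [nra|].
replace ((INR n + a) * (RtoC (INR n + 1)%R - a)) with (RtoC (INR n * (INR n + 1))%R + a * (1 - a))
  by (rewrite RtoC_mult, RtoC_plus; ring).
eapply Rle_trans; [apply Cmod_triangle|]; rewrite Cmod_R, Rabs_pos_eq by nra.
replace ((1 + Cmod (a * (1 - a)) / g / (INR n + 1)) * ((INR n + 1) * (INR n + g)))%R
  with ((INR n + 1) * (INR n + g) + Cmod (a * (1 - a)) * ((INR n + g) / g))%R by (field; lra).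
assert (1 <= (INR n + g) / g)%R by (apply Rle_div_r; lra).
nra.
Qed.

Lemma poly_bounded_hyp_coef (a : C) (g : R) : (0 < g)%R -> poly_bounded (hyp_coef a g).
Proof.
intros Hg; set (k := (Cmod (a * (1 - a)) / g)%R).
assert (Pk : (0 <= k)%R) by (apply Rle_div_r; [exact Hg | rewrite Rmult_0_l; apply Cmod_ge_0]).
destruct (nfloor_ex k Pk) as [K HK].
exists 1%R, (S K); induction n as [|n IH].
- unfold hyp_coef; simpl pochhammer; simpl fact; simpl INR.
  replace (1 * 1 / (1 * 1)) with (RtoC 1) by field; rewrite Cmod_1, Rplus_0_l, pow1; lra.
- eapply Rle_trans; [apply hyp_coef_growth, Hg|]; fold k.
  pose proof (pos_INR n) as Pn.
  rewrite Rmult_1_l in *.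
  apply Rle_trans with ((1 + / (INR n + 1)) ^ S K * (INR n + 1) ^ S K)%R.
  + assert (Pi : (0 < / (INR n + 1))%R) by (apply Rinv_0_lt_compat; lra).
    apply Rmult_le_compat; [ | apply Cmod_ge_0 | | exact IH].
    * unfold Rdiv; nra.
    * eapply Rle_trans; [|apply poly, Pi]; rewrite S_INR; unfold Rdiv; nra.
  + rewrite <- Rpow_mult_distr; right; f_equal; rewrite S_INR; field; lra.
Qed.

Lemma poly_bounded_inv_plus (g : R) :
  (0 < g)%R -> poly_bounded (fun n => / (g + INR n)).
Proof.
intros Hg; exists (/ g)%R, O; intros n; pose proof (pos_INR n).
rewrite <- RtoC_plus, <- RtoC_inv by lra; rewrite Cmod_R, Rabs_pos_eq.
- simpl; rewrite Rmult_1_r; apply Rinv_le_contravar; lra.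
- left; apply Rinv_0_lt_compat; lra.
Qed.

Lemma Cmod_shifted_harmonic (g g0 : R) (n : nat) :
  (0 < g0 <= g)%R -> (Cmod (shifted_harmonic g n) <= INR n / g0)%R.
Proof.
intros Hg; unfold shifted_harmonic; induction n as [|n IH].
- simpl; rewrite Cmod_0; unfold Rdiv; lra.
- cbn [Csum]; eapply Rle_trans; [apply Cmod_triangle|].
  rewrite S_INR; pose proof (pos_INR n).
  replace ((INR n + 1) / g0)%R with (INR n / g0 + / g0)%R by (field; lra).
  apply Rplus_le_compat; [exact IH|].
  rewrite <- RtoC_plus, <- RtoC_inv by lra; rewrite Cmod_R, Rabs_pos_eq.
  + apply Rinv_le_contravar; lra.
  + left; apply Rinv_0_lt_compat; lra.
Qed.

Lemma poly_bounded_shifted_harmonic (g : R) :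
  (0 < g)%R -> poly_bounded (shifted_harmonic g).
Proof.
intros Hg; exists (/ g)%R, 1%nat; intros n.
eapply Rle_trans; [apply (Cmod_shifted_harmonic g g); lra|].
pose proof (Rinv_0_lt_compat g Hg); unfold Rdiv; simpl; nra.
Qed.

Lemma poly_bounded_hyp_harmonic (a : C) (g : R) :
  (0 < g)%R -> poly_bounded (hyp_harmonic_coef a g).
Proof.
intros Hg; apply poly_bounded_mult;
  [apply poly_bounded_hyp_coef | apply poly_bounded_shifted_harmonic]; exact Hg.
Qed.

Definition half : C := / 2.

Lemma C2_neq_0 : RtoC 2 <> 0.
Proof. apply RtoC_neq_0; lra. Qed.

Lemma half_RtoC : half = RtoC (/ 2)%R.
Proof. unfold half; rewrite RtoC_inv by lra; reflexivity. Qed.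

Lemma Cmod_half : (Cmod half < 1)%R.
Proof. rewrite half_RtoC, Cmod_R, Rabs_pos_eq; lra. Qed.

Lemma PS_terms_tend_0 (c : nat -> C) (x : C) :
  poly_bounded c -> (Cmod x < 1)%R -> Ctends (fun n => c n * x ^ n) 0.
Proof.
intros Hc Hx; pose proof (proj1 (is_Cseries_Csum _ _) (PS_correct c x Hc Hx)) as H.
replace (RtoC 0) with (PS c x - PS c x) by ring.
apply Ctends_ext with (fun n => Csum (fun k => c k * x ^ k) (S n) - Csum (fun k => c k * x ^ k) n).
- intros n; simpl; ring.
- apply Ctends_minus; [apply Ctends_incr_1, H | exact H].
Qed.

Definition bailey_ratio (a g : C) : C := (g + a) * (g + 1 - a) / (g * (g + 1)).

Definition bailey_log_deriv (a g : C) : C := / g + / (g + 1) - / (g + a) - / (g + 1 - a).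

Lemma not_pole_neq_0 (g : C) (n : nat) :
  not_pole g -> g <> 0 /\ g + 1 <> 0 /\ g + INR n <> 0 /\ g + INR n + 1 <> 0.
Proof.
intros H; repeat split.
- intros E; apply (H O); simpl; rewrite E; ring.
- apply (H 1%nat).
- apply H.
- intros E; apply (H (S n)); rewrite S_INR, RtoC_plus; rewrite <- E; ring.
Qed.

Lemma pochhammer_plus_2 (g : C) (n : nat) :
  g * (g + 1) * pochhammer (g + 2) n = pochhammer g n * ((g + INR n) * (g + INR n + 1)).
Proof.
induction n as [|n IH]; [simpl; ring|].
cbn [pochhammer]; rewrite Cmult_assoc, IH, S_INR, RtoC_plus; ring.
Qed.

Lemma hyp_coef_plus_2 (a g : C) (n : nat) :
  not_pole g ->
  hyp_coef a (g + 2) n = hyp_coef a g n * (g * (g + 1) / ((g + INR n) * (g + INR n + 1))).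
Proof.
intros Hg; destruct (not_pole_neq_0 g n Hg) as [G0 [G1 [Gn Gn1]]].
assert (P : pochhammer (g + 2) n
   = pochhammer g n * ((g + INR n) * (g + INR n + 1)) / (g * (g + 1))).
{ rewrite <- pochhammer_plus_2; field; split; assumption. }
unfold hyp_coef; rewrite P.
pose proof (pochhammer_neq_0 g n Hg); pose proof (INR_fact_C_neq_0 n).
field; repeat split; assumption.
Qed.

Lemma shifted_harmonic_plus_2 (g : C) (n : nat) :
  not_pole g ->
  shifted_harmonic (g + 2) n
  = shifted_harmonic g n - / g - / (g + 1) + / (g + INR n) + / (g + INR n + 1).
Proof.
intros Hg; unfold shifted_harmonic; induction n as [|n IH].
- destruct (not_pole_neq_0 g 0 Hg) as [G0 [G1 _]]; simpl.
  replace (g + 0) with g by ring; ring.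
- cbn [Csum]; rewrite IH.
  replace (g + 2 + INR n) with (g + INR (S n) + 1) by (rewrite S_INR, RtoC_plus; ring).
  replace (g + INR n + 1) with (g + INR (S n)) by (rewrite S_INR, RtoC_plus; ring).
  ring.
Qed.

Lemma half_pow_S (n : nat) : half ^ S n = half ^ n * / 2.
Proof. rewrite Cpow_S; unfold half; ring. Qed.

(** Zeilberger's certificate for the step [g -> g + 2]. *)
Lemma bailey_telescope (a g : C) (N : nat) :
  not_pole g ->
  Csum (fun n => hyp_coef a g n * half ^ n
                 - bailey_ratio a g * (hyp_coef a (g + 2) n * half ^ n)) N
  = - (2) * INR N * / (g + INR N) * hyp_coef a g N * half ^ N.
Proof.
intros Hg; induction N as [|N IH].
- simpl; ring.
- cbn [Csum]; rewrite IH, hyp_coef_plus_2, hyp_coef_S, half_pow_S, S_INR, RtoC_plus by exact Hg.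
  destruct (not_pole_neq_0 g N Hg) as [G0 [G1 [Gn Gn1]]].
  unfold bailey_ratio; pose proof (INR_plus_1_neq_0 N); pose proof C2_neq_0.
  field; repeat split; try assumption.
  + rewrite Cplus_comm; exact Gn.
  + intros E; apply Gn1; rewrite <- E; ring.
Qed.

(** The previous identity differentiated with respect to [g]. *)
Lemma bailey_harmonic_telescope (a g : C) (N : nat) :
  not_pole g -> g + a <> 0 -> g + 1 - a <> 0 ->
  Csum (fun n => hyp_harmonic_coef a g n * half ^ n
                 - bailey_ratio a g * (hyp_harmonic_coef a (g + 2) n * half ^ n)
                 - bailey_log_deriv a g * bailey_ratio a g * (hyp_coef a (g + 2) n * half ^ n)) N
  = - (2) * INR N * / (g + INR N) * hyp_coef a g N
    * (shifted_harmonic g N + / (g + INR N)) * half ^ N.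
Proof.
intros Hg Ha1 Ha2; induction N as [|N IH].
- simpl; ring.
- cbn [Csum]; rewrite IH; unfold hyp_harmonic_coef.
  rewrite shifted_harmonic_plus_2, hyp_coef_plus_2, hyp_coef_S, half_pow_S by exact Hg.
  replace (shifted_harmonic g (S N)) with (shifted_harmonic g N + / (g + INR N)) by reflexivity.
  rewrite S_INR, RtoC_plus.
  destruct (not_pole_neq_0 g N Hg) as [G0 [G1 [Gn Gn1]]].
  assert (Gn' : INR N + g <> 0) by (rewrite Cplus_comm; exact Gn).
  assert (Gn1' : g + (INR N + 1) <> 0) by (intros E; apply Gn1; rewrite <- E; ring).
  unfold bailey_ratio, bailey_log_deriv; pose proof (INR_plus_1_neq_0 N); pose proof C2_neq_0.
  generalize (shifted_harmonic g N) (hyp_coef a g N) (half ^ N); intros s c p.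
  field; repeat split; assumption.
Qed.

Lemma half_sum_tends_0 (c : nat -> C) (v : nat -> C) :
  poly_bounded c -> (forall n, v n = c n * half ^ n) -> Ctends v 0.
Proof.
intros Hc H; apply Ctends_ext with (fun n => c n * half ^ n).
- intros n; symmetry; apply H.
- apply PS_terms_tend_0; [exact Hc | apply Cmod_half].
Qed.

Lemma poly_bounded_scal (k : C) (c : nat -> C) : poly_bounded c -> poly_bounded (fun n => k * c n).
Proof. apply poly_bounded_mult, poly_bounded_const. Qed.

Lemma bailey_step (a : C) (g : R) :
  (0 < g)%R ->
  PS (hyp_coef a g) half = bailey_ratio a g * PS (hyp_coef a (g + 2)%R) half.
Proof.
intros Hg; pose proof (not_pole_pos g Hg) as Np.
assert (E : PS (hyp_coef a g) half - bailey_ratio a g * PS (hyp_coef a (g + 2)%R) half = 0).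
{ refine (is_Cseries_unique _ _ _ (is_Cseries_minus _ _ _ _ (PS_correct _ half _ Cmod_half)
    (is_Cseries_scal _ _ _ (PS_correct _ half _ Cmod_half))) _).
  - apply poly_bounded_hyp_coef, Hg.
  - apply poly_bounded_hyp_coef; lra.
  - apply is_Cseries_Csum.
    apply half_sum_tends_0 with (fun n => - (2) * INR n * / (g + INR n) * hyp_coef a g n).
    + apply poly_bounded_mult; [|apply poly_bounded_hyp_coef, Hg].
      apply poly_bounded_mult; [|apply poly_bounded_inv_plus, Hg].
      apply poly_bounded_scal, poly_bounded_INR.
    + intros n; rewrite RtoC_plus; apply bailey_telescope, Np. }
replace (PS (hyp_coef a g) half) with
  (PS (hyp_coef a g) half - bailey_ratio a g * PS (hyp_coef a (g + 2)%R) half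
   + bailey_ratio a g * PS (hyp_coef a (g + 2)%R) half) by ring.
rewrite E; ring.
Qed.

Lemma bailey_harmonic_step (a : C) (g : R) :
  (0 < g)%R -> g + a <> 0 -> g + 1 - a <> 0 ->
  PS (hyp_harmonic_coef a g) half
  = bailey_log_deriv a g * PS (hyp_coef a g) half
    + bailey_ratio a g * PS (hyp_harmonic_coef a (g + 2)%R) half.
Proof.
intros Hg Ha1 Ha2; pose proof (not_pole_pos g Hg) as Np.
assert (E : PS (hyp_harmonic_coef a g) half
   - bailey_ratio a g * PS (hyp_harmonic_coef a (g + 2)%R) half
   - bailey_log_deriv a g * bailey_ratio a g * PS (hyp_coef a (g + 2)%R) half = 0).
{ refine (is_Cseries_unique _ _ _ (is_Cseries_minus _ _ _ _
    (is_Cseries_minus _ _ _ _ (PS_correct _ half _ Cmod_half)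
      (is_Cseries_scal _ _ _ (PS_correct _ half _ Cmod_half)))
    (is_Cseries_scal _ _ _ (PS_correct _ half _ Cmod_half))) _).
  - apply poly_bounded_hyp_harmonic, Hg.
  - apply poly_bounded_hyp_harmonic; lra.
  - apply poly_bounded_hyp_coef; lra.
  - apply is_Cseries_Csum.
    apply half_sum_tends_0 with (fun n => - (2) * INR n * / (g + INR n) * hyp_coef a g n
       * (shifted_harmonic g n + / (g + INR n))).
    + pose proof (poly_bounded_inv_plus g Hg) as Hi.
      apply poly_bounded_mult; [apply poly_bounded_mult|].
      * apply poly_bounded_mult; [apply poly_bounded_scal, poly_bounded_INR | exact Hi].
      * apply poly_bounded_hyp_coef, Hg.
      * apply poly_bounded_plus; [apply poly_bounded_shifted_harmonic, Hg | exact Hi].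
    + intros n; rewrite RtoC_plus; apply bailey_harmonic_telescope; assumption. }
rewrite (bailey_step a g Hg).
set (X := PS (hyp_coef a (g + 2)%R) half) in *.
set (Y := PS (hyp_harmonic_coef a (g + 2)%R) half) in *.
replace (PS (hyp_harmonic_coef a g) half) with
  (PS (hyp_harmonic_coef a g) half - bailey_ratio a g * Y
   - bailey_log_deriv a g * bailey_ratio a g * X
   + (bailey_ratio a g * Y + bailey_log_deriv a g * bailey_ratio a g * X)) by ring.
rewrite E; ring.
Qed.

(** ** The limit of large lower parameter *)

(** For [n >= 1] the quotient of the two Pochhammer symbols is at most that of their
    first factors. *)
Lemma hyp_coef_decay (a : C) (g g0 : R) (n : nat) :
  (0 < g0 <= g)%R ->
  (Cmod (hyp_coef a g (S n)) <= g0 / g * Cmod (hyp_coef a g0 (S n)))%R.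
Proof.
intros Hg.
assert (K : forall g n, (0 < g)%R -> (Cmod (hyp_coef a g (S n))
   = Cmod (hyp_coef a g n) * (Cmod ((INR n + a) * (INR n + 1 - a)) / ((INR n + 1) * (INR n + g))))%R).
{ clear; intros g n Hg; pose proof (pos_INR n).
  rewrite hyp_coef_S by (apply not_pole_pos, Hg); rewrite Cmod_mult; f_equal.
  rewrite Cmod_div.
  - f_equal; rewrite <- !RtoC_plus, <- RtoC_mult, Cmod_R, Rabs_pos_eq; nra.
  - rewrite <- !RtoC_plus, <- RtoC_mult; apply RtoC_neq_0; nra. }
assert (Pq : (0 < g0 / g)%R) by (apply Rdiv_lt_0_compat; lra).
induction n as [|n IH].
- rewrite !K by lra.
  replace (hyp_coef a g 0) with (hyp_coef a g0 0) by reflexivity.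
  right; simpl; field; lra.
- rewrite (K g (S n)), (K g0 (S n)) by lra; rewrite <- Rmult_assoc.
  set (N := INR (S n)); assert (PN : (0 <= N)%R) by apply pos_INR.
  apply Rmult_le_compat; [apply Cmod_ge_0 | | exact IH |].
  + apply Rle_div_r; [nra | rewrite Rmult_0_l; apply Cmod_ge_0].
  + apply Rmult_le_compat_l; [apply Cmod_ge_0|]; apply Rinv_le_contravar; nra.
Qed.

Lemma PS_half_decay (c d : nat -> C) (q : R) :
  poly_bounded c -> poly_bounded d ->
  (forall n, (Cmod (c (S n)) <= q * Cmod (d (S n)))%R) ->
  (Cmod (PS c half - c O)
     <= q * Series (fun n => Cmod (d (S n) * half ^ S n)))%R.
Proof.
intros Hc Hd H.
rewrite <- Series_scal_l.
apply Cseries_le with (u := fun n => c (S n) * half ^ S n).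
- intros n; rewrite !Cmod_mult, <- Rmult_assoc.
  apply Rmult_le_compat_r; [apply Cmod_ge_0 | apply H].
- apply (is_Cseries_incr_1 (fun n => c n * half ^ n)).
  replace (c O * half ^ 0 + (PS c half - c O)) with (PS c half) by (simpl; ring).
  apply PS_correct; [exact Hc | apply Cmod_half].
- apply (@ex_series_scal R_AbsRing R_NormedModule q).
  apply (ex_series_incr_1 (fun n => Cmod (d n * half ^ n))).
  destruct (poly_bounded_pos d Hd) as [M [K [PM B]]].
  apply (@ex_series_le R_AbsRing R_CompleteNormedModule) with
    (fun n => M * ((INR n + 1) ^ K * (/ 2) ^ n))%R.
  + intros n; change (Rabs (Cmod (d n * half ^ n)) <= M * ((INR n + 1) ^ K * (/ 2) ^ n))%R.
    rewrite Rabs_pos_eq, Cmod_mult, Cmod_pow, half_RtoC, Cmod_R, (Rabs_pos_eq (/ 2)),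
      <- Rmult_assoc by (apply Cmod_ge_0 || lra).
    apply Rmult_le_compat_r; [apply pow_le; lra | apply B].
  + apply (@ex_series_scal R_AbsRing R_NormedModule M), ex_series_poly_geom; lra.
Qed.

Definition lower_param (g0 : R) (j : nat) : R := (g0 + 2 * INR j)%R.

Lemma lower_param_pos (g0 : R) (j : nat) :
  (0 < g0)%R -> (0 < g0 <= lower_param g0 j)%R.
Proof. intros H; unfold lower_param; pose proof (pos_INR j); lra. Qed.

Lemma lower_param_S (g0 : R) (j : nat) : lower_param g0 (S j) = (lower_param g0 j + 2)%R.
Proof. unfold lower_param; rewrite S_INR; ring. Qed.

Lemma lower_param_ratio_tends (g0 : R) :
  (0 < g0)%R -> is_lim_seq (fun j => g0 / lower_param g0 j)%R 0%R.
Proof.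
intros Hg.
apply is_lim_seq_le_le with (u := fun _ => 0%R) (w := fun j => ((g0 + 1) * / (INR j + 1))%R).
- intros j; pose proof (pos_INR j); unfold lower_param; split.
  + left; apply Rdiv_lt_0_compat; lra.
  + apply Rle_div_l; [lra|].
    replace ((g0 + 1) * / (INR j + 1) * (g0 + 2 * INR j))%R
      with ((g0 + 1) * (g0 + 2 * INR j) / (INR j + 1))%R by (field; lra).
    apply Rle_div_r; nra.
- apply is_lim_seq_const.
- apply is_lim_seq_0_scal, is_lim_seq_inv_INR_1.
Qed.

Lemma hyp_half_tends_1 (a : C) (g0 : R) :
  (0 < g0)%R -> Ctends (fun j => PS (hyp_coef a (lower_param g0 j)) half) 1.
Proof.
intros Hg.
apply Ctends_of_le with (v := fun j => (Series (fun n => Cmod (hyp_coef a g0 (S n) * half ^ S n))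
   * (g0 / lower_param g0 j))%R).
- intros j; destruct (lower_param_pos g0 j Hg) as [_ L].
  replace (RtoC 1) with (hyp_coef a (lower_param g0 j) 0)
    by (unfold hyp_coef; simpl; field).
  rewrite Rmult_comm; apply PS_half_decay.
  + apply poly_bounded_hyp_coef; lra.
  + apply poly_bounded_hyp_coef; lra.
  + intros n; apply hyp_coef_decay; lra.
- apply is_lim_seq_0_scal, lower_param_ratio_tends, Hg.
Qed.

Lemma hyp_harmonic_half_tends_0 (a : C) (g0 : R) :
  (0 < g0)%R -> Ctends (fun j => PS (hyp_harmonic_coef a (lower_param g0 j)) half) 0.
Proof.
intros Hg.
set (d := fun n => hyp_coef a g0 n * RtoC (INR n / g0)%R).
apply Ctends_of_le with (v := fun j => (Series (fun n => Cmod (d (S n) * half ^ S n))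
   * (g0 / lower_param g0 j))%R).
- intros j; destruct (lower_param_pos g0 j Hg) as [_ L].
  replace (RtoC 0) with (hyp_harmonic_coef a (lower_param g0 j) 0)
    by (unfold hyp_harmonic_coef, shifted_harmonic; simpl; ring).
  rewrite Rmult_comm; apply PS_half_decay.
  + apply poly_bounded_hyp_harmonic; lra.
  + apply poly_bounded_mult; [apply poly_bounded_hyp_coef, Hg|].
    apply poly_bounded_le with (fun n => / g0 * INR n).
    * intros n; right; f_equal; unfold Rdiv; rewrite RtoC_mult, RtoC_inv by lra; ring.
    * apply poly_bounded_scal, poly_bounded_INR.
  + intros n; unfold hyp_harmonic_coef, d; rewrite !Cmod_mult, Cmod_R, <- Rmult_assoc.
    apply Rmult_le_compat; try apply Cmod_ge_0; [apply hyp_coef_decay; lra|].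
    eapply Rle_trans; [apply Cmod_shifted_harmonic with (g0 := g0); lra | apply Rle_abs].
- apply is_lim_seq_0_scal, lower_param_ratio_tends, Hg.
Qed.

(** The factors [v n] may vanish for small [n], so one cannot simply divide. *)
Lemma Ctends_quotient_of_prod (u v : nat -> C) (k : C) :
  (forall n, u n * v n = k) -> Ctends v 1 -> Ctends u k.
Proof.
intros H Hv; apply Ctends_spec; intros eps He.
pose proof (Cmod_ge_0 k) as Pk.
assert (Pd : (0 < eps / (2 * Cmod k + 1))%R) by (apply Rdiv_lt_0_compat; lra).
destruct (proj1 (Ctends_spec v 1) Hv (Rmin (/ 2) (eps / (2 * Cmod k + 1)))) as [N HN].
{ apply Rmin_pos; lra. }
exists N; intros n Hn; specialize (HN n Hn).
assert (H1 : (Cmod (v n - 1) < / 2)%R) by (eapply Rlt_le_trans; [exact HN | apply Rmin_l]).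
assert (H2 : (Cmod (v n - 1) < eps / (2 * Cmod k + 1))%R)
  by (eapply Rlt_le_trans; [exact HN | apply Rmin_r]).
apply Rlt_div_r in H2; [|lra].
assert (Lv : (/ 2 <= Cmod (v n))%R).
{ pose proof (Cmod_triangle (v n) (- (v n - 1))) as T.
  replace (v n + - (v n - 1)) with (RtoC 1) in T by ring; rewrite Cmod_opp, Cmod_1 in T; lra. }
assert (Lu : (Cmod (u n) <= 2 * Cmod k)%R).
{ rewrite <- (H n), Cmod_mult; pose proof (Cmod_ge_0 (u n)); nra. }
replace (u n - k) with (- (u n * (v n - 1))) by (rewrite <- (H n); ring).
rewrite Cmod_opp, Cmod_mult.
pose proof (Cmod_ge_0 (v n - 1)); nra.
Qed.

Lemma bailey_iterate (a : C) (g0 : R) (N : nat) :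
  (0 < g0)%R ->
  Cprod (fun j => bailey_ratio a (lower_param g0 j)) N * PS (hyp_coef a (lower_param g0 N)) half
  = PS (hyp_coef a g0) half.
Proof.
intros Hg; induction N as [|N IH].
- simpl; replace (lower_param g0 0) with g0 by (unfold lower_param; simpl; ring); ring.
- rewrite <- IH, lower_param_S; cbn [Cprod].
  rewrite (bailey_step a (lower_param g0 N)) by (pose proof (lower_param_pos g0 N Hg); lra).
  ring.
Qed.

(** Shifting the lower parameter by 2 multiplies the value at 1/2 by an explicit
    rational factor, and the value tends to 1 as the parameter tends to infinity. *)
Theorem bailey_product (a : C) (g0 : R) :
  (0 < g0)%R ->
  Ctends (Cprod (fun j => bailey_ratio a (lower_param g0 j))) (PS (hyp_coef a g0) half).
Proof.
intros Hg.
apply Ctends_quotient_of_prod with (fun N => PS (hyp_coef a (lower_param g0 N)) half).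
- intros N; apply bailey_iterate, Hg.
- apply hyp_half_tends_1, Hg.
Qed.

(** The remainder after [N] shifts is a convergent product times the harmonic series
    at the parameter g0 + 2N, which tends to 0. *)
Theorem bailey_log_derivative (a : C) (g0 : R) :
  (0 < g0)%R ->
  (forall j, lower_param g0 j + a <> 0) -> (forall j, lower_param g0 j + 1 - a <> 0) ->
  Ctends (fun N => PS (hyp_coef a g0) half
                   * Csum (fun j => bailey_log_deriv a (lower_param g0 j)) N)
         (PS (hyp_harmonic_coef a g0) half).
Proof.
intros Hg H1 H2.
apply Ctends_ext with (fun N => PS (hyp_harmonic_coef a g0) half
   - Cprod (fun j => bailey_ratio a (lower_param g0 j)) N
     * PS (hyp_harmonic_coef a (lower_param g0 N)) half).
- intros N; induction N as [|N IH].
  + simpl; replace (lower_param g0 0) with g0 by (unfold lower_param; simpl; ring); ring.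
  + cbn [Csum]; rewrite Cmult_plus_distr_l, <- IH, <- (bailey_iterate a g0 N Hg), lower_param_S.
    rewrite (bailey_harmonic_step a (lower_param g0 N)); auto.
    2:{ pose proof (lower_param_pos g0 N Hg); lra. }
    cbn [Cprod]; ring.
- replace (PS (hyp_harmonic_coef a g0) half) with
    (PS (hyp_harmonic_coef a g0) half - PS (hyp_coef a g0) half * 0) at 1 by ring.
  apply Ctends_minus; [apply Ctends_const|].
  apply Ctends_mult; [apply bailey_product | apply hyp_harmonic_half_tends_0]; exact Hg.
Qed.

(** * The sine as a limit of products of Pochhammer symbols *)

Definition Ccos (z : C) : C := (Cexp (Ci * z) + Cexp (- (Ci * z))) / 2.

Lemma Ci_sq : Ci * Ci = - (1).
Proof. apply injective_projections; simpl; ring. Qed.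

Lemma Cexp_Ci_RtoC (r : R) : Cexp (Ci * r) = (cos r, sin r).
Proof.
unfold Cexp.
replace (Re (Ci * r)) with 0%R by (unfold Re; simpl; ring).
replace (Im (Ci * r)) with r by (unfold Im; simpl; ring).
rewrite exp_0; apply injective_projections; simpl; ring.
Qed.

Lemma Csin_RtoC (r : R) : Csin r = sin r.
Proof.
unfold Csin; replace (- (Ci * r)) with (Ci * RtoC (- r)%R) by (rewrite RtoC_opp; ring).
rewrite !Cexp_Ci_RtoC, cos_neg, sin_neg.
replace ((cos r, sin r) - (cos r, (- sin r)%R)) with (2 * Ci * sin r)
  by (apply injective_projections; simpl; ring).
field; apply Ci_nz.
Qed.

Lemma Ccos_RtoC (r : R) : Ccos r = cos r.
Proof.
unfold Ccos; replace (- (Ci * r)) with (Ci * RtoC (- r)%R) by (rewrite RtoC_opp; ring).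
rewrite !Cexp_Ci_RtoC, cos_neg, sin_neg.
replace ((cos r, sin r) + (cos r, (- sin r)%R)) with (2 * cos r)
  by (apply injective_projections; simpl; ring).
field.
Qed.

Lemma is_Cderive_ext (f g : C -> C) (x l : C) :
  (forall y, f y = g y) -> is_Cderive f x l -> is_Cderive g x l.
Proof. exact (@is_derive_ext C_AbsRing (AbsRing_NormedModule C_AbsRing) f g x l). Qed.

Lemma is_Cderive_scal (k : C) (f : C -> C) (x l : C) :
  is_Cderive f x l -> is_Cderive (fun y => k * f y) x (k * l).
Proof.
intros H; eapply is_Cderive_eq.
- apply (is_Cderive_mult (fun _ => k) f); [apply is_Cderive_const | exact H].
- ring.
Qed.

Lemma is_Cderive_Cexp_opp_lin (z : C) :
  is_Cderive (fun y => Cexp (- (Ci * y))) z (- Ci * Cexp (- (Ci * z))).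
Proof.
replace (- (Ci * z)) with (- Ci * z) by ring.
apply is_Cderive_ext with (fun y => Cexp (- Ci * y)).
- intros y; f_equal; ring.
- apply is_Cderive_Cexp_lin.
Qed.

Lemma is_Cderive_Csin (z : C) : is_Cderive Csin z (Ccos z).
Proof.
apply is_Cderive_ext with (fun y => / (2 * Ci) * (Cexp (Ci * y) - Cexp (- (Ci * y)))).
{ intros y; unfold Csin; apply Cmult_comm. }
eapply is_Cderive_eq.
- apply is_Cderive_scal, is_Cderive_minus; [apply is_Cderive_Cexp_lin | apply is_Cderive_Cexp_opp_lin].
- unfold Ccos; field; apply Ci_nz.
Qed.

Lemma is_Cderive_Ccos (z : C) : is_Cderive Ccos z (- Csin z).
Proof.
apply is_Cderive_ext with (fun y => / 2 * (Cexp (Ci * y) + Cexp (- (Ci * y)))).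
{ intros y; unfold Ccos; apply Cmult_comm. }
eapply is_Cderive_eq.
- apply is_Cderive_scal, is_Cderive_plus; [apply is_Cderive_Cexp_lin | apply is_Cderive_Cexp_opp_lin].
- unfold Csin; pose proof Ci_nz as H; pose proof C2_neq_0 as H2.
  replace (- ((Cexp (Ci * z) - Cexp (- (Ci * z))) / (2 * Ci)))
    with (- (Ci * Ci) * - ((Cexp (Ci * z) - Cexp (- (Ci * z))) / (2 * Ci)))
    by (rewrite Ci_sq; ring).
  field; assumption.
Qed.

(** The first integrals (f' - i mu f) e^(i mu t) and (f' + i mu f) e^(-i mu t) are
    constant; for [mu <> 0] they determine f. *)
Lemma harmonic_oscillator (f f' : C -> C) (mu : C) (T : R) :
  (0 <= T)%R ->
  (forall s : R, (0 <= s <= T)%R ->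
     is_Cderive f s (f' s) /\ is_Cderive f' s (- (mu * mu) * f s)) ->
  f 0 = 1 -> f' 0 = 0 -> f T = Ccos (mu * T).
Proof.
intros HT H F0 F0'.
assert (P : forall k : C, k * k = - (mu * mu) -> forall t : R, (0 <= t <= T)%R ->
   (f' t + k * f t) * Cexp (- k * t) = k).
{ intros k Hk t Ht.
  pose (p := fun y => (f' y + k * f y) * Cexp (- k * y)).
  assert (E : p t = p 0).
  { apply Cderive_zero_const; intros s Hs.
    replace (0 + s * (t - 0)) with (RtoC (s * t)%R) by (rewrite RtoC_mult; ring).
    destruct (H (s * t)%R) as [H1 H2]; [nra|].
    eapply is_Cderive_eq.
    - apply is_Cderive_mult; [apply is_Cderive_plus; [exact H2 | apply is_Cderive_scal, H1]|].
      apply is_Cderive_Cexp_lin.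
    - rewrite <- Hk; ring. }
  unfold p in E; rewrite E, F0, F0', Cmult_0_r, Cexp_0; ring. }
assert (HK : (Ci * mu) * (Ci * mu) = - (mu * mu)).
{ replace ((Ci * mu) * (Ci * mu)) with ((Ci * Ci) * (mu * mu)) by ring; rewrite Ci_sq; ring. }
destruct (Ceq_dec mu 0) as [Z|Z].
- subst mu.
  assert (D : forall t : R, (0 <= t <= T)%R -> f' t = 0).
  { intros t Ht; specialize (P 0 ltac:(ring) t Ht).
    replace (- 0 * t) with (RtoC 0) in P by ring; rewrite Cexp_0 in P.
    rewrite <- P; ring. }
  replace (0 * T) with (RtoC 0) by ring; rewrite Ccos_RtoC, cos_0, <- F0.
  apply Cderive_zero_const; intros s Hs.
  replace (0 + s * (T - 0)) with (RtoC (s * T)%R) by (rewrite RtoC_mult; ring).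
  assert (B : (0 <= s * T <= T)%R) by nra.
  rewrite <- (D _ B); apply H, B.
- assert (HK' : (- (Ci * mu)) * (- (Ci * mu)) = - (mu * mu)) by (rewrite <- HK; ring).
  pose proof (P _ HK T ltac:(lra)) as P1; pose proof (P _ HK' T ltac:(lra)) as P2.
  replace (- - (Ci * mu) * T) with (Ci * (mu * T)) in P2 by ring.
  replace (- (Ci * mu) * T) with (- (Ci * (mu * T))) in P1 by ring.
  rewrite Cexp_opp in P1; unfold Ccos; rewrite Cexp_opp.
  pose proof (Cexp_neq_0 (Ci * (mu * T))) as Ne.
  set (e := Cexp (Ci * (mu * T))) in *.
  assert (Q1 : f' T + Ci * mu * f T = Ci * mu * e) by (rewrite <- P1 at 2; field; exact Ne).
  assert (Q2 : f' T - Ci * mu * f T = - (Ci * mu) / e)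
    by (rewrite <- P2; field; exact Ne).
  assert (Q3 : 2 * (Ci * mu) * f T = Ci * mu * (e + / e)).
  { replace (2 * (Ci * mu) * f T)
      with ((f' T + Ci * mu * f T) - (f' T - Ci * mu * f T)) by ring.
    rewrite Q1, Q2; field; exact Ne. }
  assert (Nk : Ci * mu <> 0) by (apply Cmult_neq_0; [apply Ci_nz | exact Z]).
  replace (f T) with (2 * (Ci * mu) * f T / (2 * (Ci * mu))).
  2:{ field; repeat split; (assumption || apply Ci_nz). }
  rewrite Q3; field; repeat split; (assumption || apply Ci_nz).
Qed.

Lemma Csin2_Ccos2 (r : R) : Csin r * Csin r + Ccos r * Ccos r = 1.
Proof.
rewrite Csin_RtoC, Ccos_RtoC, <- !RtoC_mult, <- RtoC_plus.
f_equal; apply sin2_cos2.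
Qed.

Lemma PS_hyp_coef_ode (b : C) (g : R) (x : C) :
  (0 < g)%R -> (Cmod x < 1)%R ->
  x * (1 - x) * PS (coef_deriv (coef_deriv (hyp_coef b g))) x
   + (g - 2 * x) * PS (coef_deriv (hyp_coef b g)) x - b * (1 - b) * PS (hyp_coef b g) x = 0.
Proof.
intros Hg Hx; rewrite hyp_op_PS by (try apply poly_bounded_hyp_coef; assumption).
rewrite (PS_ext _ (fun _ => 0)).
- apply PS_eq, is_Cseries_Csum; apply Ctends_ext with (fun _ => 0); [|apply Ctends_const].
  intros n; induction n as [|n IH]; [reflexivity|]; cbn [Csum]; rewrite <- IH; ring.
- intros n; apply hyp_op_hyp_coef, not_pole_pos, Hg.
Qed.

(** With x = sin^2 t the equation with lower parameter 1/2 becomes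
    z'' = - (2b-1)^2 z for z = cos t F. *)
Lemma hyp_one_half_cos (b : C) (T : R) :
  (0 <= T <= PI / 4)%R ->
  Ccos T * PS (hyp_coef b (/ 2)%R) (Csin T * Csin T) = Ccos ((2 * b - 1) * T).
Proof.
intros HT.
set (c := hyp_coef b (/ 2)%R).
assert (Hc : poly_bounded c) by (apply poly_bounded_hyp_coef; lra).
pose proof (poly_bounded_deriv c Hc) as Hd.
set (f := fun t => Ccos t * PS c (Csin t * Csin t)).
set (f' := fun t => - Csin t * PS c (Csin t * Csin t)
   + 2 * (Csin t * (Ccos t * Ccos t)) * PS (coef_deriv c) (Csin t * Csin t)).
apply (harmonic_oscillator f f'); [lra | | |].
- intros s Hs.
  assert (Hx : (Cmod (Csin s * Csin s) < 1)%R).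
  { rewrite Csin_RtoC, <- RtoC_mult, Cmod_R.
    assert (P : (0 < cos s)%R) by (apply cos_gt_0; pose proof PI_RGT_0; lra).
    pose proof (sin2_cos2 s) as E; unfold Rsqr in E.
    rewrite Rabs_pos_eq; nra. }
  assert (Dx : is_Cderive (fun t => Csin t * Csin t) s (2 * (Csin s * Ccos s))).
  { eapply is_Cderive_eq; [apply is_Cderive_mult; apply is_Cderive_Csin | ring]. }
  assert (D1 : is_Cderive (fun t => PS c (Csin t * Csin t)) s
     (2 * (Csin s * Ccos s) * PS (coef_deriv c) (Csin s * Csin s))).
  { apply (is_Cderive_comp (PS c) (fun t => Csin t * Csin t)); [|exact Dx].
    apply is_Cderive_PS; assumption. }
  assert (D2 : is_Cderive (fun t => PS (coef_deriv c) (Csin t * Csin t)) s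
     (2 * (Csin s * Ccos s) * PS (coef_deriv (coef_deriv c)) (Csin s * Csin s))).
  { apply (is_Cderive_comp (PS (coef_deriv c)) (fun t => Csin t * Csin t)); [|exact Dx].
    apply is_Cderive_PS; assumption. }
  pose proof (PS_hyp_coef_ode b (/ 2) (Csin s * Csin s) ltac:(lra) Hx) as O; fold c in O.
  pose proof (Csin2_Ccos2 s) as SC.
  split.
  + eapply is_Cderive_eq.
    * apply is_Cderive_mult; [apply is_Cderive_Ccos | exact D1].
    * unfold f'; ring.
  + eapply is_Cderive_eq.
    * apply is_Cderive_plus.
      -- apply is_Cderive_mult; [apply is_Cderive_opp, is_Cderive_Csin | exact D1].
      -- apply is_Cderive_mult; [|exact D2].
         apply is_Cderive_scal, is_Cderive_mult; [apply is_Cderive_Csin|].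
         apply is_Cderive_mult; apply is_Cderive_Ccos.
    * unfold f.
      set (Y := PS c (Csin s * Csin s)) in *.
      set (Y1 := PS (coef_deriv c) (Csin s * Csin s)) in *.
      set (Y2 := PS (coef_deriv (coef_deriv c)) (Csin s * Csin s)) in *.
      set (S := Csin s) in *; set (K := Ccos s) in *.
      assert (SC' : K * K = 1 - S * S) by (rewrite <- SC; ring).
      assert (O' : S * S * (K * K) * Y2
        = - ((/ 2 - 2 * (S * S)) * Y1) + b * (1 - b) * Y).
      { rewrite SC'; rewrite RtoC_inv in O by lra.
        replace (S * S * (1 - S * S) * Y2) with
          (S * S * (1 - S * S) * Y2 + (/ 2 - 2 * (S * S)) * Y1 - b * (1 - b) * Y
           - ((/ 2 - 2 * (S * S)) * Y1) + b * (1 - b) * Y) by ring.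
        rewrite O; ring. }
      transitivity (- K * Y + (- (6) * (S * S) * K + 2 * K * (K * K)) * Y1
         + 4 * K * (S * S * (K * K) * Y2)); [ring|].
      rewrite O'; rewrite SC'; field.
- unfold f; rewrite Csin_RtoC, Ccos_RtoC, sin_0, cos_0.
  replace (0 * 0) with (RtoC 0) by ring; rewrite PS_0.
  unfold c, hyp_coef; simpl; field.
- unfold f'; rewrite Csin_RtoC, sin_0; ring.
Qed.

(** (2(2a - 1/2) - 1) PI/4 = PI a - PI/2; the upper parameter 2a - 1/2 is the one for
    which Bailey's product at 1/2 has the factors (j + a)(j + 1 - a). *)
Lemma Csin_as_Ccos (a : C) : Ccos ((2 * (2 * a - / 2) - 1) * RtoC (PI / 4)%R) = Csin (PI * a).
Proof.
unfold Ccos, Csin.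
replace (Ci * ((2 * (2 * a - / 2) - 1) * RtoC (PI / 4)%R))
  with (Ci * (PI * a) + Ci * RtoC (- (PI / 2))%R).
2:{ unfold Rdiv; rewrite RtoC_opp, !RtoC_mult, !RtoC_inv by lra.
    field. }
assert (E : Cexp (Ci * RtoC (- (PI / 2))%R) = - Ci).
{ rewrite Cexp_Ci_RtoC, cos_neg, sin_neg, cos_PI2, sin_PI2.
  apply injective_projections; simpl; ring. }
assert (E' : Cexp (- (Ci * RtoC (- (PI / 2))%R)) = Ci).
{ rewrite Cexp_opp, E; pose proof Ci_nz.
  replace Ci with (- (Ci * Ci) * Ci) at 2 by (rewrite Ci_sq; ring).
  rewrite Ci_sq; replace (- - (1) * Ci) with (- (Ci * Ci) * / (- Ci)).
  - rewrite Ci_sq; ring.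
  - replace (- - (1)) with (RtoC 1) by ring; field; exact H. }
replace (- (Ci * (PI * a) + Ci * RtoC (- (PI / 2))%R))
  with (- (Ci * (PI * a)) + - (Ci * RtoC (- (PI / 2))%R)) by ring.
rewrite !Cexp_plus, E, E'.
replace (2 * Ci) with (2 * - / Ci).
- pose proof Ci_nz; field; assumption.
- replace Ci with (- (Ci * Ci) * Ci) at 2 by (rewrite Ci_sq; ring).
  rewrite Ci_sq.
  transitivity (2 * ((Ci * Ci) * / Ci)); [rewrite Ci_sq; ring | field; apply Ci_nz].
Qed.

(** The part of Bailey's product that does not depend on [a]; only ratios matter, so
    its value is never needed. *)
Definition bailey_norm (N : nat) : C :=
  Cprod (fun j => 4 / ((2 * INR j + / 2) * (2 * INR j + 3 / 2))) N.

Lemma Cprod_bailey_ratio (a : C) (N : nat) :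
  Cprod (fun j => bailey_ratio (2 * a - / 2) (lower_param (/ 2) j)) N
  = pochhammer a N * pochhammer (1 - a) N * bailey_norm N.
Proof.
induction N as [|N IH]; [unfold bailey_norm; simpl; ring|].
unfold bailey_norm; cbn [Cprod pochhammer]; fold (bailey_norm N); rewrite IH.
unfold bailey_ratio, lower_param.
rewrite RtoC_plus, RtoC_mult, RtoC_inv by lra.
pose proof C2_neq_0 as H2; pose proof (pos_INR N) as PN.
assert (H1 : 2 * INR N + / 2 <> 0).
{ rewrite <- RtoC_inv by lra; rewrite <- RtoC_mult, <- RtoC_plus; apply RtoC_neq_0; lra. }
assert (H3 : 2 * INR N + 3 / 2 <> 0).
{ unfold Cdiv; rewrite <- RtoC_inv by lra; rewrite <- !RtoC_mult, <- RtoC_plus.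
  apply RtoC_neq_0; lra. }
replace (/ 2 + 2 * INR N) with (2 * INR N + / 2) by ring.
replace (2 * INR N + / 2 + 1) with (2 * INR N + 3 / 2) by field.
replace (2 * INR N + / 2 + (2 * a - / 2)) with (2 * (a + INR N)) by ring.
replace (2 * INR N + 3 / 2 - (2 * a - / 2)) with (2 * (1 - a + INR N)) by field.
unfold Cdiv; ring.
Qed.

(** F(2a - 1/2, 3/2 - 2a; 1/2; 1/2) evaluated in two ways: by Bailey's product and
    by the cosine formula at t = PI/4. *)
Lemma pochhammer_product_tends (a : C) :
  Ctends (fun N => pochhammer a N * pochhammer (1 - a) N * bailey_norm N)
         (/ Ccos (RtoC (PI / 4)%R) * Csin (PI * a)).
Proof.
assert (K : Ccos (RtoC (PI / 4)%R) <> 0).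
{ rewrite Ccos_RtoC; apply RtoC_neq_0, Rgt_not_eq, cos_gt_0; pose proof PI_RGT_0; lra. }
apply Ctends_ext with (Cprod (fun j => bailey_ratio (2 * a - / 2) (lower_param (/ 2) j))).
{ intros N; apply Cprod_bailey_ratio. }
rewrite <- Csin_as_Ccos, <- (hyp_one_half_cos _ (PI / 4)) by (pose proof PI_RGT_0; lra).
replace (Csin (RtoC (PI / 4)%R) * Csin (RtoC (PI / 4)%R)) with half.
2:{ rewrite Csin_RtoC, half_RtoC, <- RtoC_mult, sin_PI4; f_equal.
    replace (1 / sqrt 2 * (1 / sqrt 2))%R with (/ (sqrt 2 * sqrt 2))%R
      by (field; apply Rgt_not_eq, sqrt_lt_R0; lra).
    rewrite sqrt_sqrt; lra. }
rewrite Cmult_assoc, Cinv_l, Cmult_1_l by exact K.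
apply bailey_product; lra.
Qed.

(** The coefficients of F' for the lower parameter 1. By Abel's theorem their limit is
    that of (1-x) F'(x) at 1, the strength of the logarithmic singularity. *)
Definition log_coef (a : C) (n : nat) : C := coef_deriv (hyp_coef a 1) n.

Lemma log_coef_prod (a : C) (n : nat) :
  log_coef a n = a * (1 - a) * Cprod (fun k => 1 + a * (1 - a) * tau k) n.
Proof.
induction n as [|n IH].
- unfold log_coef, coef_deriv, hyp_coef; simpl; field.
- cbn [Cprod]; rewrite Cmult_assoc, <- IH; unfold log_coef, coef_deriv.
  rewrite (hyp_coef_S a 1 (S n)) by apply not_pole_1.
  unfold tau; pose proof (pos_INR n).
  rewrite RtoC_inv, RtoC_mult, !S_INR, !RtoC_plus by nra.
  assert (INR n + 1 <> 0) by (rewrite <- RtoC_plus; apply RtoC_neq_0; lra).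
  assert (INR n + 2 <> 0) by (rewrite <- RtoC_plus; apply RtoC_neq_0; lra).
  assert (INR n + 1 + 1 <> 0) by (rewrite <- !RtoC_plus; apply RtoC_neq_0; lra).
  field; repeat split; assumption.
Qed.

Lemma Csin_half_PI : Csin (PI * / 2) = 1.
Proof.
rewrite <- RtoC_inv, <- RtoC_mult, Csin_RtoC by lra.
replace (PI * / 2)%R with (PI / 2)%R by reflexivity; rewrite sin_PI2; reflexivity.
Qed.

Lemma log_coef_deviation (a : C) (n : nat) :
  (Cmod (log_coef a n - a * (1 - a))
    <= exp (Cmod (a * (1 - a))) * Cmod (a * (1 - a)) ^ 2)%R.
Proof.
rewrite log_coef_prod.
set (m := a * (1 - a)).
replace (m * Cprod (fun k => 1 + m * tau k) n - m)
  with (m * (Cprod (fun k => 1 + m * tau k) n - 1)) by ring.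
rewrite Cmod_mult.
replace (exp (Cmod m) * Cmod m ^ 2)%R with (Cmod m * (exp (Cmod m) * Cmod m))%R by ring.
apply Rmult_le_compat_l; [apply Cmod_ge_0|].
apply Cprod_tau_sub1; [apply Cmod_ge_0|].
intros k; replace (1 + m * tau k - 1) with (m * tau k) by ring.
rewrite Cmod_mult, Cmod_R, Rabs_pos_eq by (left; apply tau_pos); lra.
Qed.

(** Dividing by the case [a = 1/2] of [pochhammer_product_tends] removes the
    normalization. *)
Lemma log_coef_tends_sin : exists L : C, forall a : C, Ctends (log_coef a) (L * Csin (PI * a)).
Proof.
destruct (Cprod_tau_converges (fun k => 1 + / 2 * (1 - / 2) * tau k) (/ 4)) as [l [Hl Ll]].
{ lra. }
{ intros k; replace (/ 2 * (1 - / 2)) with (RtoC (/ 4)%R)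
    by (rewrite RtoC_inv by lra; field).
  rewrite <- RtoC_mult, <- RtoC_plus; apply RtoC_neq_0; pose proof (tau_pos k); nra. }
{ intros k; replace (1 + / 2 * (1 - / 2) * tau k - 1) with (RtoC (/ 4 * tau k)%R)
    by (rewrite RtoC_mult, RtoC_inv by lra; field).
  rewrite Cmod_R, Rabs_pos_eq; [lra | pose proof (tau_pos k); nra]. }
set (L := / 2 * (1 - / 2) * l).
assert (LH : Ctends (log_coef (/ 2)) L).
{ apply Ctends_ext with
    (fun n => / 2 * (1 - / 2) * Cprod (fun k => 1 + / 2 * (1 - / 2) * tau k) n).
  - intros n; symmetry; apply log_coef_prod.
  - apply Ctends_scal, Ll. }
exists L; intros a.
assert (K : Ccos (RtoC (PI / 4)%R) <> 0).
{ rewrite Ccos_RtoC; apply RtoC_neq_0, Rgt_not_eq, cos_gt_0; pose proof PI_RGT_0; lra. }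
pose proof (pochhammer_product_tends a) as T.
pose proof (pochhammer_product_tends (/ 2)) as T2.
rewrite Csin_half_PI, Cmult_1_r in T2.
set (k := / Ccos (RtoC (PI / 4)%R)) in *.
assert (Nk : k <> 0).
{ intros E; apply C1_nz; rewrite <- (Cinv_l _ K); fold k; rewrite E; ring. }
set (d := fun N => pochhammer (/ 2) N * pochhammer (1 - / 2) N * bailey_norm N) in *.
assert (Nn : forall N, bailey_norm N <> 0).
{ intros N; apply Cprod_neq_0; intros j; pose proof (pos_INR j).
  unfold Cdiv; rewrite <- !RtoC_inv, <- !RtoC_mult, <- !RtoC_plus, <- RtoC_mult, <- RtoC_inv, <- RtoC_mult
    by (try nra).
  apply RtoC_neq_0; apply Rmult_integral_contrapositive_currified; [lra|].
  apply Rinv_neq_0_compat; nra. }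
assert (Np : not_pole (/ 2)) by (rewrite <- RtoC_inv by lra; apply not_pole_pos; lra).
assert (E2 : 1 - / 2 = / 2) by (field).
assert (Nd : forall N, d N <> 0).
{ intros N; unfold d; rewrite E2.
  repeat apply Cmult_neq_0; try apply pochhammer_neq_0; auto. }
pose proof (Ctends_mult _ _ _ _ T (Ctends_inv d k Nk T2 Nd)) as Q.
apply Ctends_incr_1 in Q.
pose proof (Ctends_mult _ _ _ _ LH Q) as Q'.
replace (L * (k * Csin (PI * a) * / k)) with (L * Csin (PI * a)) in Q' by (field; exact Nk).
revert Q'; apply Ctends_ext; intros n.
unfold log_coef, coef_deriv, hyp_coef, d; rewrite !E2.
pose proof (pochhammer_neq_0 _ (S n) Np); specialize (Nn (S n)).
pose proof (pochhammer_neq_0 1 (S n) not_pole_1); pose proof (INR_fact_C_neq_0 (S n)).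
field; repeat split; assumption.
Qed.

(** As [a -> 0] the n-th term is a + O(a^2) uniformly in n, which forces the
    constant of proportionality to be 1/PI. *)
Theorem log_coef_tends (a : C) : Ctends (log_coef a) (Csin (PI * a) / PI).
Proof.
destruct log_coef_tends_sin as [L H].
assert (B : forall e : R, (0 < e < / 4)%R ->
   (Cmod (L * PI - 1) <= e * (16 * Cmod L + exp 1 + 1))%R).
{ intros e He.
  assert (HPI : (0 < PI <= 4)%R) by (pose proof PI_RGT_0; pose proof PI_4; lra).
  pose proof (H (RtoC e)) as T; rewrite <- RtoC_mult, Csin_RtoC in T.
  assert (D : (Cmod (L * sin (PI * e) - e * (1 - e)) <= exp 1 * e ^ 2)%R).
  { refine (is_lim_seq_le_const _ _ _ _ (Ctends_Cmod _ _ (Ctends_minus _ _ _ _ T (Ctends_const (e * (1 - e)))))).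
    intros n; eapply Rle_trans; [apply log_coef_deviation|].
    rewrite <- RtoC_minus, <- RtoC_mult, Cmod_R, Rabs_pos_eq by nra.
    apply Rmult_le_compat; [left; apply exp_pos | apply pow2_ge_0 | |].
    - left; apply exp_increasing; nra.
    - apply pow_incr; nra. }
  assert (S : (Rabs (sin (PI * e) - PI * e) <= (PI * e) ^ 2)%R).
  { apply sin_quadratic; rewrite Rabs_pos_eq; nra. }
  apply (Rmult_le_reg_l e); [lra|].
  replace (e * Cmod (L * PI - 1))%R with (Cmod (RtoC e * (L * PI - 1)))
    by (rewrite Cmod_mult, Cmod_R, Rabs_pos_eq; lra).
  replace (RtoC e * (L * PI - 1)) with
    ((L * sin (PI * e) - e * (1 - e)) + (- (L * RtoC (sin (PI * e) - PI * e)%R) + - (e * e)))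
    by (rewrite RtoC_minus, RtoC_mult; ring).
  eapply Rle_trans; [apply Cmod_triangle|].
  eapply Rle_trans; [apply Rplus_le_compat_l, Cmod_triangle|].
  rewrite !Cmod_opp, !Cmod_mult, !Cmod_R, (Rabs_pos_eq e) by lra.
  pose proof (Cmod_ge_0 L) as PL.
  assert ((PI * e) ^ 2 <= 16 * e ^ 2)%R.
  { rewrite Rpow_mult_distr; apply Rmult_le_compat_r; [apply pow2_ge_0 | nra]. }
  nra. }
assert (E : Cmod (L * PI - 1) = 0%R).
{ apply Rle_antisym; [|apply Cmod_ge_0].
  apply Rnot_lt_le; intros P.
  set (X := Cmod (L * PI - 1)) in *; set (W := (16 * Cmod L + exp 1 + 1)%R) in *.
  assert (PW : (0 < W)%R) by (unfold W; pose proof (Cmod_ge_0 L); pose proof (exp_pos 1); lra).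
  assert (Q : (0 < X / (2 * W))%R) by (apply Rdiv_lt_0_compat; lra).
  specialize (B (Rmin (/ 8) (X / (2 * W)))%R).
  assert (M1 : (Rmin (/ 8) (X / (2 * W)) <= / 8)%R) by apply Rmin_l.
  assert (M2 : (Rmin (/ 8) (X / (2 * W)) <= X / (2 * W))%R) by apply Rmin_r.
  assert (M3 : (0 < Rmin (/ 8) (X / (2 * W)))%R) by (apply Rmin_pos; lra).
  specialize (B ltac:(lra)).
  assert (X <= X / (2 * W) * W)%R by (eapply Rle_trans; [exact B|]; apply Rmult_le_compat_r; lra).
  replace (X / (2 * W) * W)%R with (X / 2)%R in * by (field; lra); lra. }
apply Cmod_eq_0 in E.
assert (NP : RtoC PI <> 0) by apply RtoC_neq_0, PI_neq0.
replace (Csin (PI * a) / PI) with (L * Csin (PI * a)); [apply H|].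
replace L with ((L * PI - 1 + 1) / PI) by (field; exact NP); rewrite E; field; exact NP.
Qed.

(** * The principal logarithm of (1-x)/x *)

Definition log_series_coef (n : nat) : C := match n with O => 0 | S _ => / INR n end.

(** The branch of - log(1-y) on the unit disc that vanishes at 0. *)
Definition log_series (y : C) : C := PS log_series_coef y.

Lemma poly_bounded_log_series : poly_bounded log_series_coef.
Proof.
exists 1%R, O; intros [|n]; simpl pow; rewrite Rmult_1_r.
- simpl; rewrite Cmod_0; lra.
- unfold log_series_coef; rewrite S_INR; pose proof (pos_INR n).
  rewrite <- RtoC_inv, Cmod_R, Rabs_pos_eq by
    (try lra; left; apply Rinv_0_lt_compat; lra).
  rewrite <- Rinv_1; apply Rinv_le_contravar; lra.
Qed.

Lemma Cmod_lt_1_neq (y : C) : (Cmod y < 1)%R -> 1 - y <> 0.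
Proof.
intros H E; assert (Y : y = 1) by (replace y with (1 - (1 - y)) by ring; rewrite E; ring).
rewrite Y, Cmod_1 in H; lra.
Qed.

Lemma PS_geometric (y : C) : (Cmod y < 1)%R -> PS (fun _ => 1) y = / (1 - y).
Proof.
intros Hy; pose proof (Cmod_lt_1_neq y Hy) as N; apply PS_eq, is_Cseries_Csum.
apply Ctends_ext with (fun n => / (1 - y) * (1 - 1 * y ^ n)).
- intros n; induction n as [|n IH]; [simpl; ring|].
  cbn [Csum]; rewrite <- IH, Cpow_S; field; exact N.
- assert (T : Ctends (fun n => / (1 - y) * (1 - 1 * y ^ n)) (/ (1 - y) * (1 - 0))).
  { apply Ctends_scal, Ctends_minus; [apply Ctends_const|].
    apply (PS_terms_tend_0 (fun _ => 1)); [apply poly_bounded_const | exact Hy]. }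
  replace (/ (1 - y) * (1 - 0)) with (/ (1 - y)) in T by ring; exact T.
Qed.

Lemma is_Cderive_log_series (y : C) : (Cmod y < 1)%R -> is_Cderive log_series y (/ (1 - y)).
Proof.
intros Hy; rewrite <- (PS_geometric y Hy), (PS_ext _ (coef_deriv log_series_coef)).
- apply is_Cderive_PS; [apply poly_bounded_log_series | exact Hy].
- intros n; unfold coef_deriv, log_series_coef; field; apply INR_S_neq_0.
Qed.

Lemma Cexp_log_series (y : C) : (Cmod y < 1)%R -> Cexp (log_series y) * (1 - y) = 1.
Proof.
intros Hy; pose (p := fun z => Cexp (log_series z) * (1 - z)).
assert (E : p y = p 0).
{ apply Cderive_zero_const; intros s Hs.
  replace (0 + s * (y - 0)) with (s * y) by ring.
  assert (Hz : (Cmod (s * y) < 1)%R).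
  { rewrite Cmod_mult, Cmod_R, Rabs_pos_eq by lra; pose proof (Cmod_ge_0 y); nra. }
  eapply is_Cderive_eq.
  - apply (is_Cderive_mult (fun z => Cexp (log_series z)) (fun z => 1 - z)).
    + apply (is_Cderive_comp Cexp log_series); [apply is_Cderive_Cexp | apply is_Cderive_log_series, Hz].
    + apply is_Cderive_minus; [apply is_Cderive_const | apply is_Cderive_id].
  - field; apply Cmod_lt_1_neq, Hz. }
unfold p in E; rewrite E; unfold log_series at 1; rewrite PS_0; simpl.
rewrite Cexp_0; ring.
Qed.

(** Re (1-y) > 0 on the disc, so the argument cannot cross +-PI/2 on the way from
    the centre. *)
Lemma Im_log_series (y : C) : (Cmod y < 1)%R -> (Rabs (Im (log_series y)) < PI / 2)%R.
Proof.
intros Hy; pose proof PI_RGT_0 as PP.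
assert (Hs : forall s : R, (0 <= s <= 1)%R -> (Cmod (s * y) < 1)%R).
{ intros s Hs; rewrite Cmod_mult, Cmod_R, Rabs_pos_eq by lra; pose proof (Cmod_ge_0 y); nra. }
assert (NZ : forall s : R, (0 <= s <= 1)%R -> cos (Im (log_series (s * y))) <> 0%R).
{ intros s H E; pose proof (Cexp_log_series _ (Hs s H)) as K.
  assert (R : (0 < Re (1 - s * y))%R).
  { pose proof (re_le_Cmod (s * y)) as B; pose proof (Rle_abs (Re (s * y))).
    specialize (Hs s H); change (Re (1 - s * y)) with (1 - Re (s * y))%R; lra. }
  unfold Cexp in K; rewrite E in K.
  set (z := 1 - s * y) in *; set (w := log_series (s * y)) in *; clearbody w.
  destruct z as [p q]; apply (f_equal (fun v => (fst v, snd v))) in K.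
  simpl in K, R; injection K as K1 K2.
  assert (K1' : (- (exp (Re w) * sin (Im w) * q) = 1)%R) by (rewrite <- K1; ring).
  assert (K2' : (exp (Re w) * sin (Im w) * p = 0)%R) by (rewrite <- K2; ring).
  apply Rmult_integral in K2'; destruct K2' as [Z|Z]; [rewrite Z in K1'|]; lra. }
assert (C : forall sg : R, (sg = 1 \/ sg = -1)%R -> (sg * Im (log_series y) < PI / 2)%R).
{ intros sg Hsg; apply Rnot_le_lt; intros Hge.
  set (f := fun s : R => (sg * Im (log_series (s * y)) - PI / 2)%R).
  assert (F0 : (f 0 < 0)%R).
  { unfold f; replace (0 * y) with (RtoC 0) by ring; unfold log_series; rewrite PS_0; simpl.
    rewrite Rmult_0_r; lra. }
  assert (Fz : forall s : R, (0 <= s <= 1)%R -> f s <> 0%R).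
  { intros s H Z; apply (NZ s H); unfold f in Z.
    destruct Hsg as [-> | ->].
    - replace (Im (log_series (s * y))) with (PI / 2)%R by lra; apply cos_PI2.
    - replace (Im (log_series (s * y))) with (- (PI / 2))%R by lra; rewrite cos_neg; apply cos_PI2. }
  assert (F1 : (0 < f 1)%R).
  { assert (f 1%R <> 0%R) by (apply Fz; lra).
    assert (0 <= f 1)%R; [|lra].
    unfold f; replace (1 * y) with y by ring; lra. }
  destruct (IVT_interv f 0 1) as [s [Hs1 Hs2]]; [|lra|exact F0|exact F1|].
  - intros s H; unfold f; apply continuity_pt_minus;
      [|apply continuity_pt_const; intros u v; reflexivity].
    apply continuity_pt_mult; [apply continuity_pt_const; intros u v; reflexivity|].
    apply continuity_pt_filterlim.
    apply (ex_derive_continuous (V := R_NormedModule) (fun t : R => Im (log_series (t * y)))).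
    exists (Im (y * / (1 - s * y))).
    pose proof (Re_Cderive_line log_series 0 y (/ (1 - s * y)) s) as D.
    replace (0 + s * y) with (s * y) in D by ring.
    destruct (D (is_Cderive_log_series _ (Hs s H))) as [_ D2].
    revert D2; apply is_derive_ext; intros t; f_equal; f_equal; ring.
  - apply (Fz s); [lra | exact Hs2]. }
apply Rabs_def1.
- pose proof (C 1%R ltac:(lra)); lra.
- pose proof (C (-1)%R ltac:(lra)); lra.
Qed.

Lemma Clog_Cexp (u : C) : (- PI < Im u <= PI)%R -> Clog (Cexp u) = u.
Proof.
intros Hu; pose proof PI_RGT_0 as PP; pose proof (exp_pos (Re u)) as PE.
assert (R : Re (Cexp u) = (exp (Re u) * cos (Im u))%R) by (unfold Cexp, Re; simpl; ring).
assert (I : Im (Cexp u) = (exp (Re u) * sin (Im u))%R) by (unfold Cexp, Im; simpl; ring).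
unfold Clog, Carg; rewrite R, I, Cmod_Cexp, ln_exp.
replace (exp (Re u) * cos (Im u) / exp (Re u))%R with (cos (Im u)) by (field; lra).
apply injective_projections; [reflexivity|]; simpl snd; change (snd u) with (Im u).
destruct (Rle_dec 0 (exp (Re u) * sin (Im u))) as [H|H].
- apply acos_cos; split; [|lra].
  apply Rnot_lt_le; intros L.
  assert (S : (0 < sin (- Im u))%R) by (apply sin_gt_0; lra).
  rewrite sin_neg in S; nra.
- assert (L : (Im u < 0)%R).
  { apply Rnot_le_lt; intros L; apply H, Rmult_le_pos; [lra|].
    apply sin_ge_0; lra. }
  rewrite <- (cos_neg (Im u)), acos_cos by lra; ring.
Qed.

Lemma Clog_ratio (x : C) :
  (Cmod x < 1)%R -> (Cmod (1 - x) < 1)%R ->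
  Clog ((1 - x) / x) = log_series (1 - x) - log_series x.
Proof.
intros Hx Hx'.
pose proof (Cexp_log_series x Hx) as E1; pose proof (Cexp_log_series (1 - x) Hx') as E2.
replace (1 - (1 - x)) with x in E2 by ring.
assert (X : x <> 0) by (intros Z; apply C1_nz; rewrite <- E2; rewrite Z; ring).
replace ((1 - x) / x) with (Cexp (log_series (1 - x) - log_series x)).
- apply Clog_Cexp.
  pose proof (Rabs_def2 _ _ (Im_log_series x Hx)).
  pose proof (Rabs_def2 _ _ (Im_log_series (1 - x) Hx')).
  change (Im (log_series (1 - x) - log_series x))
    with (Im (log_series (1 - x)) - Im (log_series x))%R; lra.
- unfold Cminus at 1; rewrite Cexp_plus, Cexp_opp.
  pose proof (Cexp_neq_0 (log_series x)) as N.
  pose proof (Cmod_lt_1_neq x Hx) as N1.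
  assert (R1 : Cexp (log_series (1 - x)) = / x).
  { transitivity (Cexp (log_series (1 - x)) * x * / x); [field; exact X | rewrite E2; ring]. }
  assert (R2 : Cexp (log_series x) = / (1 - x)).
  { transitivity (Cexp (log_series x) * (1 - x) * / (1 - x)); [field; exact N1 | rewrite E1; ring]. }
  rewrite R1, R2.
  field; split; assumption.
Qed.

(** * Solutions of the hypergeometric equation on the lens |x| < 1, |1-x| < 1 *)

Definition lens (x : C) : Prop := (Cmod x < 1)%R /\ (Cmod (1 - x) < 1)%R.

Lemma lens_sym (x : C) : lens x -> lens (1 - x).
Proof. intros [H1 H2]; split; [exact H2 | replace (1 - (1 - x)) with x by ring; exact H1]. Qed.

Lemma lens_neq_0 (x : C) : lens x -> x <> 0 /\ 1 - x <> 0.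
Proof.
intros [H1 H2]; split; [|apply Cmod_lt_1_neq, H1].
apply Cmod_lt_1_neq in H2; intros Z; apply H2; rewrite Z; ring.
Qed.

Lemma lens_RtoC (r : R) : (0 < r < 1)%R -> lens r.
Proof.
intros H; split; [|rewrite <- RtoC_minus]; rewrite Cmod_R, Rabs_pos_eq; lra.
Qed.

Lemma lens_half : lens half.
Proof. rewrite half_RtoC; apply lens_RtoC; lra. Qed.

Lemma lens_segment (p q : C) (s : R) :
  lens p -> lens q -> (0 <= s <= 1)%R -> lens (p + s * (q - p)).
Proof.
assert (K : forall p q : C, (Cmod p < 1)%R -> (Cmod q < 1)%R -> (0 <= s <= 1)%R ->
  (Cmod (p + s * (q - p)) < 1)%R).
{ clear; intros p q Hp Hq Hs.
  replace (p + s * (q - p)) with (RtoC (1 - s)%R * p + s * q) by (rewrite RtoC_minus; ring).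
  eapply Rle_lt_trans; [apply Cmod_triangle|].
  rewrite !Cmod_mult, !Cmod_R, !Rabs_pos_eq by lra.
  pose proof (Cmod_ge_0 p); pose proof (Cmod_ge_0 q).
  destruct (Rle_lt_dec s (/ 2)); nra. }
intros [P1 P2] [Q1 Q2] Hs; split; [apply K; assumption|].
replace (1 - (p + s * (q - p))) with ((1 - p) + s * ((1 - q) - (1 - p))) by ring.
apply K; assumption.
Qed.

(** The Wronskian needs the first derivative as a function, the second one only
    pointwise. *)
Definition hyp_solution (b : C) (f f1 : C -> C) : Prop :=
  forall x, lens x -> is_Cderive f x (f1 x) /\
    exists f2 : C, is_Cderive f1 x f2 /\ x * (1 - x) * f2 + (1 - 2 * x) * f1 x - b * f x = 0.

Definition weighted_wronskian (f f1 g g1 : C -> C) (x : C) : C :=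
  x * (1 - x) * (f x * g1 x - f1 x * g x).

(** Abel's identity: x(1-x) is the integrating factor of W' = - (1-2x)/(x(1-x)) W. *)
Lemma wronskian_const (b : C) (f f1 g g1 : C -> C) (p q : C) :
  hyp_solution b f f1 -> hyp_solution b g g1 -> lens p -> lens q ->
  weighted_wronskian f f1 g g1 q = weighted_wronskian f f1 g g1 p.
Proof.
intros Hf Hg Hp Hq; apply Cderive_zero_const; intros s Hs.
set (x := p + s * (q - p)).
assert (Hx : lens x) by (apply lens_segment; assumption).
destruct (Hf x Hx) as [F1 [f2 [F2 EF]]]; destruct (Hg x Hx) as [G1 [g2 [G2 EG]]].
assert (W : is_Cderive (fun y => y * (1 - y)) x (1 - 2 * x)).
{ eapply is_Cderive_eq.
  - apply (is_Cderive_mult (fun y => y) (fun y => 1 - y)); [apply is_Cderive_id|].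
    apply is_Cderive_minus; [apply is_Cderive_const | apply is_Cderive_id].
  - ring. }
eapply is_Cderive_eq.
- apply (is_Cderive_mult (fun y => y * (1 - y)) (fun y => f y * g1 y - f1 y * g y)); [exact W|].
  apply is_Cderive_minus; apply is_Cderive_mult; [exact F1 | exact G2 | exact F2 | exact G1].
- transitivity (f x * (x * (1 - x) * g2 + (1 - 2 * x) * g1 x - b * g x)
    - g x * (x * (1 - x) * f2 + (1 - 2 * x) * f1 x - b * f x)); [ring|].
  rewrite EF, EG; ring.
Qed.

Lemma is_Cderive_reflect (f : C -> C) (x l : C) :
  is_Cderive f (1 - x) l -> is_Cderive (fun y => f (1 - y)) x (- l).
Proof.
intros H; eapply is_Cderive_eq.
- apply (is_Cderive_comp f (fun y => 1 - y)); [exact H|].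
  apply is_Cderive_minus; [apply is_Cderive_const | apply is_Cderive_id].
- ring.
Qed.

Lemma is_Cderive_inv (x : C) : x <> 0 -> is_Cderive Cinv x (- (/ x * / x)).
Proof.
intros Hx; pose proof (proj1 (Cmod_gt_0 x) Hx) as P.
apply is_Cderive_of_quadratic with (d := (Cmod x / 2)%R) (M := (2 / (Cmod x * Cmod x * Cmod x))%R);
  [lra|].
intros h Hh.
assert (L : (Cmod x / 2 <= Cmod (x + h))%R).
{ pose proof (Cmod_triangle (x + h) (- h)) as T.
  replace (x + h + - h) with x in T by ring; rewrite Cmod_opp in T; lra. }
assert (Hxh : x + h <> 0) by (apply Cmod_gt_0; lra).
replace (/ (x + h)%C - / x - h * - (/ x * / x)) with (h * h / (x * x * (x + h)))
  by (field; split; assumption).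
rewrite Cmod_div, !Cmod_mult by (repeat apply Cmult_neq_0; assumption).
assert (K : (/ (Cmod x * Cmod x * Cmod (x + h)) <= 2 / (Cmod x * Cmod x * Cmod x))%R).
{ replace (2 / (Cmod x * Cmod x * Cmod x))%R with (/ (Cmod x * Cmod x * (Cmod x / 2)))%R
    by (field; lra).
  assert (0 < Cmod x * Cmod x)%R by nra.
  apply Rinv_le_contravar; [nra | apply Rmult_le_compat_l; lra]. }
pose proof (Cmod_ge_0 h).
unfold Rdiv at 1; simpl pow; rewrite Rmult_1_r, Rmult_comm.
apply Rmult_le_compat_r; [nra | exact K].
Qed.

(** * The identity *)

Lemma shifted_harmonic_1 (n : nat) : shifted_harmonic 1 n = harmonic n.
Proof.
induction n as [|n IH].
- unfold harmonic; rewrite sum_n_m_zero by lia; reflexivity.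
- unfold shifted_harmonic; cbn [Csum]; fold (shifted_harmonic 1 n); rewrite IH.
  unfold harmonic; rewrite sum_n_Sm by lia; unfold plus; simpl.
  change (match n with O => 1%R | S _ => (INR n + 1)%R end) with (INR (S n)).
  rewrite RtoC_plus, RtoC_inv by (apply not_0_INR; discriminate).
  rewrite S_INR, RtoC_plus; f_equal; f_equal; ring.
Qed.

Lemma poly_bounded_hyp_coef_1 (a : C) : poly_bounded (hyp_coef a 1).
Proof. apply (poly_bounded_hyp_coef a 1); lra. Qed.

Lemma poly_bounded_hyp_harmonic_1 (a : C) : poly_bounded (hyp_harmonic_coef a 1).
Proof. apply (poly_bounded_hyp_harmonic a 1); lra. Qed.

(** As H_(n+1) = H_n + 1/(n+1), the recurrence of the coefficients [c] of F cancels
    everything except (n+1) c_(n+1). *)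
Lemma harmonic_ode (a x : C) :
  (Cmod x < 1)%R ->
  x * (1 - x) * PS (coef_deriv (coef_deriv (hyp_harmonic_coef a 1))) x
   + (1 - 2 * x) * PS (coef_deriv (hyp_harmonic_coef a 1)) x
   - a * (1 - a) * PS (hyp_harmonic_coef a 1) x
  = PS (coef_deriv (hyp_coef a 1)) x.
Proof.
intros Hx; rewrite hyp_op_PS by (try apply poly_bounded_hyp_harmonic_1; exact Hx).
apply PS_ext; intros n.
pose proof (hyp_op_hyp_coef a 1 n not_pole_1) as E.
unfold hyp_op_coef in E |- *; unfold hyp_harmonic_coef, coef_deriv.
replace (shifted_harmonic 1 (S n)) with (shifted_harmonic 1 n + / (1 + INR n)) by reflexivity.
pose proof (not_pole_1 n) as N.
transitivity (shifted_harmonic 1 n *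
   (INR (S n) * (INR n + 1) * hyp_coef a 1 (S n) - (INR n + a) * (INR n + 1 - a) * hyp_coef a 1 n)
   + INR (S n) * hyp_coef a 1 (S n)); [|rewrite E; ring].
field; exact N.
Qed.

Section Connection.

Variable a : C.
Hypothesis ha : forall m : Z, a <> IZR m.

Let c := hyp_coef a 1.
Let F := PS c.
Let F1 := PS (coef_deriv c).
Let F2 (x : C) := F (1 - x).
Let F21 (x : C) := - F1 (1 - x).
Let G := PS (hyp_harmonic_coef a 1).
Let G1 := PS (coef_deriv (hyp_harmonic_coef a 1)).
Let u (x : C) := log_series x - log_series (1 - x).
Let u1 (x : C) := / (1 - x) + / x.
Let s := Csin (PI * a) / PI.
Let Psi := digamma (1 - a / 2) + digamma ((a + 1) / 2) - digamma 1 - digamma (1 / 2).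

Lemma hyp_solution_F : hyp_solution (a * (1 - a)) F F1.
Proof.
intros x [Hx _]; pose proof (poly_bounded_hyp_coef_1 a) as B; split.
- apply is_Cderive_PS; assumption.
- exists (PS (coef_deriv (coef_deriv c)) x); split.
  + apply is_Cderive_PS; [apply poly_bounded_deriv, B | exact Hx].
  + apply (PS_hyp_coef_ode a 1); [lra | exact Hx].
Qed.

Lemma hyp_solution_F2 : hyp_solution (a * (1 - a)) F2 F21.
Proof.
intros x Hx; destruct (hyp_solution_F (1 - x) (lens_sym x Hx)) as [D [f2 [D2 E]]]; split.
- apply is_Cderive_reflect, D.
- exists f2; split.
  + replace f2 with (- - f2) by ring; apply is_Cderive_opp.
    apply (is_Cderive_reflect F1), D2.
  + unfold F2, F21; rewrite <- E; ring.
Qed.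

Lemma is_Cderive_u (x : C) : lens x -> is_Cderive u x (u1 x).
Proof.
intros [H1 H2]; eapply is_Cderive_eq.
- apply is_Cderive_minus; [apply is_Cderive_log_series, H1|].
  apply is_Cderive_reflect, is_Cderive_log_series, H2.
- unfold u1; replace (1 - (1 - x)) with x by ring; ring.
Qed.

Lemma is_Cderive_u1 (x : C) :
  lens x -> is_Cderive u1 x (/ (1 - x) * / (1 - x) - / x * / x).
Proof.
intros Hx; destruct (lens_neq_0 x Hx) as [N1 N2]; eapply is_Cderive_eq.
- apply is_Cderive_plus; [|apply is_Cderive_inv, N1].
  apply (is_Cderive_reflect Cinv), is_Cderive_inv, N2.
- ring.
Qed.

(** The variation-of-constants term u F / 2 cancels the right-hand side F'. *)
Lemma hyp_solution_combination (A B : C) :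
  hyp_solution (a * (1 - a))
    (fun x => G x - A * F x - B * F2 x - / 2 * (u x * F x))
    (fun x => G1 x - A * F1 x - B * F21 x - / 2 * (u1 x * F x + u x * F1 x)).
Proof.
intros x Hx; pose proof (poly_bounded_hyp_harmonic_1 a) as BG.
destruct (lens_neq_0 x Hx) as [N1 N2].
destruct (hyp_solution_F x Hx) as [DF [f2 [DF1 EF]]].
destruct (hyp_solution_F2 x Hx) as [DH [h2 [DH1 EH]]].
assert (DG : is_Cderive G x (G1 x)) by (apply is_Cderive_PS; [exact BG | apply Hx]).
set (g2 := PS (coef_deriv (coef_deriv (hyp_harmonic_coef a 1))) x).
assert (DG1 : is_Cderive G1 x g2)
  by (apply is_Cderive_PS; [apply poly_bounded_deriv, BG | apply Hx]).
assert (EG : x * (1 - x) * g2 + (1 - 2 * x) * G1 x - a * (1 - a) * G x = F1 x)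
  by (apply harmonic_ode, Hx).
pose proof (is_Cderive_u x Hx) as Du; pose proof (is_Cderive_u1 x Hx) as Du1.
split.
- apply is_Cderive_minus; [apply is_Cderive_minus; [apply is_Cderive_minus|]|].
  + exact DG.
  + apply is_Cderive_scal, DF.
  + apply is_Cderive_scal, DH.
  + apply (is_Cderive_scal (/ 2) (fun y => u y * F y)), (is_Cderive_mult u F); assumption.
- eexists; split.
  + apply is_Cderive_minus; [apply is_Cderive_minus; [apply is_Cderive_minus|]|].
    * exact DG1.
    * apply is_Cderive_scal, DF1.
    * apply is_Cderive_scal, DH1.
    * apply (is_Cderive_scal (/ 2) (fun y => u1 y * F y + u y * F1 y)), is_Cderive_plus.
      -- apply (is_Cderive_mult u1 F); [exact Du1 | exact DF].
      -- apply (is_Cderive_mult u F1); [exact Du | exact DF1].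
  + cbv beta; set (U := u x) in *.
    assert (U1 : u1 x = / (x * (1 - x))) by (unfold u1; field; split; assumption).
    rewrite U1.
    transitivity ((x * (1 - x) * g2 + (1 - 2 * x) * G1 x - a * (1 - a) * G x)
      - (A + / 2 * U) * (x * (1 - x) * f2 + (1 - 2 * x) * F1 x - a * (1 - a) * F x)
      - B * (x * (1 - x) * h2 + (1 - 2 * x) * F21 x - a * (1 - a) * F2 x) - F1 x).
    * field; split; assumption.
    * rewrite EG, EF, EH; ring.
Qed.

Lemma noninteger_shift (n : nat) : a + INR n <> 0 /\ INR n + 1 - a <> 0.
Proof.
split; intros E.
- apply (ha (- Z.of_nat n)%Z); rewrite opp_IZR, <- INR_IZR_INZ, RtoC_opp.
  replace a with (a + INR n - INR n) by ring; rewrite E; ring.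
- apply (ha (Z.of_nat (S n))); rewrite <- INR_IZR_INZ, S_INR, RtoC_plus.
  replace a with (INR n + 1 - (INR n + 1 - a)) by ring; rewrite E; ring.
Qed.

Lemma sin_PI_neq_0 : s <> 0.
Proof.
pose proof (log_coef_tends a) as T.
destruct (Cprod_tau_converges (fun k => 1 + a * (1 - a) * tau k) (Cmod (a * (1 - a))))
  as [l [Hl Ll]].
- apply Cmod_ge_0.
- intros k; unfold tau; pose proof (pos_INR k).
  rewrite RtoC_inv, RtoC_mult, !RtoC_plus by nra.
  assert (P1 : INR k + 1 <> 0) by (rewrite <- RtoC_plus; apply RtoC_neq_0; lra).
  assert (P2 : INR k + 2 <> 0) by (rewrite <- RtoC_plus; apply RtoC_neq_0; lra).
  replace (1 + a * (1 - a) * / ((INR k + 1) * (INR k + 2)))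
    with ((a + INR (S k)) * (INR (S k) + 1 - a) * / ((INR k + 1) * (INR k + 2)))
    by (rewrite S_INR, RtoC_plus; field; split; assumption).
  destruct (noninteger_shift (S k)).
  repeat apply Cmult_neq_0; try assumption.
  intros E; apply C1_nz.
  rewrite <- (Cinv_r ((INR k + 1) * (INR k + 2))) by (apply Cmult_neq_0; assumption).
  rewrite E; ring.
- intros k; replace (1 + a * (1 - a) * tau k - 1) with (a * (1 - a) * tau k) by ring.
  rewrite Cmod_mult, Cmod_R, Rabs_pos_eq by (left; apply tau_pos); lra.
- replace s with (a * (1 - a) * l).
  + destruct (noninteger_shift 0) as [N1 N2].
    repeat apply Cmult_neq_0; [| |exact Hl].
    * intros E; apply N1; rewrite E; simpl; ring.
    * intros E; apply N2; transitivity (1 - a); [simpl; ring | exact E].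
  + apply (Ctends_unique (log_coef a)); [|exact T].
    apply Ctends_ext with (fun n => a * (1 - a) * Cprod (fun k => 1 + a * (1 - a) * tau k) n).
    * intros n; symmetry; apply log_coef_prod.
    * apply Ctends_scal, Ll.
Qed.

(** The bracket of digamma values is twice the sum of Bailey's logarithmic
    derivatives; the logarithms in the four limits cancel. *)
Lemma harmonic_at_half : G half = / 2 * Psi * F half.
Proof.
pose proof C2_neq_0 as C2.
assert (P1 : not_pole (1 - a / 2)).
{ intros k E; apply (ha (2 * (Z.of_nat k + 1))%Z).
  rewrite mult_IZR, plus_IZR, <- INR_IZR_INZ, RtoC_mult, RtoC_plus.
  transitivity (2 * (1 + INR k - (1 - a / 2 + INR k))); [field|rewrite E; ring]. }
assert (P2 : not_pole ((a + 1) / 2)).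
{ intros k E; apply (ha (- (2 * Z.of_nat k + 1))%Z).
  rewrite opp_IZR, plus_IZR, mult_IZR, <- INR_IZR_INZ, RtoC_opp, RtoC_plus, RtoC_mult.
  transitivity (2 * ((a + 1) / 2 + INR k) - (2 * INR k + 1)); [field|rewrite E; ring]. }
assert (P4 : not_pole (1 / 2)).
{ replace (1 / 2) with (RtoC (/ 2)%R) by (rewrite RtoC_inv by lra; field).
  apply not_pole_pos; lra. }
pose proof (digamma_tends _ P1) as T1; pose proof (digamma_tends _ P2) as T2.
pose proof (digamma_tends _ not_pole_1) as T3; pose proof (digamma_tends _ P4) as T4.
pose proof (Ctends_minus _ _ _ _ (Ctends_minus _ _ _ _ (Ctends_plus _ _ _ _ T1 T2) T3) T4) as T.
fold Psi in T.
apply (Ctends_scal (/ 2)), (Ctends_scal (F half)) in T.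
replace (/ 2 * Psi * F half) with (F half * (/ 2 * Psi)) by ring.
apply (Ctends_unique (fun N => F half
   * Csum (fun j => bailey_log_deriv a (lower_param 1 j)) N)).
- assert (EI : forall j, RtoC (lower_param 1 j) = INR (1 + 2 * j)).
  { intros j; unfold lower_param; rewrite plus_INR, mult_INR; f_equal; simpl; ring. }
  apply bailey_log_derivative; [lra| |]; intros j; rewrite EI.
  + rewrite Cplus_comm; apply noninteger_shift.
  + apply noninteger_shift.
- revert T; apply Ctends_ext; intros N; f_equal.
  induction N as [|N IH]; [simpl; ring|].
  cbn [Csum]; rewrite <- IH.
  unfold bailey_log_deriv, lower_param; rewrite RtoC_plus, RtoC_mult.
  specialize (P1 N); specialize (P2 N); specialize (P4 N); pose proof (not_pole_1 N) as P3.
  replace (1 + 2 * INR N) with (2 * (1 / 2 + INR N)) by field.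
  replace (2 * (1 / 2 + INR N) + 1) with (2 * (1 + INR N)) by field.
  replace (2 * (1 / 2 + INR N) + a) with (2 * ((a + 1) / 2 + INR N)) by field.
  replace (2 * (1 + INR N) - a) with (2 * (1 - a / 2 + INR N)) by field.
  assert (I : forall z : C, z <> 0 -> / (2 * z) = / 2 * / z) by (intros z Hz; field; exact Hz).
  rewrite !I by assumption; ring.
Qed.

Let X (m : nat) : C := near0 m.

Lemma X_lens (m : nat) : lens (X m).
Proof. apply lens_RtoC, near0_bounds. Qed.

Lemma X_tends : Ctends X 0.
Proof. apply Ctends_RtoC, near0_tends. Qed.

Lemma X_PS_tends (d : nat -> C) : poly_bounded d -> Ctends (fun m => PS d (X m)) (d O).
Proof.
intros Hd; rewrite <- (PS_0 d).
apply (Ctends_of_Cderive (PS d) 0 (PS (coef_deriv d) 0)); [|apply X_tends].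
apply is_Cderive_PS; [exact Hd | rewrite Cmod_0; lra].
Qed.

Lemma X_mult_tends_0 (v : nat -> C) (l : C) : Ctends v l -> Ctends (fun m => X m * v m) 0.
Proof.
intros H; apply Ctends_eq with (0 * l); [|ring]; apply Ctends_mult; [apply X_tends | exact H].
Qed.

Lemma X_Abel_tends (d : nat -> C) (l : C) :
  poly_bounded d -> Ctends d l -> Ctends (fun m => X m * PS d (1 - X m)) l.
Proof.
intros Hd Hl; apply Ctends_ext with (fun m => near0 m * PS d (RtoC (1 - near0 m)%R)).
- intros m; rewrite RtoC_minus; reflexivity.
- apply Abel_near0; assumption.
Qed.

Lemma one_minus_X_tends : Ctends (fun m => 1 - X m) 1.
Proof.
apply Ctends_eq with (1 - 0); [|ring].
apply Ctends_minus; [apply Ctends_const | apply X_tends].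
Qed.

Lemma F_tends : Ctends (fun m => F (X m)) 1.
Proof.
replace (RtoC 1) with (c O) by (unfold c, hyp_coef; simpl; field).
apply (X_PS_tends c), poly_bounded_hyp_coef_1.
Qed.

Lemma F1_tends : exists l : C, Ctends (fun m => F1 (X m)) l.
Proof. eexists; apply (X_PS_tends (coef_deriv c)), poly_bounded_deriv, poly_bounded_hyp_coef_1. Qed.

Lemma X_F2_tends : Ctends (fun m => X m * F2 (X m)) 0.
Proof.
apply (X_Abel_tends c 0); [apply poly_bounded_hyp_coef_1|].
apply Ctends_incr_1.
apply Ctends_ext with (fun n => log_coef a n * RtoC (/ (INR n + 1))%R).
- intros n; unfold log_coef, coef_deriv; pose proof (pos_INR n).
  rewrite <- S_INR, RtoC_inv by (apply not_0_INR; discriminate).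
  fold c; field; apply INR_S_neq_0.
- apply Ctends_eq with (s * 0); [|ring]; apply Ctends_mult; [apply log_coef_tends|].
  apply Ctends_RtoC, is_lim_seq_inv_INR_1.
Qed.

(** F(1-x) has the singularity - s log x at 0. *)
Lemma X_F21_tends : Ctends (fun m => X m * F21 (X m)) (- s).
Proof.
apply Ctends_ext with (fun m => - (1) * (X m * F1 (1 - X m))).
- intros m; unfold F21; ring.
- apply Ctends_eq with (- (1) * s); [|ring]; apply Ctends_scal, (X_Abel_tends (coef_deriv c)).
  + apply poly_bounded_deriv, poly_bounded_hyp_coef_1.
  + apply log_coef_tends.
Qed.

Lemma X_u_tends : Ctends (fun m => X m * u (X m)) 0.
Proof.
apply Ctends_ext with (fun m => X m * log_series (X m) - X m * log_series (1 - X m)).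
- intros m; unfold u; ring.
- apply Ctends_eq with (0 - 0); [|ring]; apply Ctends_minus.
  + apply X_mult_tends_0 with (log_series_coef O), (X_PS_tends log_series_coef), poly_bounded_log_series.
  + apply (X_Abel_tends log_series_coef); [apply poly_bounded_log_series|].
    apply Ctends_incr_1; apply Ctends_ext with (fun n => RtoC (/ (INR n + 1))%R).
    * intros n; unfold log_series_coef; rewrite <- S_INR, RtoC_inv; [reflexivity|].
      apply not_0_INR; discriminate.
    * apply Ctends_RtoC, is_lim_seq_inv_INR_1.
Qed.

Lemma X_u1_tends : Ctends (fun m => X m * u1 (X m)) 1.
Proof.
apply Ctends_ext with (fun m => / (1 - X m)).
- intros m; unfold u1; destruct (lens_neq_0 _ (X_lens m)); field; split; assumption.
- apply Ctends_eq with (/ 1); [|field].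
  apply Ctends_inv; [exact C1_nz | apply one_minus_X_tends|].
  intros m; apply (lens_neq_0 _ (X_lens m)).
Qed.

(** The value is read off at 0, where x F(1-x) tends to 0 and the derivative of F(1-x)
    is - s / x to leading order. *)
Lemma wronskian_F_F2 (x : C) : lens x -> weighted_wronskian F F1 F2 F21 x = - s.
Proof.
intros Hx; apply (Ctends_unique (fun m => weighted_wronskian F F1 F2 F21 (X m))).
- apply Ctends_ext with (fun _ => weighted_wronskian F F1 F2 F21 x); [|apply Ctends_const].
  intros m; apply (wronskian_const (a * (1 - a)));
    [apply hyp_solution_F | apply hyp_solution_F2 | apply X_lens | exact Hx].
- destruct F1_tends as [l Hl].
  apply Ctends_ext with (fun m => (1 - X m) * (F (X m) * (X m * F21 (X m)) - F1 (X m) * (X m * F2 (X m)))).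
  + intros m; unfold weighted_wronskian; ring.
  + apply Ctends_eq with (1 * (1 * - s - l * 0)); [|ring].
    apply Ctends_mult; [apply one_minus_X_tends|]; apply Ctends_minus; apply Ctends_mult.
    * apply F_tends.
    * apply X_F21_tends.
    * exact Hl.
    * apply X_F2_tends.
Qed.

Let B := PI / (2 * Csin (PI * a)).
Let A := / 2 * Psi - B.
Let D (x : C) := G x - A * F x - B * F2 x - / 2 * (u x * F x).
Let D1 (x : C) := G1 x - A * F1 x - B * F21 x - / 2 * (u1 x * F x + u x * F1 x).

Lemma Csin_neq_0 : Csin (PI * a) <> 0.
Proof.
intros E; apply sin_PI_neq_0; unfold s; rewrite E; unfold Cdiv; ring.
Qed.

Lemma B_s : B * s = / 2.
Proof.
unfold B, s; pose proof Csin_neq_0; pose proof (RtoC_neq_0 _ PI_neq0).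
field; split; assumption.
Qed.

Lemma X_D_tends : Ctends (fun m => X m * D (X m)) 0.
Proof.
apply Ctends_ext with (fun m => X m * G (X m) - A * (X m * F (X m)) - B * (X m * F2 (X m))
   - / 2 * (X m * u (X m) * F (X m))).
- intros m; unfold D; ring.
- apply Ctends_eq with (0 - A * 0 - B * 0 - / 2 * (0 * 1)); [|ring].
  apply Ctends_minus; [apply Ctends_minus; [apply Ctends_minus|]|].
  + eapply X_mult_tends_0, (X_PS_tends (hyp_harmonic_coef a 1)), poly_bounded_hyp_harmonic_1.
  + eapply Ctends_scal, X_mult_tends_0, F_tends.
  + apply Ctends_scal, X_F2_tends.
  + apply Ctends_scal, Ctends_mult; [apply X_u_tends | apply F_tends].
Qed.

(** The coefficient [B] is chosen so that the logarithmic singularities cancel. *)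
Lemma X_D1_tends : Ctends (fun m => X m * D1 (X m)) 0.
Proof.
destruct F1_tends as [l Hl].
apply Ctends_ext with (fun m => X m * G1 (X m) - A * (X m * F1 (X m)) - B * (X m * F21 (X m))
   - / 2 * (X m * u1 (X m) * F (X m) + X m * u (X m) * F1 (X m))).
- intros m; unfold D1; ring.
- apply Ctends_eq with (0 - A * 0 - B * - s - / 2 * (1 * 1 + 0 * l)).
  2:{ transitivity (B * s - / 2); [ring | rewrite B_s; ring]. }
  apply Ctends_minus; [apply Ctends_minus; [apply Ctends_minus|]|].
  + eapply X_mult_tends_0, (X_PS_tends (coef_deriv (hyp_harmonic_coef a 1))), poly_bounded_deriv,
      poly_bounded_hyp_harmonic_1.
  + eapply Ctends_scal, X_mult_tends_0, Hl.
  + apply Ctends_scal, X_F21_tends.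
  + apply Ctends_scal, Ctends_plus; apply Ctends_mult;
      [apply X_u1_tends | apply F_tends | apply X_u_tends | exact Hl].
Qed.

Lemma wronskian_F_D (x : C) : lens x -> weighted_wronskian F F1 D D1 x = 0.
Proof.
intros Hx; apply (Ctends_unique (fun m => weighted_wronskian F F1 D D1 (X m))).
- apply Ctends_ext with (fun _ => weighted_wronskian F F1 D D1 x); [|apply Ctends_const].
  intros m; apply (wronskian_const (a * (1 - a)));
    [apply hyp_solution_F | apply hyp_solution_combination | apply X_lens | exact Hx].
- destruct F1_tends as [l Hl].
  apply Ctends_ext with (fun m => (1 - X m) * (F (X m) * (X m * D1 (X m)) - F1 (X m) * (X m * D (X m)))).
  + intros m; unfold weighted_wronskian; ring.
  + apply Ctends_eq with (1 * (1 * 0 - l * 0)); [|ring].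
    apply Ctends_mult; [apply one_minus_X_tends|]; apply Ctends_minus; apply Ctends_mult.
    * apply F_tends.
    * apply X_D1_tends.
    * exact Hl.
    * apply X_D_tends.
Qed.

Lemma one_minus_half : 1 - half = half.
Proof. unfold half; field. Qed.

Lemma D_half : D half = 0.
Proof.
unfold D, F2, u; rewrite one_minus_half, harmonic_at_half; unfold A; ring.
Qed.

(** At the midpoint F(1-x) and F(x) agree, so the second Wronskian vanishes with
    the first one. *)
Lemma wronskian_F2_D (x : C) : lens x -> weighted_wronskian F2 F21 D D1 x = 0.
Proof.
intros Hx; rewrite (wronskian_const (a * (1 - a)) _ _ _ _ half x);
  [|apply hyp_solution_F2 | apply hyp_solution_combination | apply lens_half | exact Hx].
rewrite <- (wronskian_F_D half lens_half).
unfold weighted_wronskian, F2; rewrite one_minus_half, D_half; ring.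
Qed.

(** D is a combination of the two Wronskians that vanish, divided by the one that does
    not. *)
Lemma D_zero (x : C) : lens x -> D x = 0.
Proof.
intros Hx.
assert (E : D x * weighted_wronskian F F1 F2 F21 x = 0).
{ transitivity (F2 x * weighted_wronskian F F1 D D1 x - F x * weighted_wronskian F2 F21 D D1 x).
  - unfold weighted_wronskian; ring.
  - rewrite wronskian_F_D, wronskian_F2_D by exact Hx; ring. }
rewrite wronskian_F_F2 in E by exact Hx.
replace (D x) with (D x * - s * - / s) by (field; apply sin_PI_neq_0).
rewrite E; ring.
Qed.

Theorem harmonic_connection (x : C) :
  lens x ->
  PS (hyp_harmonic_coef a 1) x
  = PI / (2 * Csin (PI * a)) * hyp2F1 a (1 - a) 1 (1 - x)
    + / 2 * (digamma (1 - a / 2) + digamma ((a + 1) / 2) - digamma 1 - digamma (1 / 2)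
             - PI / Csin (PI * a) - Clog ((1 - x) / x)) * hyp2F1 a (1 - a) 1 x.
Proof.
intros Hx; rewrite Clog_ratio by apply Hx.
change (hyp2F1 a (1 - a) 1 (1 - x)) with (F2 x).
change (hyp2F1 a (1 - a) 1 x) with (F x).
pose proof (D_zero x Hx) as E.
pose proof Csin_neq_0 as N.
assert (HB : PI / Csin (PI * a) = 2 * B) by (unfold B; field; exact N).
rewrite HB; fold B.
transitivity (PS (hyp_harmonic_coef a 1) x - D x); [rewrite E; ring|].
unfold D, A, u, Psi, G; field.
Qed.

End Connection.

Theorem theorem2 (a x : C)
  (ha : forall m : Z, a <> IZR m)
  (hx : (Cmod x < 1)%R) (hx' : (Cmod (1 - x) < 1)%R) :
  is_Cseries
    (fun k => let n := S k in
       pochhammer a n * pochhammer (1 - a) n / INR (fact n) ^ 2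
         * harmonic n * x ^ n)
    (PI / (2 * Csin (PI * a)) * hyp2F1 a (1 - a) 1 (1 - x)
     + / 2 * (digamma (1 - a / 2) + digamma ((a + 1) / 2)
              - digamma 1 - digamma (1 / 2)
              - PI / Csin (PI * a) - Clog ((1 - x) / x))
       * hyp2F1 a (1 - a) 1 x).
Proof.
rewrite <- (harmonic_connection a ha x (conj hx hx')).
apply is_Cseries_ext with (fun k => hyp_harmonic_coef a 1 (S k) * x ^ S k).
- intros k; unfold hyp_harmonic_coef, hyp_coef.
  rewrite shifted_harmonic_1, pochhammer_1; pose proof (INR_fact_C_neq_0 (S k)).
  cbv zeta; field; assumption.
- apply (is_Cseries_incr_1 (fun n => hyp_harmonic_coef a 1 n * x ^ n)).
  replace (hyp_harmonic_coef a 1 0 * x ^ 0 + PS (hyp_harmonic_coef a 1) x)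
    with (PS (hyp_harmonic_coef a 1) x)
    by (unfold hyp_harmonic_coef, shifted_harmonic; simpl; ring).
  apply PS_correct; [apply poly_bounded_hyp_harmonic_1 | exact hx].
Qed.
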